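(* For every $\varepsilon>0$ and every $\ell\in\mathbb R^m$ the boundary-value problem $$\begin{aligned} &\frac{d(F'z)}{dt}=-C'z+H'u+p,\qquad \frac{d(Fp)}{dt}=Cp+\varepsilon Q^{-1}z,\qquad \varepsilon u=RHp,\\ &F'z(T)+F^+Fp(T)=F'\ell,\qquad F'd=0,\qquad \frac1\varepsilon Fp(t_0)=Q_0^{-1}\big((F')^+F'z(t_0)-d\big) \end{aligned}$$ has a unique solution $(u,p,z,d)=(\hat u_\varepsilon,\hat p_\varepsilon,\hat z_\varepsilon,\hat d_\varepsilon)$. If $\ell\in\mathcal L(T)$, then there exist $\hat d\in\mathbb R^m$, $\hat u\in\mathbb L_2(t_0,T,\mathbb R^p)$ and $\hat z\in\mathbb L_2(t_0,T,\mathbb R^m)$ such that: 1) as $\varepsilon\to0$, $\hat d_\varepsilon\to\hat d$ in $\mathbb R^m$, and $\hat u_\varepsilon\to\hat u$, $\hat z_\varepsilon\to\hat z$ in $\mathbb L_2$; 2) $\hat u$ and $\hat z$ satisfy $\frac{d(F'\hat z)}{dt}=-C'(t)\hat z(t)+H'(t)\hat u(t)$, $F'\hat z(T)=F'\ell$; 3) $\hat u$ is the $\ell$-estimate, and the $\ell$-error is $$\hat\sigma(T,\ell)=\sigma(T,\ell,\hat u)=\Omega(\hat u,\hat z,\hat d):=\|R^{-\frac12}\hat u\|_{\mathbb L_2}^2+\big\|Q_0^{-\frac12}\big((F')^+F'\hat z(t_0)-\hat d\big)\big\|^2+\|Q^{-\frac12}\hat z\|_{\mathbb L_2}^2 .$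$
   Context: Notation. A prime denotes the transpose of a matrix, $F^+$ is the Moore–Penrose pseudoinverse, $Q^{\frac12}$ is the square root of a symmetric nonnegative matrix, $E$ is expectation, $\|\cdot\|$ is the Euclidean norm. $\mathbb L_2(t_0,T,\mathbb R^k)$ (abbreviated $\mathbb L_2$) is the space of square-integrable $\mathbb R^k$-valued functions on $[t_0,T]$, and $\mathbb H_1(t_0,T,\mathbb R^k)$ is the space of absolutely continuous $\mathbb R^k$-valued functions with derivative in $\mathbb L_2$. Data. $t_0<T$ are real numbers; $F\in\mathbb R^{m\times n}$ is a constant matrix; $C(t)\in\mathbb R^{m\times n}$ and $H(t)\in\mathbb R^{p\times n}$ are continuous in $t\in[t_0,T]$; $Q_0,Q(t)\in\mathbb R^{m\times m}$ and $R(t)\in\mathbb R^{p\times p}$ are symmetric positive definite, with $Q(t),Q^{-1}(t),R(t),R^{-1}(t)$ continuous on $[t_0,T]$. (The integer $p$ in $\mathbb R^p$ is the dimension of the observation space and should not be confused with the unknown function $p$ of the boundary-value problem.) State equation and observations: $$\frac{d(Fx)}{dt}=C(t)x(t)+f(t),\quad Fx(t_0)=x_0,\qquad y(t)=H(t)x(t)+\eta(t),$$ with $x_0\in\mathbb R^m$, $f\in\mathbb L_2(t_0,T,\mathbb R^m)$. A solution is a function $x\in\mathbb L_2(t_0,T,\mathbb R^n)$ such that $Fx\in\mathbb H_1(t_0,T,\mathbb R^m)$ (i.e. $Fx$ has an absolutely continuous representative, whose value at $t$ is denoted $Fx(t)$), the equation holds almost everywhere and the initial condition holds. Neither existence nor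 uniqueness of a solution is assumed. Similarly, in the boundary-value problem the unknowns are $u\in\mathbb L_2(t_0,T,\mathbb R^p)$, $p\in\mathbb L_2(t_0,T,\mathbb R^n)$ with $Fp\in\mathbb H_1(t_0,T,\mathbb R^m)$, $z\in\mathbb L_2(t_0,T,\mathbb R^m)$ with $F'z\in\mathbb H_1(t_0,T,\mathbb R^n)$, and $d\in\mathbb R^m$; differential equations hold almost everywhere, and $Fp(t)$, $F'z(t)$ denote the values of the absolutely continuous representatives. Uncertainty. $(x_0,f)$ is unknown and belongs to $$\mathscr G=\Big\{(x_0,f):\langle Q_0x_0,x_0\rangle+\int_{t_0}^T\langle Q(t)f(t),f(t)\rangle dt\le1\Big\}.$$ $\eta$ is a realization of an $\mathbb R^p$-valued random process with $E\eta(t)=0$ on $[t_0,T]$ and unknown correlation function $\mathcal R_\eta(t,s)=E\eta(t)\eta'(s)$ belonging to $$W=\Big\{\mathcal R_\eta:\int_{t_0}^T\mathrm{tr}\,(R(t)\mathcal R_\eta(t,t))dt\le1\Big\}.$$ Minimax estimation. For $\ell\in\mathbb R^m$, $u\in\mathbb L_2(t_0,T,\mathbb R^p)$ let $u(y)=\int_{t_0}^T\langle u(t),y(t)\rangle dt$ and define the mean-squared worst-case error $$\sigma(T,\ell,u)=\sup_{x,\,(x_0,f)\in\mathscr G,\,\mathcal R_\eta\in W}E\big[\langle\ell,Fx(T)\rangle-u(y)\big]^2\in[0,+\infty],$$ the supremum being over all $(x_0,f)\in\mathscr G$, all solutions $x$ of the state equation for $(x_0,f)$, and all admissible noises. The $\ell$-error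 is $\hat\sigma(T,\ell)=\inf_{u}\sigma(T,\ell,u)$, the infimum being over $u\in\mathbb L_2(t_0,T,\mathbb R^p)$. A function $\hat u\in\mathbb L_2(t_0,T,\mathbb R^p)$ (equivalently the functional $\hat u(y)$) with $\sigma(T,\ell,\hat u)=\hat\sigma(T,\ell)$ is called an $\ell$-estimate. The minimax observable subspace is $\mathcal L(T)=\{\ell\in\mathbb R^m:\hat\sigma(T,\ell)<+\infty\}$. *)

(* Defs.v *)
From HB Require Import structures.
From mathcomp Require Import all_boot all_order all_algebra.
From mathcomp Require Import all_classical all_reals all_analysis.

Set Implicit Arguments.
Unset Strict Implicit.
Unset Printing Implicit Defensive.

Import Order.TTheory GRing.Theory Num.Theory.
Import numFieldNormedType.Exports.

Local Open Scope classical_set_scope.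
Local Open Scope ring_scope.

Definition dotv (R : realType) (k : nat) (u v : 'cV[R]_k) : R :=
  \sum_(i < k) u i 0 * v i 0.

(* Euclidean norm; the library norm on matrices is the sup norm. *)
Definition enorm (R : realType) (k : nat) (v : 'cV[R]_k) : R :=
  Num.sqrt (dotv v v).

Definition sym_posdef (R : realType) (k : nat) (A : 'M[R]_k) : Prop :=
  A^T = A /\ forall v : 'cV[R]_k, v != 0 -> 0 < dotv (A *m v) v.

Definition sym_possemidef (R : realType) (k : nat) (A : 'M[R]_k) : Prop :=
  A^T = A /\ forall v : 'cV[R]_k, 0 <= dotv (A *m v) v.

(* Meaningful for symmetric nonnegative A, for which the set below is a
   singleton. *)
Definition sqrtmx (R : realType) (k : nat) (A : 'M[R]_k) : 'M[R]_k :=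
  xget 0 [set S : 'M[R]_k | sym_possemidef S /\ S *m S = A].

(* Moore-Penrose pseudoinverse: the four Penrose equations always have exactly
   one solution X. *)
Definition pinv (R : realType) (m n : nat) (A : 'M[R]_(m, n)) : 'M[R]_(n, m) :=
  xget 0 [set X : 'M[R]_(n, m) |
    [/\ A *m X *m A = A, X *m A *m X = X,
        (A *m X)^T = A *m X & (X *m A)^T = X *m A]].

(* Functions of time are total functions on R of which only the restriction to
   [a, b] is relevant; elements of L_2 are represented by Borel functions and
   compared almost everywhere on [a, b]. *)
Definition L2 (R : realType) (a b : R) (k : nat) : set (R -> 'cV[R]_k) :=
  [set f : R -> 'cV[R]_k | (forall i, measurable_fun `[a, b] (fun t => f t i 0)) /\
    (\int[lebesgue_measure]_(t in `[a, b]) ((enorm (f t) ^+ 2)%R)%:E < +oo)%E].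

Definition L2norm (R : realType) (a b : R) (k : nat) (f : R -> 'cV[R]_k) : R :=
  Num.sqrt (\int[lebesgue_measure]_(t in `[a, b]) (enorm (f t) ^+ 2)).

Definition abs_continuous (R : realType) (a b : R) (k : nat)
    (g : R -> 'cV[R]_k) : Prop :=
  forall e : R, 0 < e -> exists2 del : R, 0 < del &
    forall (N : nat) (s t : 'I_N -> R),
      (forall i, a <= s i /\ s i < t i /\ t i <= b) ->
      trivIset setT (fun i => `]s i, t i[%classic) ->
      \sum_(i < N) (t i - s i) < del ->
      \sum_(i < N) enorm (g (t i) - g (s i)) < e.

Definition ae_derive (R : realType) (a b : R) (k : nat)
    (g w : R -> 'cV[R]_k) : Prop :=
  {ae lebesgue_measure, forall t : R, t \in `[a, b] ->
     forall i, is_derive t 1 (fun s => g s i 0) (w t i 0)}.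

Definition H1 (R : realType) (a b : R) (k : nat) : set (R -> 'cV[R]_k) :=
  [set g : R -> 'cV[R]_k | abs_continuous a b g /\ exists2 w, L2 a b w & ae_derive a b g w].

(* v, as a class of almost everywhere equal functions, belongs to H_1. *)
Definition in_H1 (R : realType) (a b : R) (k : nat) (v : R -> 'cV[R]_k) :=
  exists2 g, H1 a b g & ae_eq lebesgue_measure `[a, b]%classic g v.

(* Absolutely continuous representative of v; its values on [a, b] do not
   depend on the choice made by xget. *)
Definition acrep (R : realType) (a b : R) (k : nat) (v : R -> 'cV[R]_k) :
    R -> 'cV[R]_k :=
  xget (fun=> 0) [set g : R -> 'cV[R]_k | H1 a b g /\ ae_eq lebesgue_measure `[a, b]%classic g v].

Definition state_solution (R : realType) (m n : nat) (t0 T : R)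
    (F : 'M[R]_(m, n)) (C : R -> 'M[R]_(m, n))
    (x0 : 'cV[R]_m) (f : R -> 'cV[R]_m) (x : R -> 'cV[R]_n) : Prop :=
  let Fx := acrep t0 T (fun t => F *m x t) in
  [/\ L2 t0 T x, in_H1 t0 T (fun t => F *m x t),
      ae_derive t0 T Fx (fun t => C t *m x t + f t)
    & Fx t0 = x0].

Definition calG (R : realType) (m : nat) (t0 T : R)
    (Q0 : 'M[R]_m) (Q : R -> 'M[R]_m) : set ('cV[R]_m * (R -> 'cV[R]_m)) :=
  [set xf | L2 t0 T xf.2 /\
    ((dotv (Q0 *m xf.1) xf.1)%:E +
     \int[lebesgue_measure]_(t in `[t0, T])
       (dotv (Q t *m xf.2 t) (xf.2 t))%:E <= 1)%E].

(* Centered second-order process on [t0, T]. Joint measurability in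
   (time, event) makes the random functional \int <u(t), eta(t)> dt and its
   moments meaningful. *)
Definition centered_process (R : realType) (q : nat) (t0 T : R)
    (dsp : measure_display) (Om : measurableType dsp) (P : probability Om R)
    (eta : R -> Om -> 'cV[R]_q) : Prop :=
  [/\ forall i, measurable_fun (`[t0, T] `*` [set: Om])
        (fun tw : measurableTypeR R * Om => eta tw.1 tw.2 i 0),
      forall t, t \in `[t0, T] ->
        ('E_P[(fun w => enorm (eta t w) ^+ 2)%R] < +oo)%E
    & forall t, t \in `[t0, T] -> forall i,
        ('E_P[(fun w => eta t w i 0)%R] = 0)%E].

Definition correlation (R : realType) (q : nat)
    (dsp : measure_display) (Om : measurableType dsp) (P : probability Om R)
    (eta : R -> Om -> 'cV[R]_q) (t s : R) : 'M[R]_q :=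
  \matrix_(i, j) fine ('E_P[(fun w => (eta t w *m (eta s w)^T) i j)%R])%E.

Definition calW (R : realType) (q : nat) (t0 T : R) (Rn : R -> 'M[R]_q) :
    set (R -> R -> 'M[R]_q) :=
  [set K | (\int[lebesgue_measure]_(t in `[t0, T])
              (\tr (Rn t *m K t t))%:E <= 1)%E].

Definition obs_functional (R : realType) (q : nat) (t0 T : R)
    (u y : R -> 'cV[R]_q) : R :=
  \int[lebesgue_measure]_(t in `[t0, T]) dotv (u t) (y t).

(* The supremum also ranges over the probability space carrying the noise. *)
Definition sigma (R : realType) (m n q : nat) (t0 T : R)
    (F : 'M[R]_(m, n)) (C : R -> 'M[R]_(m, n)) (H : R -> 'M[R]_(q, n))
    (Q0 : 'M[R]_m) (Q : R -> 'M[R]_m) (Rn : R -> 'M[R]_q)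
    (l : 'cV[R]_m) (u : R -> 'cV[R]_q) : \bar R :=
  ereal_sup [set v : \bar R |
    exists (x0 : 'cV[R]_m) (f : R -> 'cV[R]_m) (x : R -> 'cV[R]_n)
           (dsp : measure_display) (Om : measurableType dsp)
           (P : probability Om R) (eta : R -> Om -> 'cV[R]_q),
      [/\ calG t0 T Q0 Q (x0, f), state_solution t0 T F C x0 f x,
          centered_process t0 T P eta,
          calW t0 T Rn (correlation P eta)
        & v = ('E_P[(fun w =>
            (dotv l (acrep t0 T (fun t => F *m x t) T)
             - obs_functional t0 T u (fun t => H t *m x t + eta t w)) ^+ 2)%R])%E]].

Definition sigma_hat (R : realType) (m n q : nat) (t0 T : R)
    (F : 'M[R]_(m, n)) (C : R -> 'M[R]_(m, n)) (H : R -> 'M[R]_(q, n))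
    (Q0 : 'M[R]_m) (Q : R -> 'M[R]_m) (Rn : R -> 'M[R]_q)
    (l : 'cV[R]_m) : \bar R :=
  ereal_inf [set sigma t0 T F C H Q0 Q Rn l u | u in @L2 R t0 T q].

Definition l_estimate (R : realType) (m n q : nat) (t0 T : R)
    (F : 'M[R]_(m, n)) (C : R -> 'M[R]_(m, n)) (H : R -> 'M[R]_(q, n))
    (Q0 : 'M[R]_m) (Q : R -> 'M[R]_m) (Rn : R -> 'M[R]_q)
    (l : 'cV[R]_m) (u : R -> 'cV[R]_q) : Prop :=
  L2 t0 T u /\
  sigma t0 T F C H Q0 Q Rn l u = sigma_hat t0 T F C H Q0 Q Rn l.

Definition minimax_observable (R : realType) (m n q : nat) (t0 T : R)
    (F : 'M[R]_(m, n)) (C : R -> 'M[R]_(m, n)) (H : R -> 'M[R]_(q, n))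
    (Q0 : 'M[R]_m) (Q : R -> 'M[R]_m) (Rn : R -> 'M[R]_q) : set 'cV[R]_m :=
  [set l | (sigma_hat t0 T F C H Q0 Q Rn l < +oo)%E].

Definition bvp_solution (R : realType) (m n q : nat) (t0 T : R)
    (F : 'M[R]_(m, n)) (C : R -> 'M[R]_(m, n)) (H : R -> 'M[R]_(q, n))
    (Q0 : 'M[R]_m) (Q : R -> 'M[R]_m) (Rn : R -> 'M[R]_q)
    (l : 'cV[R]_m) (eps : R)
    (u : R -> 'cV[R]_q) (p : R -> 'cV[R]_n) (z : R -> 'cV[R]_m)
    (d : 'cV[R]_m) : Prop :=
  let Ftz := acrep t0 T (fun t => F^T *m z t) in
  let Fp := acrep t0 T (fun t => F *m p t) in
  [/\ [/\ L2 t0 T u, L2 t0 T p & L2 t0 T z],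
      in_H1 t0 T (fun t => F *m p t) /\ in_H1 t0 T (fun t => F^T *m z t),
      [/\ ae_derive t0 T Ftz
            (fun t => - ((C t)^T *m z t) + (H t)^T *m u t + p t),
          ae_derive t0 T Fp
            (fun t => C t *m p t + eps *: (invmx (Q t) *m z t))
        & ae_eq lebesgue_measure `[t0, T]%classic
            (fun t => eps *: u t) (fun t => Rn t *m H t *m p t)]
    & [/\ Ftz T + pinv F *m Fp T = F^T *m l,
          F^T *m d = 0
        & eps^-1 *: Fp t0 = invmx Q0 *m (pinv F^T *m Ftz t0 - d)]].

Definition Omega (R : realType) (m n q : nat) (t0 T : R) (F : 'M[R]_(m, n))
    (Q0 : 'M[R]_m) (Q : R -> 'M[R]_m) (Rn : R -> 'M[R]_q)
    (u : R -> 'cV[R]_q) (z : R -> 'cV[R]_m) (d : 'cV[R]_m) : R :=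
  L2norm t0 T (fun t => sqrtmx (invmx (Rn t)) *m u t) ^+ 2
  + enorm (sqrtmx (invmx Q0) *m
      (pinv F^T *m acrep t0 T (fun t => F^T *m z t) t0 - d)) ^+ 2
  + L2norm t0 T (fun t => sqrtmx (invmx (Q t)) *m z t) ^+ 2.

(* Main.v *)
Require Import Defs.
From HB Require Import structures.
From mathcomp Require Import all_boot all_order all_algebra.
From mathcomp Require Import all_classical all_reals all_analysis.
From mathcomp Require Import measurable_realfun complex.
From mathcomp Require Import ring lra.

Set Implicit Arguments.
Unset Strict Implicit.
Unset Printing Implicit Defensive.

Import Order.TTheory GRing.Theory Num.Theory.
Import numFieldNormedType.Exports.

Local Open Scope classical_set_scope.
Local Open Scope ring_scope.

(** Admissible unknowns are tuples [(u, z, p, g, d)] where [z] solves the adjoint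
    equation [(F' z)' = - C' z + H' u + p], [g] is the absolutely continuous
    representative of [F' z], and [F' d = 0]. On them lives the energy form
    [<R^-1 u, u> + <Q^-1 z, z> + <Q0^-1 a, a>], [a = (F')^+ g(t0) - d], which on
    the diagonal is [Omega]. Everything rests on Green's formula [green]: against
    a solution [x] of the state equation the adjoint equation integrates to
    boundary terms, and the pseudoinverse only inserts projectors that fix [F x]
    and [F' z] and are therefore invisible.

    For positive [eps] the boundary value problem is the Euler-Lagrange system of
    the minimisation of the energy plus [1/eps] times the squared residual
    [|p|^2 + |F' z(T) - F' l|^2]. The quadratic form is coercive for the graph
    norm of the adjoint operator, and the admissible tuples are complete for that
    norm ([adm_complete]), so a minimiser exists by the Riesz argument ([riesz]);
    testing the variational identity against enough tuples gives back the
    equations ([bvp_exists]). The rescaled residual [p / eps] solves the state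
    equation with input [Q^-1 z] and initial value [Q0^-1 a], and Green's formula
    applied to it yields uniqueness ([bvp_unique]).

    The estimation error is bounded from both sides by such pairs. If the
    residual vanishes, then Green's formula turns the deterministic error into a
    pairing of [(a, z)] with [(x0, f)], which Cauchy-Schwarz bounds on the
    ellipsoid, while the noise contributes [<R^-1 u, u>]: hence [sigma_le],
    through [noise_upper]. Conversely the state [p / eps], normalised into the
    ellipsoid, together with a random sign times [R^-1 u] as noise, shows that
    every [u] has an error of at least the energy of the regularised solution
    plus twice its weighted residual ([bvp_le_sigma]).

    Along [eps -> 0] the energies therefore increase and are bounded by the error
    of any estimate of finite error. Since the squared energy distance between
    two regularised solutions is at most the difference of their energies
    ([bvp_cauchy]) and the residual is [O(eps)], they converge in graph norm to
    an admissible tuple without residual ([limit_exists]). For its [u] the upper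
    bound meets the lower bound, so [u] is the estimate and its error is [Omega]. *)

(** * Inequalities between real numbers *)

Section RealInequalities.
Context (R : realType).

Lemma discriminant (A B C : R) : (forall s, 0 <= A + 2 * s * B + s ^+ 2 * C) ->
  0 <= C -> B ^+ 2 <= A * C.
Proof.
move=> h; rewrite le_eqVlt => /predU1P[C0|C0].
  have [->|B0] := eqVneq B 0; first by rewrite -C0 mulr0 expr0n.
  have := h (- (A + 1) / (2 * B)); rewrite -C0 mulr0 addr0.
  have -> : A + 2 * (- (A + 1) / (2 * B)) * B = -1 by field.
  by rewrite oppr_ge0 ler10.
have := h (- B / C).
have -> : A + 2 * (- B / C) * B + (- B / C) ^+ 2 * C = (A * C - B ^+ 2) / C.
  by field; rewrite gt_eqF.
by rewrite pmulr_lge0 ?invr_gt0// subr_ge0.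
Qed.

Lemma am_gm (x y z : R) : 0 <= y -> 0 <= z -> x ^+ 2 <= y * z -> 2 * x <= y + z.
Proof.
move=> y0 z0 xyz; rewrite leNgt; apply/negP => h.
have yz0 : 0 <= y + z by rewrite addr_ge0.
have := ltr_pM yz0 yz0 h h; have := sqr_ge0 (y - z); rewrite !expr2 in xyz *.
have -> : (y - z) * (y - z) = y * y + z * z - 2 * (y * z) by ring.
have -> : (y + z) * (y + z) = y * y + z * z + 2 * (y * z) by ring.
have -> : 2 * x * (2 * x) = 4 * (x * x) by ring.
by lra.
Qed.

(** The monotonicity behind the regularisation: [e] and [d] are the energies for
    the weights [x <= y] of the residual, [c] their mixed term, [A], [B], [K] the
    matching residual forms. If [K > A], then Cauchy-Schwarz makes [B - K]
    exceed [K - A], and the two identities contradict [2 c <= e + d]. *)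
Lemma discriminant_le (e d c A B K x y : R) : 0 < x -> x <= y -> 0 <= A -> 0 <= B ->
  K ^+ 2 <= A * B -> 0 <= e + d - 2 * c ->
  e + x * A = c + x * K -> d + y * B = c + y * K -> e <= c.
Proof.
move=> x0 xy A0 B0 KAB edc h1 h2.
suff KA : K <= A by have := ler_wpM2l (ltW x0) KA; lra.
rewrite leNgt; apply/negP => AK.
have K0 : 0 < K by apply: le_lt_trans AK.
have Ap : 0 < A.
  rewrite lt_neqAle A0 andbT eq_sym; apply/negP => /eqP A00.
  by move: KAB; rewrite A00 mul0r leNgt exprn_gt0.
have BK : K - A < B - K.
  rewrite -(ltr_pM2l Ap).
  have : A * (K - A) < K * (K - A) by rewrite ltr_pM2r// subr_gt0.
  by move: KAB; rewrite expr2; lra.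
have := ltr_pM2l x0 (K - A) (B - K); rewrite BK => h3.
have : x * (B - K) <= y * (B - K).
  by rewrite ler_wpM2r//; apply: le_trans (ltW BK); rewrite subr_ge0 ltW.
by lra.
Qed.

End RealInequalities.

(** * Linear algebra *)

Section Dotv.
Context (R : realType).

Lemma dotvE k (u v : 'cV[R]_k) : dotv u v = (u^T *m v) 0 0.
Proof. by rewrite mxE; apply: eq_bigr => i _; rewrite mxE. Qed.

Lemma dotvC k (u v : 'cV[R]_k) : dotv u v = dotv v u.
Proof. by apply: eq_bigr => i _; rewrite mulrC. Qed.

Lemma dotvDl k (u v w : 'cV[R]_k) : dotv (u + v) w = dotv u w + dotv v w.
Proof. by rewrite !dotvE linearD mulmxDl mxE. Qed.

Lemma dotvZl k c (u v : 'cV[R]_k) : dotv (c *: u) v = c * dotv u v.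
Proof. by rewrite !dotvE linearZ -scalemxAl mxE. Qed.

Lemma dotvDr k (u v w : 'cV[R]_k) : dotv w (u + v) = dotv w u + dotv w v.
Proof. by rewrite !(dotvC w) dotvDl. Qed.

Lemma dotvZr k c (u v : 'cV[R]_k) : dotv u (c *: v) = c * dotv u v.
Proof. by rewrite !(dotvC u) dotvZl. Qed.

Lemma dotvNl k (u v : 'cV[R]_k) : dotv (- u) v = - dotv u v.
Proof. by rewrite -scaleN1r dotvZl mulN1r. Qed.

Lemma dotvNr k (u v : 'cV[R]_k) : dotv u (- v) = - dotv u v.
Proof. by rewrite dotvC dotvNl dotvC. Qed.

Lemma dotvBl k (u v w : 'cV[R]_k) : dotv (u - v) w = dotv u w - dotv v w.
Proof. by rewrite dotvDl dotvNl. Qed.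

Lemma dotvBr k (u v w : 'cV[R]_k) : dotv w (u - v) = dotv w u - dotv w v.
Proof. by rewrite dotvDr dotvNr. Qed.

Lemma dotv0l k (u : 'cV[R]_k) : dotv 0 u = 0.
Proof. by rewrite -(scale0r 0) dotvZl mul0r. Qed.

Lemma dotv0r k (u : 'cV[R]_k) : dotv u 0 = 0.
Proof. by rewrite dotvC dotv0l. Qed.

Lemma dotv_mulmxl k l (A : 'M[R]_(k, l)) u v :
  dotv (A *m u) v = dotv u (A^T *m v).
Proof. by rewrite !dotvE trmx_mul mulmxA. Qed.

Lemma dotv_mulmxr k l (A : 'M[R]_(k, l)) u v :
  dotv v (A *m u) = dotv (A^T *m v) u.
Proof. by rewrite dotvC dotv_mulmxl dotvC. Qed.

Lemma dotv_ge0 k (u : 'cV[R]_k) : 0 <= dotv u u.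
Proof. by apply: sumr_ge0 => i _; rewrite -expr2 sqr_ge0. Qed.

Lemma dotv_eq0 k (u : 'cV[R]_k) : dotv u u = 0 -> u = 0.
Proof.
move=> /eqP; rewrite psumr_eq0; last by move=> i _; rewrite -expr2 sqr_ge0.
move=> /allP h; apply/matrixP => i j; rewrite mxE ord1.
by apply/eqP; have := h i; rewrite mem_index_enum -expr2 sqrf_eq0; apply.
Qed.

Lemma enorm_sqr k (u : 'cV[R]_k) : enorm u ^+ 2 = dotv u u.
Proof. by rewrite sqr_sqrtr ?dotv_ge0. Qed.

Lemma le_sqr_dotv k (u : 'cV[R]_k) i : u i 0 ^+ 2 <= dotv u u.
Proof.
rewrite /dotv (bigD1 i)//= -expr2 lerDl.
by apply: sumr_ge0 => j _; rewrite -expr2 sqr_ge0.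
Qed.

Lemma posdef_possemidef k (A : 'M[R]_k) : sym_posdef A -> sym_possemidef A.
Proof.
move=> [sA pA]; split=> // v; have [->|/pA/ltW//] := eqVneq v 0.
by rewrite mulmx0 dotv0r.
Qed.

Lemma posdef_unitmx k (A : 'M[R]_k) : sym_posdef A -> A \in unitmx.
Proof.
move=> [sA pA]; rewrite -sA unitmx_tr -row_free_unit -kermx_eq0.
apply/rowV0P => v /sub_kermxP vA.
apply/eqP; rewrite -(inj_eq trmx_inj) trmx0; apply/negPn/negP => /pA.
have -> : A *m v^T = 0 by rewrite -(trmxK (A *m _)) trmx_mul trmxK sA vA trmx0.
by rewrite dotv0l ltxx.
Qed.

Lemma posdef_inv k (A : 'M[R]_k) : sym_posdef A -> sym_posdef (invmx A).
Proof.
move=> pdA; have uA := posdef_unitmx pdA; have [sA pA] := pdA.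
split; first by rewrite trmx_inv sA.
move=> v v0; have : invmx A *m v != 0.
  by apply: contra v0 => /eqP /(congr1 (mulmx A)); rewrite mulKVmx// mulmx0 => ->.
by move=> /pA; rewrite mulKVmx// dotvC.
Qed.

(** Cauchy-Schwarz for the form of [A], at [A^-1 v] and [v]: an upper bound on a
    positive form is a lower bound on the inverse form. *)
Lemma posdef_inv_coercive k (A : 'M[R]_k) (K : R) (v : 'cV[R]_k) :
  sym_posdef A -> dotv (A *m v) v <= K * dotv v v ->
  dotv v v <= K * dotv (invmx A *m v) v.
Proof.
move=> pdA leK; have uA := posdef_unitmx pdA.
have [_ pA] := posdef_possemidef pdA; have [sA _] := pdA.
have [->|v0] := eqVneq v 0; first by rewrite mulmx0 dotv0l mulr0.
set w := invmx A *m v; have Aw : A *m w = v by rewrite mulKVmx.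
have vv : 0 < dotv v v.
  by rewrite lt_neqAle dotv_ge0 andbT eq_sym; apply: contra v0 => /eqP/dotv_eq0->.
have K0 : 0 < K.
  rewrite ltNge; apply/negP => Kle0.
  have := lt_le_trans (pdA.2 _ v0) leK.
  by rewrite ltNge (mulr_le0_ge0 Kle0 (ltW vv)).
have := pA (K *: w - v); rewrite mulmxBr -scalemxAr Aw.
rewrite !(dotvBl, dotvBr, dotvZl, dotvZr).
rewrite (dotv_mulmxl A v) sA Aw (dotvC v w) => h.
have {}h : 0 <= K * (K * dotv w v - dotv v v).
  by move: h leK; rewrite mulrBr; lra.
by move: h; rewrite pmulr_rge0// subr_ge0 dotvC.
Qed.

Lemma dotv_add_le k (x y : 'cV[R]_k) : dotv (x + y) (x + y) <= 2 * dotv x x + 2 * dotv y y.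
Proof.
have := dotv_ge0 (x - y).
by rewrite !(dotvBl, dotvBr, dotvDl, dotvDr) (dotvC y x); lra.
Qed.

(** The crude constants spare a square root wherever only finiteness or
    convergence to zero matters. *)
Lemma dotv_am k (x y : 'cV[R]_k) : dotv x y <= dotv x x + dotv y y.
Proof.
have := dotv_ge0 (x - y); have := dotv_ge0 x; have := dotv_ge0 y.
by rewrite !(dotvBl, dotvBr) (dotvC y x); lra.
Qed.

(** Completing the square: the left-hand side is the form of [M] at
    [e + s M^-1 u]. Every Cauchy-Schwarz inequality for a weight and its inverse
    comes from the discriminant of this quadratic in [s]. *)
Lemma posdef_square_ge0 k (M : 'M[R]_k) s (u e : 'cV[R]_k) : sym_posdef M ->
  0 <= dotv (M *m e) e + 2 * s * dotv u e + s ^+ 2 * dotv u (invmx M *m u).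
Proof.
move=> pM; have uM := posdef_unitmx pM.
have := (posdef_possemidef pM).2 (e + s *: (invmx M *m u)).
rewrite mulmxDr -scalemxAr (mulKVmx uM) dotvDl !dotvDr !dotvZl !dotvZr.
have -> : dotv (M *m e) (invmx M *m u) = dotv u e.
  by rewrite dotv_mulmxl pM.1 (mulKVmx uM) dotvC.
by congr (0 <= _); ring.
Qed.

End Dotv.

Section Sqrt.
Context (R : realType).

(** Lagrange interpolation on an arbitrary list, with repetitions allowed. *)
Lemma interpolation (F : fieldType) (f : F -> F) (s : seq F) :
  exists r : {poly F}, forall x, x \in s -> r.[x] = f x.
Proof.
elim: s => [|a s [r rP]]; first by exists 0.
have [as_|aNs] := boolP (a \in s).
  by exists r => x; rewrite inE => /orP[/eqP->|]; apply: rP.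
pose w := \prod_(b <- s) ('X - b%:P).
have wa : w.[a] != 0 by have := root_prod_XsubC s a; rewrite rootE => ->.
exists (r + ((f a - r.[a]) / w.[a])%:P * w) => x.
rewrite !hornerE inE => /orP[/eqP->|xs].
  by rewrite divfK// addrC subrK.
have /rootP -> : root w x by rewrite root_prod_XsubC.
by rewrite mulr0 addr0 rP.
Qed.

(** A polynomial taking the values of the fourth root on the spectrum of [A]
    is evaluated at [A]; the spectral theorem, over the complex numbers, shows
    that the fourth power of the result is [A], so that its square is a
    square root of [A], and it is nonnegative because it is itself the square
    of a symmetric matrix. *)
Lemma sqrtmx_exists k (A : 'M[R]_k) : sym_possemidef A ->
  exists S : 'M[R]_k, sym_possemidef S /\ S *m S = A.
Proof.
case: k A => [|k] A [sA pA].
  exists 0; split; last by apply/matrixP => -[].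
  by split=> [|v]; [rewrite trmx0|rewrite mul0mx dotv0l].
pose f := real_complex R.
pose AC : 'M[R[i]]_k.+1 := map_mx f A.
have AC_real : AC \is a mxOver Num.real.
  by apply/mxOverP => i j; rewrite mxE; apply/complex_realP; exists (A i j).
have AC_herm : AC \is hermitianmx _ false Num.Def.conjC.
  apply: realsym_hermsym => //.
  by apply/is_hermitianmxP/matrixP => i j; rewrite expr0 scale1r !mxE/= -[in LHS]sA mxE.
have /hermitian_normalmx/orthomx_spectralP := AC_herm.
have /mxOverP sp_real := hermitian_spectral_diag_real AC_herm.
have := spectral_unit AC.
move: (spectralmx AC) (spectral_diag AC) sp_real => P sp sp_real uP ACE.
have dP i : sp 0 i = f (complex.Re (sp 0 i)) by rewrite /f RRe_real.
have d_ge0 i : 0 <= complex.Re (sp 0 i).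
  have : eigenvalue AC (sp 0 i).
    apply/eigenvalueP; exists (row i P); last first.
      by apply: contraTneq uP => rP0; rewrite -row_free_unit; apply/negP => /row_freeP[B PB];
         have := congr1 (row i) PB; rewrite row_mul rP0 mul0mx => /matrixP/(_ 0 i);
         rewrite !mxE eqxx => /eqP; rewrite eq_sym oner_eq0.
    rewrite ACE -row_mul !mulmxA mulmxV// mul1mx.
    by rewrite row_mul row_diag_mx -scalemxAl -rowE.
  rewrite eigenvalue_root_char -map_char_poly dP fmorph_root -eigenvalue_root_char.
  move=> /eigenvalueP[v vA v0].
  have vv : 0 < dotv v^T v^T.
    rewrite lt_neqAle dotv_ge0 andbT; apply: contra v0 => /eqP/esym/dotv_eq0.
    by move=> /(congr1 trmx); rewrite trmxK trmx0 => ->.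
  have := pA v^T; have -> : A *m v^T = (v *m A)^T by rewrite trmx_mul sA.
  by rewrite vA linearZ dotvZl pmulr_lge0.
have [r rP] := interpolation (fun x => Num.sqrt (Num.sqrt x))
  [seq complex.Re (sp 0 i) | i <- enum 'I_k.+1].
have r4 i : (r ^+ 4).[complex.Re (sp 0 i)] = complex.Re (sp 0 i).
  rewrite horner_exp rP; last by apply/mapP; exists i; rewrite ?mem_enum.
  by rewrite (exprM _ 2 2) !sqr_sqrtr ?sqrtr_ge0.
pose M := horner_mx A r.
have MT : M^T = M.
  rewrite /M; elim/poly_ind: r {rP r4 M} => [|p c IH].
    by rewrite rmorph0 trmx0.
  rewrite rmorphD rmorphM /= horner_mx_X horner_mx_C linearD /= trmx_mul sA IH.
  by rewrite tr_scalar_mx; congr (_ + _); apply: comm_mx_horner.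
exists (M *m M); split; last first.
  have -> : M *m M *m (M *m M) = horner_mx A (r ^+ 4).
    by rewrite rmorphXn/= -/M (exprM _ 2 2) !expr2.
  apply/(map_mx_inj (f := f)); rewrite map_horner_mx -/AC {1}ACE.
  have hc := horner_mx_uconjC (map_poly f (r ^+ 4)) (diag_mx sp) uP.
  have e : map_mx (horner (map_poly f (r ^+ 4))) sp = sp.
    by apply/rowP => i; rewrite mxE dP horner_map r4.
  rewrite [LHS]hc horner_mx_diag e.
  exact: (esym ACE).
split=> [|v]; first by rewrite trmx_mul MT.
by rewrite -mulmxA dotv_mulmxl MT dotv_ge0.
Qed.

Lemma sqrtmxP k (A : 'M[R]_k) : sym_possemidef A ->
  (sqrtmx A)^T = sqrtmx A /\ sqrtmx A *m sqrtmx A = A.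
Proof.
move=> /sqrtmx_exists[S hS]; rewrite /sqrtmx.
by case: xgetP => [S' _ [[]]|/(_ S)/(_ hS)].
Qed.

Lemma enorm_sqrtmx k (A : 'M[R]_k) v : sym_possemidef A ->
  enorm (sqrtmx A *m v) ^+ 2 = dotv (A *m v) v.
Proof.
move=> /sqrtmxP[sS SS].
by rewrite enorm_sqr dotv_mulmxl sS mulmxA SS dotvC.
Qed.

End Sqrt.

Section Pinv.
Context (R : realType).

Definition penrose m n (A : 'M[R]_(m, n)) (X : 'M[R]_(n, m)) :=
  [/\ A *m X *m A = A, X *m A *m X = X,
     (A *m X)^T = A *m X & (X *m A)^T = X *m A].

(** [v A A' = 0] forces [|A' v'|^2 = 0]. *)
Lemma gram_unitmx m n (A : 'M[R]_(m, n)) : row_free A -> A *m A^T \in unitmx.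
Proof.
move=> fA; rewrite -row_free_unit -kermx_eq0; apply/rowV0P => v /sub_kermxP vA.
have : dotv (A^T *m v^T) (A^T *m v^T) = 0.
  have -> : A^T *m v^T = (v *m A)^T by rewrite trmx_mul.
  by rewrite dotvE trmxK trmx_mul mulmxA -(mulmxA v) vA mul0mx mxE.
move=> /dotv_eq0 /(congr1 trmx); rewrite trmx_mul !trmxK trmx0 => vA0.
by apply: (row_free_inj fA); rewrite vA0 mul0mx.
Qed.

(** A full-rank factorization [A = L U] gives
    [A^+ = U' (U U')^-1 (L' L)^-1 L']. *)
Lemma penrose_exists m n (A : 'M[R]_(m, n)) : exists X, penrose A X.
Proof.
have [r [L [U [AE fU fL]]]] : exists (r : nat) (L : 'M[R]_(m, r)) (U : 'M[R]_(r, n)),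
    [/\ A = L *m U, row_free U & row_free (L^T)].
  exists (\rank A), (col_base A), (row_base A).
  rewrite mulmx_base row_base_free /row_free mxrank_tr; split=> //.
  exact: col_base_full.
have uU := gram_unitmx fU; have uL := gram_unitmx fL; rewrite trmxK in uL.
pose iU := invmx (U *m U^T); pose iL := invmx (L^T *m L).
have iUU : U *m U^T *m iU = 1%:M by apply: mulmxV.
have iLL : iL *m (L^T *m L) = 1%:M by apply: mulVmx.
have siU : iU^T = iU by rewrite /iU trmx_inv trmx_mul trmxK.
have siL : iL^T = iL by rewrite /iL trmx_inv trmx_mul trmxK.
pose X := U^T *m iU *m (iL *m L^T).
have AX : A *m X = L *m iL *m L^T.
  by rewrite AE /X !mulmxA -(mulmxA L U) -(mulmxA L) iUU mulmx1.
have XA : X *m A = U^T *m iU *m U.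
  by rewrite AE /X !mulmxA -(mulmxA _ L^T L) -(mulmxA _ iL) iLL mulmx1.
exists X; split.
- by rewrite AX AE !mulmxA -(mulmxA _ L^T L) -(mulmxA _ iL) iLL mulmx1.
- by rewrite XA /X !mulmxA -(mulmxA _ U U^T) -(mulmxA _ (U *m U^T) iU) iUU mulmx1.
- by rewrite AX !trmx_mul trmxK siL mulmxA.
- by rewrite XA !trmx_mul trmxK siU mulmxA.
Qed.

Local Notation pinv := Defs.pinv.

Lemma pinvP m n (A : 'M[R]_(m, n)) : penrose A (pinv A).
Proof.
by have [X hX] := penrose_exists A; rewrite /pinv; case: xgetP => // /(_ X)/(_ hX).
Qed.

Lemma penrose_uniq m n (A : 'M[R]_(m, n)) X Y : penrose A X -> penrose A Y -> X = Y.
Proof.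
move=> [x1 x2 x3 x4] [y1 y2 y3 y4].
have AXY : A *m X = A *m Y.
  by rewrite -{1}y1 -mulmxA -y3 -x3 -trmx_mul mulmxA x1 y3.
have XAY : X *m A = Y *m A.
  by rewrite -{1}y1 !mulmxA -mulmxA -x4 -y4 -trmx_mul -mulmxA (mulmxA A) x1 y4.
by rewrite -x2 XAY -mulmxA AXY mulmxA.
Qed.

Lemma pinv_tr m n (A : 'M[R]_(m, n)) : pinv A^T = (pinv A)^T.
Proof.
apply: penrose_uniq (pinvP _) _; have [x1 x2 x3 x4] := pinvP A.
by split; rewrite -!trmx_mul ?trmxK ?mulmxA ?x1 ?x2 ?x3 ?x4.
Qed.

End Pinv.

(** * Limits of sequences *)

Section Sequences.
Context (R : realType).

Lemma le0_of_cvg (x : R) (s : nat -> R) : (forall i, x <= s i) ->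
  s i @[i --> \oo] --> (0 : R) -> x <= 0.
Proof.
by move=> xs s0; apply: (cvgr_to_ge s0); apply: nearW.
Qed.

Lemma cauchy_cvg_R (x : nat -> R) :
  (forall e, 0 < e -> exists N, forall i j, (N <= i)%N -> (N <= j)%N -> `|x i - x j| <= e) ->
  cvgn x.
Proof.
move=> cau; apply/cauchy_cvgP; apply: cauchy_exP => e e0.
have [N hN] : exists N, forall i j, (N <= i)%N -> (N <= j)%N -> `|x i - x j| <= e / 2.
  by apply: cau; rewrite divr_gt0.
exists (x N); exists N => // i /= Ni; rewrite /ball/=.
by apply: (le_lt_trans (hN N i (leqnn N) Ni)); lra.
Qed.

Lemma cvg_sum0 I (r : seq I) (f : I -> nat -> R) :
  (forall c, f c i @[i --> \oo] --> (0 : R)) ->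
  \sum_(c <- r) f c i @[i --> \oo] --> (0 : R).
Proof.
move=> f0; elim: r => [|c r IH].
  by rewrite (_ : (fun _ => _) = (fun=> 0)); [exact: cvg_cst|apply/funext => i; rewrite big_nil].
rewrite (_ : (fun _ => _) = (fun i => f c i + \sum_(c <- r) f c i)); last first.
  by apply/funext => i; rewrite big_cons.
by rewrite -[X in _ --> X](addr0 0); apply: cvgD.
Qed.

Lemma cauchy_cvg_cV k (x : nat -> 'cV[R]_k) :
  (forall e, 0 < e -> exists N, forall i j, (N <= i)%N -> (N <= j)%N ->
     dotv (x i - x j) (x i - x j) <= e) ->
  exists y, dotv (x i - y) (x i - y) @[i --> \oo] --> (0 : R).
Proof.
move=> cau.
have cvx c : cvgn (fun i => x i c 0).
  apply: cauchy_cvg_R => e e0; have [N hN] := cau (e ^+ 2) (exprn_gt0 2 e0).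
  exists N => i j Ni Nj; rewrite -(@ler_pXn2r _ 2) ?nnegrE ?(ltW e0)//.
  apply: le_trans (hN i j Ni Nj); rewrite real_normK ?num_real//.
  by have := le_sqr_dotv (x i - x j) c; rewrite !mxE.
exists (\col_c limn (fun i => x i c 0)).
apply: cvg_sum0 => c; rewrite -[X in _ --> X](mulr0 0).
have h : (x i - \col_c limn (fun i => x i c 0)) c 0 @[i --> \oo] --> (0 : R).
  rewrite -[X in _ --> X](subrr (limn (fun i => x i c 0))).
  under eq_fun do rewrite !mxE.
  by apply: cvgB; [exact: cvx|exact: cvg_cst].
exact: (cvgM h h).
Qed.

Lemma cvg0_ge0_le (s t : nat -> R) : (forall i, 0 <= s i) -> (forall i, s i <= t i) ->
  t i @[i --> \oo] --> (0 : R) -> s i @[i --> \oo] --> (0 : R).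
Proof.
move=> s0 st t0; apply: (squeeze_cvgr _ (cvg_cst 0) t0).
by apply: nearW => i; rewrite s0 st.
Qed.

End Sequences.

(** * Square-integrable functions on an interval *)

Section ScalarL2.
Context (R : realType) (a b : R).
Local Notation mu := (@lebesgue_measure R).
Local Notation D := (`[a, b]%classic : set (measurableTypeR R)).
Local Notation intD f := (\int[mu]_(t in D) (f t))%R.

Definition integrable_itv (f : R -> R) := mu.-integrable D (EFin \o f).

Definition sL2 (f : R -> R) :=
  measurable_fun D f /\ integrable_itv (fun t => f t ^+ 2).

Lemma mD : measurable D. Proof. exact: measurable_itv. Qed.
Hint Resolve mD : core.

Lemma muD_fin : (mu D < +oo)%E.
Proof. by rewrite lebesgue_measure_itv/=; case: ifP => _; rewrite ?ltey. Qed.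

Lemma integrable_itv_le (f g : R -> R) : measurable_fun D f ->
  (forall t, D t -> `|f t| <= g t) -> integrable_itv g -> integrable_itv f.
Proof.
move=> mf fg ig; apply: le_integrable ig => //; first exact/measurable_EFinP.
by move=> t Dt /=; rewrite lee_fin (le_trans (fg t Dt)) // ler_norm.
Qed.

Lemma integrable_itv_add f g : integrable_itv f -> integrable_itv g ->
  integrable_itv (fun t => f t + g t).
Proof. by move=> hf hg; apply: (integrableD mD hf hg). Qed.

Lemma integrable_itv_scale c f : integrable_itv f -> integrable_itv (fun t => c * f t).
Proof. by move=> hf; apply: (integrableZl mD c hf). Qed.

Lemma integrable_itv_meas f : integrable_itv f -> measurable_fun D f.
Proof. by move=> /measurable_int/measurable_EFinP. Qed.

Lemma integrable_itv_cst c : integrable_itv (fun=> c).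
Proof.
apply: measurable_bounded_integrable => //; first exact: muD_fin.
exists `|c|; split; first exact: num_real.
by move=> x cx t _ /=; apply: ltW.
Qed.

Lemma sL2_mul_integrable f g : sL2 f -> sL2 g -> integrable_itv (fun t => f t * g t).
Proof.
move=> [mf if2] [mg ig2]; apply: (integrable_itv_le _ _ (integrable_itv_add if2 ig2)).
  exact: measurable_funM.
move=> t _ /=; rewrite ler_norml.
have := sqr_ge0 (f t + g t); have := sqr_ge0 (f t - g t).
have := sqr_ge0 (f t); have := sqr_ge0 (g t).
by rewrite !expr2; nra.
Qed.

Lemma sL2_cst c : sL2 (fun=> c).
Proof. by split; [exact: measurable_cst|exact: integrable_itv_cst]. Qed.

Lemma sL2_integrable f : sL2 f -> integrable_itv f.
Proof.
move=> /sL2_mul_integrable/(_ (sL2_cst 1)).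
by rewrite (_ : (fun t => _) = f)//; apply/funext => t; rewrite mulr1.
Qed.

Lemma sL2D f g : sL2 f -> sL2 g -> sL2 (fun t => f t + g t).
Proof.
move=> hf hg; split; first exact: (measurable_funD hf.1 hg.1).
have := integrable_itv_add (integrable_itv_add hf.2 hg.2)
  (integrable_itv_scale 2 (sL2_mul_integrable hf hg)).
by congr integrable_itv; apply/funext => t; ring.
Qed.

Lemma sL2M_bdd K (c f : R -> R) : measurable_fun D c -> (forall t, D t -> `|c t| <= K) ->
  sL2 f -> sL2 (fun t => c t * f t).
Proof.
move=> mc cK hf; split; first exact: (measurable_funM mc hf.1).
apply: (integrable_itv_le _ _ (integrable_itv_scale (K ^+ 2) hf.2)).
  by apply: measurable_funX; apply: (measurable_funM mc hf.1).
move=> t Dt /=; rewrite ger0_norm ?sqr_ge0// exprMn ler_wpM2r ?sqr_ge0//.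
by rewrite -(real_normK (num_real (c t))) ler_pXn2r ?nnegrE// ?(le_trans _ (cK t Dt)) ?cK.
Qed.

Lemma sL2Z c f : sL2 f -> sL2 (fun t => c * f t).
Proof. by apply: (@sL2M_bdd `|c|) => // t _; rewrite lexx. Qed.

Lemma sL2_sum I (r : seq I) (F : I -> R -> R) : (forall i, sL2 (F i)) ->
  sL2 (fun t => \sum_(i <- r) F i t).
Proof.
move=> hF; elim: r => [|i r IH].
  by under eq_fun do rewrite big_nil; apply: sL2_cst.
by under eq_fun do rewrite big_cons; apply: sL2D.
Qed.

Lemma intD_ae (f g : R -> R) : {ae mu, forall t, D t -> f t = g t} ->
  integrable_itv f -> integrable_itv g -> intD f = intD g.
Proof.
move=> fg hf hg; rewrite /Rintegral; congr fine.
apply: ae_eq_integral => //; [exact: measurable_int hf|exact: measurable_int hg|].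
by apply: filterS fg => t h Dt /=; rewrite h.
Qed.

Lemma intD_eq (f g : R -> R) : (forall t, D t -> f t = g t) -> intD f = intD g.
Proof. by move=> fg; apply: eq_Rintegral => t; rewrite inE => /fg. Qed.

Lemma intD_ge0_eq0 (f : R -> R) : integrable_itv f -> (forall t, D t -> 0 <= f t) ->
  intD f = 0 -> {ae mu, forall t, D t -> f t = 0}.
Proof.
move=> hf f0 if0.
have h : (\int[mu]_(t in D) `|(EFin \o f) t| = 0)%E.
  have -> : (\int[mu]_(t in D) `|(EFin \o f) t| = \int[mu]_(t in D) (f t)%:E)%E.
    by apply: eq_integral => t; rewrite inE => Dt /=; rewrite ger0_norm ?f0.
  rewrite -[LHS]fineK; first by rewrite -[X in X%:E]/(intD f) if0.
  exact: (integrable_fin_num mD hf).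
have := (ae_eq_integral_abs mu mD (measurable_int _ hf)).1 h.
by apply: filterS => t ht Dt; have := ht Dt => /= -[].
Qed.

Lemma measurable_continuous (c : R -> R) : {within D, continuous c} -> measurable_fun D c.
Proof. exact: subspace_continuous_measurable_fun. Qed.

Lemma bounded_continuous (c : R -> R) : {within D, continuous c} ->
  exists2 K, 0 <= K & forall t, D t -> `|c t| <= K.
Proof.
move=> cc.
have cD : compact (c @` D) by apply: continuous_compact => //; apply: segment_compact.
have [M [_ hM]] := compact_bounded cD.
exists (`|M| + 1) => [|t Dt]; first by rewrite addr_ge0.
by apply: (hM (`|M| + 1)); [rewrite (le_lt_trans (ler_norm _))// ltrDl|exists t].
Qed.

End ScalarL2.

Section Complete.
Context (R : realType) (a b : R).
Local Notation mu := (@lebesgue_measure R).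
Local Notation D := (`[a, b]%classic : set (measurableTypeR R)).
Local Notation intD f := (\int[mu]_(t in D) (f t))%R.
Hint Resolve mD : core.

(** Fatou's lemma passes a bound on the distances from [f] to [h i] to the
    almost everywhere limit of [h]. *)
Lemma sL2_near_limit (h : nat -> R -> R) (g : R -> R) (f : R -> R) e :
  sL2 a b f -> (forall i, sL2 a b (h i)) -> measurable_fun D g ->
  {ae mu, forall t, D t -> h i t @[i --> \oo] --> g t} ->
  (\forall i \near \oo, intD (fun t => (f t - h i t) ^+ 2) <= e) ->
  sL2 a b (fun t => f t - g t) /\ intD (fun t => (f t - g t) ^+ 2) <= e.
Proof.
move=> hf hh mg hg le_e.
have hfh i : sL2 a b (fun t => f t - h i t).
  under eq_fun do rewrite -mulN1r; exact: (sL2D hf (sL2Z (-1) (hh i))).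
have mfg : measurable_fun D (fun t => f t - g t).
  by apply: measurable_funB => //; apply: hf.1.
have key : (\int[mu]_(t in D) ((f t - g t) ^+ 2)%:E <= e%:E)%E.
  have -> : (\int[mu]_(t in D) ((f t - g t) ^+ 2)%:E =
             \int[mu]_(t in D) limn_einf (fun i => ((f t - h i t) ^+ 2)%:E))%E.
    apply: ae_eq_integral => //.
    - by apply/measurable_EFinP; apply: measurable_funX.
    - have -> : (fun t : measurableTypeR R => limn_einf (fun i => ((f t - h i t) ^+ 2)%:E)) =
          (fun t => - limn_esup (fun i => - ((f t - h i t) ^+ 2)%:E))%E.
        by apply/funext => t; rewrite -limn_einfN; congr limn_einf; apply/funext => i /=; rewrite opprK.
      apply: measurableT_comp => //.
      apply: measurable_fun_limn_esup => i.
      apply: measurableT_comp => //; apply/measurable_EFinP.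
      by apply: measurable_funX; apply: (hfh i).1.
    - apply: filterS hg => t ht Dt; have /cvg_limn_einf_sup[-> //] :
        ((f t - h i t) ^+ 2)%:E @[i --> \oo] --> ((f t - g t) ^+ 2)%:E.
      apply: cvg_EFin; first exact: nearW.
      rewrite /comp/=; under eq_fun do rewrite /= expr2.
      by rewrite expr2; apply: cvgM; (apply: cvgB; [exact: cvg_cst|exact: ht]).
  apply: le_trans (fatou mu _ _ _) _ => //.
  - by move=> i; apply/measurable_EFinP; apply: measurable_funX; apply: (hfh i).1.
  - by move=> i t _; rewrite lee_fin sqr_ge0.
  rewrite limn_einf_lim; apply: lime_le; first exact: is_cvg_einfs.
  case: le_e => N _ hN; exists N => // i /= Ni.
  apply: le_trans (_ : (\int[mu]_(t in D) ((f t - h i t) ^+ 2)%:E <= _)%E).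
    by apply: ereal_inf_lbound; exists i => //=.
  have /integrable_fin_num fin : mu.-integrable D (EFin \o (fun t => (f t - h i t) ^+ 2)).
    exact: (hfh i).2.
  by rewrite -[leLHS](fineK (fin _))//= lee_fin; apply: hN.
have ifg : integrable_itv a b (fun t => (f t - g t) ^+ 2).
  apply/integrableP; split; first by apply/measurable_EFinP; apply: measurable_funX.
  under eq_integral do rewrite /= ger0_norm ?sqr_ge0//.
  by apply: le_lt_trans key _; rewrite ltry.
split; first by [].
by rewrite -lee_fin fineK//; apply: (integrable_fin_num (mD a b) ifg).
Qed.

Lemma nneseries_cvg (v : nat -> R) : (forall i, 0 <= v i) ->
  (\big[+%E/0%E]_(0 <= i <oo) (v i)%:E < +oo)%E -> cvgn (series v).
Proof.
move=> v0 vfin; apply: nondecreasing_is_cvgn.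
  by apply/nondecreasing_seqP => k; rewrite /series/= big_nat_recr//= lerDl.
exists (fine (\big[+%E/0%E]_(0 <= i <oo) (v i)%:E)) => _ [k _ <-].
rewrite -lee_fin fineK; last first.
  by rewrite ge0_fin_numE//; apply: nneseries_ge0 => i _ _; rewrite lee_fin.
rewrite /series/= -sumEFin.
by apply: nneseries_lim_ge => i _ _; rewrite lee_fin.
Qed.

(** A Cauchy sequence has a subsequence whose consecutive distances are
    summable; it converges almost everywhere, and Fatou's lemma turns this into
    convergence in mean square of the whole sequence. *)
Theorem sL2_complete (f : nat -> R -> R) : (forall i, sL2 a b (f i)) ->
  (forall e, 0 < e -> exists N, forall i j, (N <= i)%N -> (N <= j)%N ->
     intD (fun t => (f i t - f j t) ^+ 2) <= e) ->
  exists2 g, sL2 a b g & forall e, 0 < e -> exists N, forall i, (N <= i)%N ->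
     intD (fun t => (f i t - g t) ^+ 2) <= e.
Proof.
move=> hf cau.
have /choice[N0 hN0] : forall k, exists N, forall i j, (N <= i)%N -> (N <= j)%N ->
     intD (fun t => (f i t - f j t) ^+ 2) <= 4 ^- k.
  by move=> k; apply: cau; rewrite invr_gt0 exprn_gt0.
(* The term [k] makes [N] unbounded, the sum makes it monotone. *)
pose N k := (k + \sum_(0 <= i < k.+1) N0 i)%N.
have N0N k : (N0 k <= N k)%N by rewrite /N big_nat_recr//= addnA leq_addl.
have NS k : (N k <= N k.+1)%N.
  by rewrite /N [in leqRHS]big_nat_recr//= leq_add// leq_addr.
pose h k := f (N k).
have hh k : sL2 a b (h k) by apply: hf.
pose v k t := `|h k.+1 t - h k t|.
have hv k : sL2 a b (fun t => h k.+1 t - h k t).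
  under eq_fun do rewrite -mulN1r; exact: (sL2D (hh _) (sL2Z (-1) (hh _))).
have iv k : integrable_itv a b (v k).
  exact: (integrable_norm (sL2_integrable (hv k))).
pose c := 1 + fine (mu D).
have c0 : 0 <= c by rewrite addr_ge0// fine_ge0.
have le_v k : intD (v k) <= c * 2 ^- k.
  (* The bound [x <= 2^k x^2 + 2^-k] trades an absolute value for a square. *)
  pose w t := 2 ^+ k * (h k.+1 t - h k t) ^+ 2 + 2 ^- k.
  have iw1 : integrable_itv a b (fun t => 2 ^+ k * (h k.+1 t - h k t) ^+ 2).
    exact: integrable_itv_scale (hv k).2.
  have iw : integrable_itv a b w.
    by apply: (integrable_itv_add iw1); apply: integrable_itv_cst.
  apply: (@le_trans _ _ (intD w)).
    apply: (le_Rintegral (mD a b) (iv k) iw) => t _; rewrite /v /w.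
    set x := h k.+1 t - h k t.
    have p0 : 0 < (2 ^+ k : R) by rewrite exprn_gt0.
    rewrite -(ler_pM2l p0) mulrDr mulfV ?gt_eqF// -(real_normK (num_real x)).
    have : 0 <= (2 ^+ k * `|x| - 1) ^+ 2 by rewrite sqr_ge0.
    have : 0 <= 2 ^+ k * `|x| by rewrite mulr_ge0// ltW.
    by rewrite !expr2; nra.
  rewrite RintegralD//; last exact: integrable_itv_cst.
  rewrite RintegralZl//; last exact: (hv k).2.
  rewrite Rintegral_cst// mulrDl mul1r (mulrC (fine _)) lerD2r.
  rewrite -ler_pdivlMl ?exprn_gt0// -invfM -exprMn -natrM.
  apply: le_trans (hN0 k _ _ _ _) _ => //; exact: leq_trans (N0N _) (NS _).
have sumfin : (\int[mu]_(t in D) \big[+%E/0%E]_(0 <= k <oo) (v k t)%:E < +oo)%E.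
  rewrite integral_nneseries//; first last.
  - by move=> k t _; rewrite lee_fin normr_ge0.
  - by move=> k; apply/measurable_EFinP; apply: integrable_itv_meas (iv k).
  apply: (@le_lt_trans _ _ (\big[+%E/0%E]_(0 <= k <oo) (c * 2 ^- k)%:E)%E).
    apply: lee_nneseries => k _; first by move=> _; apply: integral_ge0 => t _; rewrite lee_fin normr_ge0.
    rewrite -(fineK (integrable_fin_num (mD a b) (iv k))) lee_fin.
    exact: le_v.
  apply: (@le_lt_trans _ _ (c * 2)%:E); last by rewrite ltry.
  apply: le_trans (epsilon_trick0 xpredT (mulr_ge0 c0 (ler0n _ 2))).
  apply: lee_nneseries => k _; first by rewrite lee_fin mulr_ge0// invr_ge0 exprn_ge0.
  by rewrite lee_fin natrX exprS invfM mulrA mulfK.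
have h_cvg : {ae mu, forall t, D t -> cvgn (h ^~ t)}.
  have iS : mu.-integrable D (fun t => \big[+%E/0%E]_(0 <= k <oo) (v k t)%:E)%E.
    apply/integrableP; split.
      apply: ge0_emeasurable_sum => [k t _ _|k _]; first by rewrite lee_fin normr_ge0.
      by apply/measurable_EFinP; apply: integrable_itv_meas (iv k).
    under eq_integral => t _.
      rewrite gee0_abs; last by apply: nneseries_ge0 => k _ _; rewrite lee_fin normr_ge0.
      over.
    exact: sumfin.
  apply: filterS (integrable_ae (mD a b) iS) => t ht Dt.
  have {ht} := ht Dt; rewrite ge0_fin_numE; last first.
    by apply: nneseries_ge0 => k _ _; rewrite lee_fin normr_ge0.
  move=> /nneseries_cvg => /(_ (fun k => normr_ge0 _)) => cv.
  have {cv} := @normed_cvg _ _ (telescope (h ^~ t)) cv.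
  move=> cv; rewrite (_ : h ^~ t = fun k => h 0 t + series (telescope (h ^~ t)) k).
    2: by apply/funext => k; rewrite -eq_sum_telescope.
  by apply: is_cvgD => //; exact: is_cvg_cst.
pose G t := fine (limn_esup (fun k => (h k t)%:E)).
have mG : measurable_fun D G.
  apply: measurableT_comp => //; apply: measurable_fun_limn_esup => k.
  by apply/measurable_EFinP; apply: (hh k).1.
have hG : {ae mu, forall t, D t -> h k t @[k --> \oo] --> G t}.
  apply: filterS h_cvg => t ht Dt; have := ht Dt => {}ht.
  have : (h k t)%:E @[k --> \oo] --> (limn (h ^~ t))%:E.
    by apply: cvg_EFin; [exact: nearW|exact: ht].
  by move=> /cvg_limn_einf_sup[_]; rewrite /G => ->.
have lim e : 0 < e -> exists M, forall i, (M <= i)%N ->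
    sL2 a b (fun t => f i t - G t) /\ intD (fun t => (f i t - G t) ^+ 2) <= e.
  move=> e0; have [M hM] := cau _ e0; exists M => i Mi.
  apply: (sL2_near_limit (hf i) hh mG hG).
  near=> k; apply: hM => //.
  apply: (@leq_trans k); first by near: k; exact: nbhs_infty_ge.
  by rewrite leq_addr.
exists G.
  have [M /(_ M (leqnn M))[hMG _]] := lim 1 ltr01.
  have := sL2D (hf M) (sL2Z (-1) hMG).
  by congr sL2; apply/funext => t; rewrite mulN1r opprB addrC subrK.
by move=> e /lim[M hM]; exists M => i /hM[].
Unshelve. all: by end_near.
Qed.

End Complete.

(** * Absolutely continuous functions *)

Section AbsCont.
Context (R : realType).
Implicit Types (a b x y : R) (g f : R -> R).
Local Notation mu := (@lebesgue_measure R).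

Definition ac a b g := forall e : R, 0 < e -> exists2 del : R, 0 < del &
  forall (N : nat) (s t : 'I_N -> R),
    (forall i, a <= s i /\ s i < t i /\ t i <= b) ->
    trivIset setT (fun i => `]s i, t i[%classic) ->
    \sum_(i < N) (t i - s i) < del ->
    \sum_(i < N) `|g (t i) - g (s i)| < e.

Lemma ac_sub a b a' b' g : a <= a' -> b' <= b -> ac a b g -> ac a' b' g.
Proof.
move=> aa' bb' acg e /acg[del d0 h]; exists del => // N s t st; apply: h => i.
have [h1 [h2 h3]] := st i.
by rewrite (le_trans aa' h1) (le_trans h3 bb').
Qed.

(** Covers differences, and products of bounded functions, at once. *)
Lemma ac_le a b K1 K2 f g h : 0 <= K1 -> 0 <= K2 -> ac a b f -> ac a b g ->
  (forall s t, a <= s -> s < t -> t <= b ->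
    `|h t - h s| <= K1 * `|f t - f s| + K2 * `|g t - g s|) -> ac a b h.
Proof.
move=> K10 K20 acf acg hle e e0.
pose e' := e / (2 * (K1 + K2 + 1)).
have KK : 0 < K1 + K2 + 1 by rewrite ltr_wpDl// addr_ge0.
have e'0 : 0 < e' by rewrite divr_gt0// mulr_gt0.
have [d1 d10 h1] := acf _ e'0; have [d2 d20 h2] := acg _ e'0.
exists (Num.min d1 d2) => [|N s t st tr]; first by rewrite lt_min d10.
rewrite lt_min => /andP[/(h1 _ _ _ st tr) l1 /(h2 _ _ _ st tr) l2].
apply: (@le_lt_trans _ _
    (\sum_(i < N) (K1 * `|f (t i) - f (s i)| + K2 * `|g (t i) - g (s i)|))).
  by apply: ler_sum => i _; have [? [? ?]] := st i; apply: hle.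
rewrite big_split -!mulr_sumr /=.
apply: (@le_lt_trans _ _ (K1 * e' + K2 * e')).
  by apply: lerD; rewrite ler_wpM2l// ltW.
rewrite -mulrDl /e' mulrA ltr_pdivrMr ?mulr_gt0// mulrC ltr_pM2l//.
by rewrite mulr_natl mulr2n; lra.
Qed.

(** Disjoint open intervals of [[a, x]] contained in [U], listed from right to left
    so that a walk to the right extends a chain by [cons]. *)
Fixpoint chain a (U : set R) x (s : seq (R * R)) : Prop :=
  if s is p :: s' then
    [/\ p.1 < p.2, p.2 <= x, `]p.1, p.2[ `<=` U & chain a U p.1 s']
  else a <= x.

Lemma chain_mono a U x y s : x <= y -> chain a U x s -> chain a U y s.
Proof.
case: s => [|p s] xy /=; first by move=> /le_trans; apply.
by move=> [h1 h2 h3 h4]; split=> //; apply: le_trans h2 xy.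
Qed.

Lemma chain_ge a U x s : chain a U x s -> a <= x.
Proof.
elim: s x => //= p s IH x [h1 h2 _ /IH h4].
exact: le_trans (le_trans h4 (ltW h1)) h2.
Qed.

Lemma chain_nth a U x s i : chain a U x s -> (i < size s)%N ->
  [/\ a <= (nth (0, 0) s i).1, (nth (0, 0) s i).1 < (nth (0, 0) s i).2 &
      (nth (0, 0) s i).2 <= x].
Proof.
elim: s x i => //= p s IH x [|i] [h1 h2 _ h4] /=; first by move=> _; split=> //; apply: chain_ge h4.
by rewrite ltnS => /(IH _ _ h4)[-> -> h]; split=> //; apply: le_trans h (le_trans (ltW h1) h2).
Qed.

Lemma chain_nth_lt a U x s i j : chain a U x s -> (i < j)%N -> (j < size s)%N ->
  (nth (0, 0) s j).2 <= (nth (0, 0) s i).1.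
Proof.
elim: s x i j => //= p s IH x [|i] [|j]//= [h1 h2 _ h4].
  by rewrite ltnS => _ /(chain_nth h4)[].
by rewrite !ltnS => ij js; apply: IH ij js; apply: h4.
Qed.

Lemma chain_measure a U x s : open U -> chain a U x s ->
  ((\sum_(p <- s) (p.2 - p.1))%:E <= mu (U `&` `]a, x[))%E.
Proof.
move=> oU; have mU : measurable (U : set (measurableTypeR R)) by apply: open_measurable.
elim: s x => [|p s IH] x /=; first by rewrite big_nil.
move=> [h1 h2 h3 h4]; rewrite big_cons EFinD.
have ap := chain_ge h4.
have := IH _ h4; move/(leeD2l (p.2 - p.1)%:E)/le_trans; apply.
have -> : (p.2 - p.1)%:E = mu `]p.1, p.2[.
  by rewrite lebesgue_measure_itv/= lte_fin h1.
rewrite -measureU//.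
- apply: le_measure; rewrite ?inE//.
  + by apply: measurableU => //; apply: measurableI.
  + by apply: measurableI.
  + move=> t [/= tp|[Ut /= ]].
      split=> /=; first exact: h3.
      move: tp; rewrite !in_itv/= => /andP[p1 p2].
      by rewrite (le_lt_trans ap p1) (lt_le_trans p2 h2).
    rewrite !in_itv/= => /andP[t1 t2]; split=> //=; rewrite t1.
    by rewrite (lt_trans t2)// (lt_le_trans h1 h2).
- exact: measurableI.
- rewrite -subset0 => t [/= + [_ /=]]; rewrite !in_itv/= => /andP[t1 t2] /andP[_ t3].
  by move: (lt_trans t1 t3); rewrite ltxx.
Qed.

(** A supremum argument walks from [a] to the right: near a point of zero
    derivative the increment is at most [e] times the length, and the other
    points lie in an open set of small measure, where absolute continuity
    bounds the increments. *)
Lemma ac_derive0_eq a b g : a <= b -> ac a b g ->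
  {ae mu, forall t : R, t \in `[a, b] -> is_derive t 1 g (0 : R)} -> g b = g a.
Proof.
move=> ab acg [Z [mZ Z0 subZ]].
have key e : 0 < e -> `|g b - g a| <= e * (b - a) + e.
  move=> e0; have [del d0 hdel] := acg _ e0.
  (* The exceptional set is covered by an open set too small to contribute more
     than [e] to the increment of [g]. *)
  have [U [oU ZU mU]] : exists U, [/\ open U, Z `<=` U & (mu U < del%:E)%E].
    have Zfin : (mu Z < +oo)%E by rewrite Z0 ltry.
    have [U [oU ZU UZ]] := @lebesgue_regularity_outer R Z del mZ Zfin d0.
    exists U; split=> //.
    have mUm : measurable (U : set (measurableTypeR R)) by apply: open_measurable.
    rewrite -(setDUK ZU) measureU//; last by rewrite setDIK.
      by move: UZ; rewrite -[X in (X < _)%E]add0e -Z0.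
    exact: measurableD.
  pose reach x := exists2 s, chain a U x s &
    `|g x - g a| <= e * (x - a) + \sum_(p <- s) `|g p.2 - g p.1|.
  suff [s cs hs] : reach b.
    apply: (le_trans hs); rewrite lerD2l.
    have lt_del : \sum_(p <- s) (p.2 - p.1) < del.
      rewrite -lte_fin; apply: le_lt_trans (chain_measure oU cs) _.
      apply: le_lt_trans mU; apply: le_measure; rewrite ?inE//.
      - by apply: measurableI => //; apply: open_measurable.
      - exact: open_measurable.
    rewrite (big_nth (0, 0)) big_mkord; apply/ltW.
    apply: (hdel _ (fun i : 'I_(size s) => (nth (0, 0) s i).1)).
    - by move=> i; have [] := chain_nth cs (ltn_ord i).
    - apply/trivIsetP => i j _ _ ij; rewrite -subset0 => t [/=].
      rewrite !in_itv/= => /andP[i1 i2] /andP[j1 j2].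
      have [lij|lji|/val_inj eij] := ltngtP i j.
      + have := chain_nth_lt cs lij (ltn_ord j).
        by move=> h; have := lt_trans (lt_le_trans j2 h) i1; rewrite ltxx.
      + have := chain_nth_lt cs lji (ltn_ord i).
        by move=> h; have := lt_trans (lt_le_trans i2 h) j1; rewrite ltxx.
      + by rewrite eij eqxx in ij.
    - by rewrite -(big_mkord xpredT (fun i => (nth (0, 0) s i).2 - (nth (0, 0) s i).1))
           -(big_nth (0, 0) xpredT (fun p => p.2 - p.1)).
  pose A := [set x | x \in `[a, b] /\ reach x].
  have Aa : A a.
    split; first by rewrite in_itv/= lexx.
    by exists [::] => //=; rewrite !subrr normr0 mulr0 big_nil addr0.
  have hsA : has_sup A.
    by split; [exists a|exists b => x [+ _]; rewrite in_itv/= => /andP[]].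
  pose c := sup A.
  have ac_ : a <= c by apply: ub_le_sup => //; exact: hsA.2.
  have cb : c <= b.
    by apply: ge_sup; [exists a|move=> x [+ _]; rewrite in_itv/= => /andP[]].
  have [rho r0 step] : exists2 rho, 0 < rho &
      forall x y, c - rho < x -> x <= c -> c <= y -> y < c + rho ->
        a <= x -> y <= b -> reach x -> reach y.
    have [good|bad] := pselect (is_derive c 1 g (0 : R)).
      have [rho r0 hrho] : exists2 rho, 0 < rho &
          forall y, `|y - c| < rho -> `|g y - g c| <= e * `|y - c|.
        have dg := @ex_derive _ _ _ _ _ _ _ good.
        have vg := @derive_val _ _ _ _ _ _ _ good.
        have /cvgrPdist_le/(_ e e0) : h^-1 *: ((g \o shift c) (h *: (1 : R)) - g c) @[h --> 0^'] --> (0 : R).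
          by rewrite -[X in _ --> X]vg; exact: dg.
        move=> [rho /= r0 hrho]; exists rho => // y yc.
        have [->|yNc] := eqVneq y c; first by rewrite !subrr normr0 mulr0.
        have yc0 : y - c != 0 by rewrite subr_eq0.
        have := hrho (y - c); rewrite /ball/= sub0r normrN => /(_ yc yc0).
        rewrite /shift/= [_%:A]mulr1 subrK sub0r normrN normrM normfV.
        by rewrite ler_pdivrMl ?normr_gt0// mulrC.
      exists rho => // x y x1 xc cy y1 ax yb [s cs hs].
      have xy := le_trans xc cy.
      exists s; first exact: chain_mono xy cs.
      have h1 : `|g x - g c| <= e * (c - x).
        have -> : c - x = `|x - c| by rewrite distrC ger0_norm// subr_ge0.
        by apply: hrho; rewrite distrC ger0_norm ?subr_ge0//; lra.
      have h2 : `|g y - g c| <= e * (y - c).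
        have -> : y - c = `|y - c| by rewrite ger0_norm// subr_ge0.
        by apply: hrho; rewrite ger0_norm ?subr_ge0//; lra.
      have -> : g y - g a = (g y - g c) - (g x - g c) + (g x - g a) by ring.
      apply: le_trans (ler_normD _ _) _.
      have := ler_normB (g y - g c) (g x - g c); lra.
    have Uc : U c.
      apply/ZU/subZ => /(_ _)/bad; apply.
      by rewrite in_itv/= ac_ cb.
    have [rho r0 hrho] : exists2 rho, 0 < rho & forall y, `|y - c| < rho -> U y.
      have /nbhs_ballP[rho /= r0 hr] := open_nbhs_nbhs (conj oU Uc).
      by exists rho => // y yc; apply: hr; rewrite /ball/= distrC.
    exists rho => // x y x1 xc cy y1 ax yb [s cs hs].
    have := le_trans xc cy; rewrite le_eqVlt => /predU1P[<-|xy]; first by exists s.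
    exists ((x, y) :: s) => /=.
      split=> // t /=; rewrite in_itv/= => /andP[xt ty].
      by apply: hrho; rewrite ltr_norml; lra.
    rewrite big_cons /=.
    have -> : g y - g a = (g y - g x) + (g x - g a) by ring.
    apply: le_trans (ler_normD _ _) _.
    have : e * (x - a) <= e * (y - a) by rewrite ler_pM2l//; lra.
    by lra.
  have [x [xab rx] xc] : exists2 x, A x & c - rho < x.
    exact: (sup_adherent r0 hsA).
  have xlec : x <= c by apply: ub_le_sup => //; exact: hsA.2.
  have ax : a <= x by move: xab; rewrite in_itv/= => /andP[].
  have [cltb|bc] := ltP c b; last by apply: (step x) => //; [lra].
  pose y := Num.min b (c + rho / 2).
  have yb : y <= b by rewrite /y ge_min lexx.
  have cy : c < y by rewrite lt_min cltb/= ltrDl divr_gt0.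
  have Ay : A y.
    split; first by rewrite in_itv/= yb andbT (le_trans ac_)// ltW.
    apply: (step x) => //; first exact: ltW.
    by rewrite gt_min; apply/orP; right; lra.
  have : y <= c by apply: ub_le_sup => //; exact: hsA.2.
  by rewrite leNgt cy.
apply/eqP; rewrite -subr_eq0 -normr_eq0; apply/eqP/le_anti.
rewrite normr_ge0 andbT; apply/ler_addgt0Pl => e e0; rewrite addr0.
have K0 : 0 < b - a + 1 by lra.
have := key (e / (b - a + 1)); rewrite divr_gt0// => /(_ isT).
have -> // : e / (b - a + 1) * (b - a) + e / (b - a + 1) = e.
by field; rewrite gt_eqF.
Qed.

End AbsCont.

Section Primitive.
Context (R : realType) (a b : R).
Local Notation mu := (@lebesgue_measure R).
Local Notation D := (`[a, b]%classic : set (measurableTypeR R)).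
Local Notation intD f := (\int[mu]_(t in D) (f t))%R.
Hint Resolve mD : core.

(** The primitive vanishing at [a]; extending [w] by [0] outside [[a, b]] makes
    it differentiable almost everywhere on the whole line. *)
Definition prim (w : R -> R) (t : R) : R :=
  \int[mu]_(s in (`[a, t]%classic : set (measurableTypeR R))) ((w \_ D) s).

Lemma integrable_patch (A : set (measurableTypeR R)) (w : R -> R) : measurable A ->
  integrable_itv a b w -> mu.-integrable A (EFin \o (w \_ D)).
Proof.
move=> mA iw; apply: (integrableS measurableT mA (@subsetT _ _)).
rewrite -restrict_EFin.
by move: iw => /(integrable_mkcond _ (mD a b)).
Qed.

Lemma prim_eq w t : t \in `[a, b] ->
  prim w t = \int[mu]_(s in (`[a, t]%classic : set (measurableTypeR R))) w s.
Proof.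
rewrite in_itv/= => /andP[_ tb]; apply: eq_Rintegral => s.
rewrite inE/= in_itv/= => /andP[as_ st]; rewrite patchE mem_set//=.
by rewrite in_itv/= as_ (le_trans st).
Qed.

Lemma prim_a w : prim w a = 0.
Proof. by rewrite /prim set_itv1 Rintegral_set1. Qed.

Lemma prim_b w : prim w b = intD w.
Proof. by apply: eq_Rintegral => s sD; rewrite patchE sD. Qed.

Lemma primB w s t : integrable_itv a b w -> a <= s -> s <= t ->
  prim w t - prim w s =
  \int[mu]_(r in (`]s, t[%classic : set (measurableTypeR R))) ((w \_ D) r).
Proof.
move=> iw as_ st; rewrite /prim Rintegral_itvB//.
  by rewrite -Rintegral_itv_bndo_bndc//; apply: integrable_patch.
exact: integrable_patch.
Qed.

Lemma primD w v t : integrable_itv a b w -> integrable_itv a b v ->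
  prim (fun s => w s + v s) t = prim w t + prim v t.
Proof.
move=> iw iv; rewrite /prim -RintegralD//; [|exact: integrable_patch..].
by apply: eq_Rintegral => s _; rewrite !patchE; case: ifP; rewrite ?addr0.
Qed.

Lemma primZ c w t : integrable_itv a b w ->
  prim (fun s => c * w s) t = c * prim w t.
Proof.
move=> iw; rewrite /prim -RintegralZl//; [|exact: integrable_patch].
by apply: eq_Rintegral => s _; rewrite !patchE; case: ifP; rewrite ?mulr0.
Qed.

Lemma primB_le w s t : integrable_itv a b w -> a <= s -> s <= t -> t <= b ->
  `|prim w t - prim w s| <= 
  \int[mu]_(r in (`]s, t[%classic : set (measurableTypeR R))) `|w r|.
Proof.
move=> iw as_ st tb; rewrite primB//.
apply: le_trans (le_normr_Rintegral _ _) _ => //; first exact: integrable_patch.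
rewrite le_eqVlt; apply/orP; left; apply/eqP; apply: eq_Rintegral => r.
rewrite inE/= in_itv/= => /andP[sr rt]; rewrite patchE mem_set//= in_itv/=.
by rewrite (le_trans as_ (ltW sr)) (le_trans (ltW rt) tb).
Qed.

Lemma prim_bound w t : integrable_itv a b w -> t \in `[a, b] ->
  `|prim w t| <= intD (fun s => `|w s|).
Proof.
move=> iw; rewrite in_itv/= => /andP[at_ tb].
rewrite -[prim w t]subr0 -(prim_a w).
apply: le_trans (primB_le iw (lexx _) at_ tb) _.
have iaw : integrable_itv a b (fun s => `|w s|) by apply: (integrable_norm iw).
apply: fine_le.
- apply: integrable_fin_num => //; apply: integrableS iaw => //.
  by move=> r /=; rewrite !in_itv/= => /andP[h1 h2]; rewrite !ltW// (lt_le_trans h2).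
- exact: (integrable_fin_num (mD a b) iaw).
- apply: ge0_subset_integral => //.
  + exact: measurable_int iaw.
  + by move=> r /=; rewrite !in_itv/= => /andP[h1 h2]; rewrite !ltW// (lt_le_trans h2).
Qed.

(** On disjoint intervals of total length [d], splitting
    [|w| <= eta w^2 + 1 / (4 eta)] bounds the sum of the integrals of [|w|] by
    [eta] times the integral of [w^2] plus [d / (4 eta)]. *)
Lemma prim_ac w : sL2 a b w -> ac a b (prim w).
Proof.
move=> hw e e0; have iw := sL2_integrable hw.
set M := intD (fun s => w s ^+ 2).
have M0 : 0 <= M by apply: Rintegral_ge0 => t _; rewrite sqr_ge0.
pose eta := e / (2 * (M + 1)).
have eta0 : 0 < eta by rewrite divr_gt0// mulr_gt0// ltr_wpDl.
exists (2 * eta * e); first by rewrite mulr_gt0// mulr_gt0.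
move=> N s t st tr le_d.
pose I i := (`]s i, t i[%classic : set (measurableTypeR R)).
have ID i : I i `<=` D.
  move=> r; rewrite /I/= !in_itv/= => /andP[h1 h2]; have [h3 [h4 h5]] := st i.
  by rewrite (le_trans h3 (ltW h1)) (le_trans (ltW h2) h5).
have mI i : measurable (I i) by exact: measurable_itv.
have iI i f : integrable_itv a b f -> mu.-integrable (I i) (EFin \o f).
  by move=> hf; apply: (integrableS (mD a b) (mI i) (ID i) hf).
have sumM : \sum_(i < N) \int[mu]_(r in I i) (w r ^+ 2) <= M.
  rewrite -lee_fin -sumEFin /M [in leRHS]/Rintegral fineK; last first.
    exact: (integrable_fin_num (mD a b) hw.2).
  under eq_bigr => i _.
    rewrite /Rintegral fineK; last first.
      by apply: (integrable_fin_num (mI i)); apply: iI; exact: hw.2.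
    over.
  have mJ : measurable (\big[setU/set0]_(i < N) I i).
    by apply: bigsetU_measurable => i _; exact: mI.
  have JD : \big[setU/set0]_(i < N) I i `<=` D.
    apply: (big_ind (fun A : set (measurableTypeR R) => A `<=` D)) => [//|A B hA hB r|i _].
      by case; [apply: hA|apply: hB].
    exact: ID.
  have mw2 : measurable_fun D (fun r => (w r ^+ 2)%:E).
    exact: measurable_int hw.2.
  rewrite -(@ge0_integral_bigsetU _ _ _ mu _ I) //.
  - by apply: ge0_subset_integral => // r _; rewrite lee_fin sqr_ge0.
  - by rewrite index_enum_uniq.
  - by move=> i j _ _; apply: tr.
  - exact: measurable_funS mw2.
  - by move=> r _; rewrite lee_fin sqr_ge0.
have le_i i : `|prim w (t i) - prim w (s i)| <=
    eta * \int[mu]_(r in I i) (w r ^+ 2) + (4 * eta)^-1 * (t i - s i).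
  have [h3 [h4 h5]] := st i.
  apply: le_trans (primB_le iw h3 (ltW h4) h5) _.
  have i1 : integrable_itv a b (fun r => eta * w r ^+ 2) by apply: integrable_itv_scale hw.2.
  have i2 : integrable_itv a b (fun r => (4 * eta)^-1) by apply: integrable_itv_cst.
  apply: (@le_trans _ _ (\int[mu]_(r in I i) (eta * w r ^+ 2 + (4 * eta)^-1))).
    apply: le_Rintegral => //.
    - by apply: iI; apply: (integrable_norm iw).
    - by apply: iI; apply: integrable_itv_add.
    move=> r _; rewrite -(ler_pM2l eta0) mulrDr -(real_normK (num_real (w r))).
    have -> : eta * (4 * eta)^-1 = 4^-1 by field; rewrite gt_eqF.
    have := sqr_ge0 (eta * `|w r| - 2^-1); rewrite !expr2; nra.
  rewrite RintegralD//; [|exact: iI..].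
  rewrite RintegralZl//; last by apply: iI; exact: hw.2.
  rewrite lerD2l (Rintegral_cst _ (mI i)).
  have <- : fine (mu (I i)) = t i - s i by rewrite lebesgue_measure_itv/= lte_fin h4.
  exact: lexx.
apply: le_lt_trans (ler_sum _ (fun i _ => le_i i)) _.
rewrite big_split/= -!mulr_sumr.
apply: (@le_lt_trans _ _ (eta * M + (4 * eta)^-1 * \sum_(i < N) (t i - s i))).
  by rewrite lerD2r ler_wpM2l// ltW.
have h1 : eta * M <= e / 2.
  rewrite /eta invfM mulrA mulrAC ler_pdivrMr; last by rewrite ltr_wpDl.
  by rewrite ler_wpM2l ?divr_ge0 ?ltW// ltrDl.
have h2 : (4 * eta)^-1 * \sum_(i < N) (t i - s i) < e / 2.
  rewrite ltr_pdivrMl; last exact: mulr_gt0.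
  have -> : 4 * eta * (e / 2) = 2 * eta * e by field.
  exact: le_d.
by rewrite [e]splitr; apply: ler_ltD.
Qed.

(** Lebesgue differentiation. *)
Lemma prim_derive w : integrable_itv a b w ->
  {ae mu, forall t : R, t \in `[a, b] -> is_derive t 1 (prim w) (w t)}.
Proof.
move=> iw.
have h1 y : mu.-integrable [set` Interval (BLeft a) (BRight y)] (EFin \o (w \_ D)).
  exact: integrable_patch.
have h2 : locally_integrable [set: R] (w \_ D) by apply: integrable_locally.
have neq_a : {ae mu, forall t : R, t != a}.
  exists [set a]; split; [exact: measurable_set1|exact: lebesgue_measure_set1|].
  by move=> t /= /negP/negPn/eqP.
have := FTC1 h1 h2; apply: filterS2 neq_a; first exact: (ae_filter_ringOfSetsType mu).
move=> t /= ta h tD.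
have [|d1 d2] := h.
  by move: tD; rewrite in_itv/= lte_fin lt_neqAle eq_sym ta => /andP[].
have -> : w t = (w \_ D) t by rewrite patchE mem_set.
by rewrite -d2 derive1E; apply: derivableP.
Qed.

Lemma prim_continuous w : a <= b -> integrable_itv a b w ->
  {within D, continuous (prim w)}.
Proof.
move=> ab iw; apply: (parameterized_integral_continuous ab).
by apply: integrable_patch.
Qed.

(** Fundamental theorem of calculus for absolutely continuous functions: [g]
    minus the primitive of its derivative has derivative zero. *)
Theorem ac_prim g w : ac a b g -> sL2 a b w ->
  {ae mu, forall t : R, t \in `[a, b] -> is_derive t 1 g (w t)} ->
  forall t, t \in `[a, b] -> g t = g a + prim w t.
Proof.
move=> acg hw dg t; rewrite in_itv/= => /andP[at_ tb].
pose h s := g s - prim w s.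
have ach : ac a b h.
  apply: (ac_le (ler01) (ler01) acg (prim_ac hw)) => s r _ _ _; rewrite !mul1r /h.
  have -> : g r - prim w r - (g s - prim w s) = (g r - g s) - (prim w r - prim w s) by ring.
  exact: ler_normB.
have : h t = h a.
  apply: ac_derive0_eq at_ (ac_sub (lexx _) tb ach) _.
  apply: filterS2 dg (prim_derive (sL2_integrable hw)).
    exact: (ae_filter_ringOfSetsType mu).
  move=> s h1 h2.
  rewrite in_itv/= => /andP[as_ st].
  have sD : s \in `[a, b] by rewrite in_itv/= as_ (le_trans st).
  rewrite -(subrr (w s)); apply: is_deriveB; [exact: h1|exact: h2].
by rewrite /h prim_a subr0 => <-; rewrite subrK.
Qed.

(** The points of agreement are dense, as an open interval without any would have
    positive measure, and the difference varies little on short intervals. *)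
Lemma ac_ae_eq g h : a < b -> ac a b g -> ac a b h ->
  {ae mu, forall t : R, t \in `[a, b] -> g t = h t} ->
  forall t, t \in `[a, b] -> g t = h t.
Proof.
move=> ab acg ach gh t tab.
have ack : ac a b (fun s => g s - h s).
  apply: (ac_le (ler01) (ler01) acg ach) => s r _ _ _; rewrite !mul1r.
  have -> : g r - h r - (g s - h s) = (g r - g s) - (h r - h s) by ring.
  exact: ler_normB.
apply/eqP; rewrite -subr_eq0 -normr_eq0; apply/eqP/le_anti.
rewrite normr_ge0 andbT; apply/ler_addgt0Pl => e e0; rewrite addr0.
have [del d0 hdel] := ack _ e0.
move: tab; rewrite in_itv/= => /andP[at_ tb].
have near_pt l r : a <= l -> l < r -> r <= b -> exists2 s, l < s < r & g s = h s.
  move=> al lr rb; apply: contrapT => none.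
  have [Z [mZ Z0 subZ]] := gh.
  suff : (mu `]l, r[ <= mu Z)%E.
    by rewrite Z0 lebesgue_measure_itv/= lte_fin lr lee_fin leNgt subr_gt0 lr.
  apply: le_measure; rewrite ?inE//.
  move=> s /=; rewrite in_itv/= => lsr; apply: subZ => /= hs; apply: none.
  exists s => //; apply: hs; move/andP: lsr => [ls sr].
  by rewrite in_itv/= (le_trans al (ltW ls)) (le_trans (ltW sr) rb).
have one s r : a <= s -> s < r -> r <= b -> r - s < del ->
    `|g r - h r - (g s - h s)| < e.
  move=> as_ sr rb rsd.
  have := hdel 1%N (fun=> s) (fun=> r); rewrite !big_ord1; apply => //.
  by apply/trivIsetP => i j _ _; rewrite !ord1 eqxx.
have [tltb|bt] := ltP t b.
  have [||s /andP[ts]] := near_pt t (Num.min b (t + del)) at_.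
  - by rewrite lt_min tltb/= ltrDl.
  - by rewrite ge_min lexx.
  rewrite lt_min => /andP[sb sd] gs; have := one t s at_ ts (ltW sb).
  by rewrite gs subrr sub0r normrN; move=> /(_ _)/ltW; apply; lra.
have [||s /andP[]] := near_pt (Num.max a (t - del)) t _ _ tb.
- by rewrite le_max lexx.
- by rewrite gt_max (lt_le_trans ab bt)/=; lra.
rewrite gt_max => /andP[as_ sd] st gs; have := one s t (ltW as_) st tb.
by rewrite gs subrr subr0; move=> /(_ _)/ltW; apply; lra.
Qed.

Lemma prim_cst_ac c w : sL2 a b w -> ac a b (fun t => c + prim w t).
Proof.
move=> hw; apply: (ac_le ler01 ler01 (prim_ac hw) (prim_ac hw)) => s t _ _ _.
by rewrite opprD addrACA subrr add0r mul1r lerDl.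
Qed.

Lemma prim_cst_derive c w : sL2 a b w ->
  {ae mu, forall t : R, t \in `[a, b] -> is_derive t 1 (fun s => c + prim w s) (w t)}.
Proof.
move=> /sL2_integrable/prim_derive; apply: filterS.
  exact: (ae_filter_ringOfSetsType mu).
move=> t ht /ht {}ht; rewrite -[w t]add0r.
exact: (is_deriveD (is_derive_cst c t 1) ht).
Qed.

Lemma prim_cst_bound c w : sL2 a b w ->
  exists2 K, 0 <= K & forall t, D t -> `|c + prim w t| <= K.
Proof.
move=> /sL2_integrable iw; exists (`|c| + intD (fun s => `|w s|)).
  by rewrite addr_ge0// Rintegral_ge0.
move=> t tD; apply: le_trans (ler_normD _ _) _.
by rewrite lerD2l prim_bound.
Qed.

Lemma prim_cst_measurable c w : a <= b -> sL2 a b w ->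
  measurable_fun D (fun t => c + prim w t).
Proof.
move=> ab hw; apply: measurable_funD => //; apply: measurable_continuous.
by apply: prim_continuous => //; apply: sL2_integrable.
Qed.

Lemma sL2_prim c w : a <= b -> sL2 a b w -> sL2 a b (fun t => c + prim w t).
Proof.
move=> ab hw; have [K K0 hK] := prim_cst_bound c hw.
have := sL2M_bdd (prim_cst_measurable c ab hw) hK (sL2_cst a b 1).
by congr sL2; apply/funext => t; rewrite mulr1.
Qed.

(** The product of the primitives is absolutely continuous, so [ac_prim] applies
    to it. *)
Theorem prim_by_parts f g w v : a <= b -> sL2 a b w -> sL2 a b v ->
  (forall t, t \in `[a, b] -> f t = f a + prim w t) ->
  (forall t, t \in `[a, b] -> g t = g a + prim v t) ->
  intD (fun t => f t * v t) + intD (fun t => w t * g t) = f b * g b - f a * g a.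
Proof.
move=> ab hw hv fE gE.
pose F t := f a + prim w t; pose G t := g a + prim v t.
have [K1 K10 hF] := prim_cst_bound (f a) hw.
have [K2 K20 hG] := prim_cst_bound (g a) hv.
have hFL := sL2_prim (f a) ab hw; have hGL := sL2_prim (g a) ab hv.
have acFG : ac a b (fun t => F t * G t).
  apply: (ac_le K20 K10 (prim_cst_ac (f a) hw) (prim_cst_ac (g a) hv)) => s t as_ st tb.
  have -> : F t * G t - F s * G s = (F t - F s) * G t + F s * (G t - G s) by ring.
  apply: le_trans (ler_normD _ _) _; rewrite !normrM (mulrC K2).
  apply: lerD; first by rewrite ler_wpM2l// hG//= in_itv/= tb andbT (le_trans as_) ?ltW.
  by rewrite ler_wpM2r// hF//= in_itv/= as_ (le_trans (ltW st)).
have hd1 : sL2 a b (fun t => F t * v t).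
  exact: (sL2M_bdd (prim_cst_measurable (f a) ab hw) hF hv).
have hd2 : sL2 a b (fun t => w t * G t).
  have := sL2M_bdd (prim_cst_measurable (g a) ab hv) hG hw.
  by congr sL2; apply/funext => t; rewrite mulrC.
have := ac_prim acFG (sL2D hd1 hd2) _ (t := b); rewrite in_itv/= ab lexx prim_b.
rewrite RintegralD//; [|exact: sL2_integrable..].
have aD : a \in `[a, b] by rewrite in_itv/= lexx.
have bD : b \in `[a, b] by rewrite in_itv/= lexx ab.
have -> : F b = f b by rewrite /F -fE.
have -> : G b = g b by rewrite /G -gE.
have -> : F a = f a by rewrite /F prim_a addr0.
have -> : G a = g a by rewrite /G prim_a addr0.
move=> -> //.
  rewrite addrAC subrr add0r; congr (_ + _); apply: intD_eq => t tD.
    by rewrite /F -fE.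
  by rewrite /G -gE.
apply: filterS2 (prim_cst_derive (f a) hw) (prim_cst_derive (g a) hv).
  exact: (ae_filter_ringOfSetsType mu).
move=> t h1 h2 tD; rewrite [w t * _]mulrC.
exact: (is_deriveM (h1 tD) (h2 tD)).
Qed.

End Primitive.

(** * Vector-valued square-integrable functions *)

Section VectorL2.
Context (R : realType) (a b : R).
Local Notation mu := (@lebesgue_measure R).
Local Notation D := (`[a, b]%classic : set (measurableTypeR R)).
Local Notation intD f := (\int[mu]_(t in D) (f t))%R.
Hint Resolve mD : core.
Implicit Types k l : nat.

Definition ip k (f g : R -> 'cV[R]_k) : R := intD (fun t => dotv (f t) (g t)).

Lemma L2P k (f : R -> 'cV[R]_k) : L2 a b f <-> forall i, sL2 a b (fun t => f t i 0).
Proof.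
have mdot : (forall i, measurable_fun D (fun t => f t i 0)) ->
    measurable_fun D (fun t => enorm (f t) ^+ 2).
  move=> mf; rewrite (funext (fun t => enorm_sqr (f t))).
  by apply: measurable_sum => i; apply: measurable_funM.
split=> [[mf fin] i|hf].
  split; first exact: mf.
  apply: (integrable_itv_le (g := fun t => enorm (f t) ^+ 2)).
  - by apply: measurable_funX; apply: mf.
  - by move=> t _; rewrite ger0_norm ?sqr_ge0// enorm_sqr le_sqr_dotv.
  apply/integrableP; split; first by apply/measurable_EFinP; apply: mdot.
  by under eq_integral do rewrite /= ger0_norm ?sqr_ge0//.
split=> [i|]; first exact: (hf i).1.
have : integrable_itv a b (fun t => enorm (f t) ^+ 2).
  have : sL2 a b (fun t => \sum_(i < k) `|f t i 0|).
    apply: sL2_sum => i; split; first by apply: measurableT_comp => //; exact: (hf i).1.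
    have := (hf i).2; congr integrable_itv; apply/funext => t.
    by rewrite real_normK ?num_real.
  move=> [_]; apply: integrable_itv_le; first by apply: mdot => i; exact: (hf i).1.
  move=> t _; rewrite ger0_norm ?sqr_ge0// enorm_sqr.
  rewrite expr2 mulr_suml; apply: ler_sum => i _; rewrite -expr2.
  rewrite -real_normK ?num_real// expr2 ler_wpM2l//.
  by rewrite (bigD1 i)//= lerDl sumr_ge0.
by move=> /(integrable_lty (mD a b)).
Qed.

Lemma L2D k (f g : R -> 'cV[R]_k) : L2 a b f -> L2 a b g -> L2 a b (fun t => f t + g t).
Proof.
move=> /L2P hf /L2P hg; apply/L2P => i.
by under eq_fun do rewrite mxE; apply: sL2D.
Qed.

Lemma L2Z k c (f : R -> 'cV[R]_k) : L2 a b f -> L2 a b (fun t => c *: f t).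
Proof.
move=> /L2P hf; apply/L2P => i.
by under eq_fun do rewrite mxE; apply: sL2Z.
Qed.

Lemma L2N k (f : R -> 'cV[R]_k) : L2 a b f -> L2 a b (fun t => - f t).
Proof. by move=> /(L2Z (-1)); under eq_fun do rewrite scaleN1r. Qed.

Lemma L2B k (f g : R -> 'cV[R]_k) : L2 a b f -> L2 a b g -> L2 a b (fun t => f t - g t).
Proof. by move=> hf /L2N; apply: L2D. Qed.

Lemma L2_cst k (c : 'cV[R]_k) : L2 a b (fun=> c).
Proof. by apply/L2P => i; apply: sL2_cst. Qed.

(** Continuity of the coefficients is used only through this property. *)
Definition bmx k l (M : R -> 'M[R]_(k, l)) := forall i j,
  measurable_fun D (fun t => M t i j) /\
  exists K, forall t, D t -> `|M t i j| <= K.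

Lemma bmx_continuous k l (M : R -> 'M[R]_(k, l)) :
  {within `[a, b], continuous M} -> bmx M.
Proof.
move=> cM i j.
have cMij : {within `[a, b], continuous (fun t => M t i j)}.
  apply: (@within_continuous_comp _ _ _ _ M (fun A : 'M[R]_(k, l) => A i j)) => //.
  by move=> A _; exact: coord_continuous.
split; first exact: measurable_continuous.
by have [K _ hK] := bounded_continuous cMij; exists K.
Qed.

Lemma bmx_cst k l (M : 'M[R]_(k, l)) : bmx (fun=> M).
Proof. by move=> i j; split; [exact: measurable_cst|exists `|M i j|]. Qed.

Lemma bmx_tr k l (M : R -> 'M[R]_(k, l)) : bmx M -> bmx (fun t => (M t)^T).
Proof.
move=> hM i j; have [mM [K hK]] := hM j i.
have -> : (fun t => (M t)^T i j) = (fun t => M t j i) by apply/funext => t; rewrite mxE.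
by split=> //; exists K => t Dt; rewrite mxE hK.
Qed.

Lemma bmx_mul k l r (M : R -> 'M[R]_(k, l)) (N : R -> 'M[R]_(l, r)) :
  bmx M -> bmx N -> bmx (fun t => M t *m N t).
Proof.
move=> hM hN i j.
have /choice[K1 hK1] s := (hM i s).2; have /choice[K2 hK2] s := (hN s j).2.
split.
  have -> : (fun t => (M t *m N t) i j) = (fun t => \sum_s M t i s * N t s j).
    by apply/funext => t; rewrite mxE.
  by apply: measurable_sum => s; apply: measurable_funM; [exact: (hM i s).1|exact: (hN s j).1].
exists (\sum_s K1 s * K2 s) => t Dt; rewrite mxE.
apply: le_trans (ler_norm_sum _ _ _) _; apply: ler_sum => s _.
by rewrite normrM ler_pM// ?hK1 ?hK2.
Qed.

Lemma L2_mulmx k l (M : R -> 'M[R]_(k, l)) f : bmx M -> L2 a b f ->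
  L2 a b (fun t => M t *m f t).
Proof.
move=> hM /L2P hf; apply/L2P => i; under eq_fun do rewrite mxE.
apply: sL2_sum => j; have [mM [K hK]] := hM i j.
exact: (sL2M_bdd mM hK (hf j)).
Qed.

Lemma dotv_integrable k (f g : R -> 'cV[R]_k) : L2 a b f -> L2 a b g ->
  integrable_itv a b (fun t => dotv (f t) (g t)).
Proof.
move=> /L2P hf /L2P hg; rewrite /integrable_itv.
have -> : EFin \o (fun t => dotv (f t) (g t)) =
    (fun t => \sum_i (f t i 0 * g t i 0)%:E)%E.
  by apply/funext => t; rewrite sumEFin.
apply: integrable_sum => // i _; exact: (sL2_mul_integrable (hf i) (hg i)).
Qed.

Lemma ip_eq k l (f g : R -> 'cV[R]_k) (f' g' : R -> 'cV[R]_l) :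
  (forall t, D t -> dotv (f t) (g t) = dotv (f' t) (g' t)) -> ip f g = ip f' g'.
Proof. exact: intD_eq. Qed.

Lemma ipC k (f g : R -> 'cV[R]_k) : ip f g = ip g f.
Proof. by apply: eq_Rintegral => t _; rewrite dotvC. Qed.

Lemma ipDl k (f g h : R -> 'cV[R]_k) : L2 a b f -> L2 a b g -> L2 a b h ->
  ip (fun t => f t + g t) h = ip f h + ip g h.
Proof.
move=> hf hg hh; rewrite /ip -RintegralD//; [|exact: dotv_integrable..].
by apply: eq_Rintegral => t _; rewrite dotvDl.
Qed.

Lemma ipZl k c (f h : R -> 'cV[R]_k) : L2 a b f -> L2 a b h ->
  ip (fun t => c *: f t) h = c * ip f h.
Proof.
move=> hf hh; rewrite /ip -RintegralZl//; last exact: dotv_integrable.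
by apply: eq_Rintegral => t _; rewrite dotvZl.
Qed.

Lemma ipDr k (f g h : R -> 'cV[R]_k) : L2 a b f -> L2 a b g -> L2 a b h ->
  ip h (fun t => f t + g t) = ip h f + ip h g.
Proof. by move=> *; rewrite ipC ipDl// !(ipC h). Qed.

Lemma ipZr k c (f h : R -> 'cV[R]_k) : L2 a b f -> L2 a b h ->
  ip h (fun t => c *: f t) = c * ip h f.
Proof. by move=> *; rewrite ipC ipZl// ipC. Qed.

Lemma ipNl k (f h : R -> 'cV[R]_k) : L2 a b f -> L2 a b h ->
  ip (fun t => - f t) h = - ip f h.
Proof.
by move=> hf hh; rewrite -mulN1r -ipZl//; under [in RHS]eq_fun do rewrite scaleN1r.
Qed.

Lemma ipBl k (f g h : R -> 'cV[R]_k) : L2 a b f -> L2 a b g -> L2 a b h ->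
  ip (fun t => f t - g t) h = ip f h - ip g h.
Proof. by move=> hf hg hh; rewrite ipDl ?ipNl//; apply: L2N. Qed.

Lemma ip_ge0 k (f : R -> 'cV[R]_k) : 0 <= ip f f.
Proof. by apply: Rintegral_ge0 => t _; apply: dotv_ge0. Qed.

Lemma ip_ae k (f g f' g' : R -> 'cV[R]_k) :
  L2 a b f -> L2 a b g -> L2 a b f' -> L2 a b g' ->
  ae_eq mu D f f' -> ae_eq mu D g g' -> ip f g = ip f' g'.
Proof.
move=> hf hg hf' hg' ff' gg'.
apply: intD_ae; [|exact: dotv_integrable..].
by apply: filterS2 ff' gg' => t h1 h2 Dt; rewrite h1// h2.
Qed.

Lemma ip_eq0 k (f : R -> 'cV[R]_k) : L2 a b f -> ip f f = 0 -> ae_eq mu D f (fun=> 0).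
Proof.
move=> hf f0.
have := intD_ge0_eq0 (dotv_integrable hf hf) (fun t _ => dotv_ge0 (f t)) f0.
by apply: filterS => t ht Dt; apply: dotv_eq0; apply: ht.
Qed.

Lemma L2norm_sqr k (f : R -> 'cV[R]_k) : L2norm a b f ^+ 2 = ip f f.
Proof.
rewrite sqr_sqrtr; first by apply: eq_Rintegral => t _; rewrite enorm_sqr.
by apply: Rintegral_ge0 => t _; apply: sqr_ge0.
Qed.

Lemma ip_expand k (f g : R -> 'cV[R]_k) s : L2 a b f -> L2 a b g ->
  ip (fun t => f t + s *: g t) (fun t => f t + s *: g t) =
  ip f f + 2 * s * ip f g + s ^+ 2 * ip g g.
Proof.
move=> hf hg; have hsg := L2Z s hg; have hfg := L2D hf hsg.
by rewrite ipDl// !ipDr// !ipZl// !ipZr// (ipC g f); ring.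
Qed.

Lemma ipE k (f g : R -> 'cV[R]_k) : L2 a b f -> L2 a b g ->
  ip f g = \sum_i intD (fun t => f t i 0 * g t i 0).
Proof.
move=> /L2P hf /L2P hg; rewrite /ip /dotv /Rintegral.
under eq_integral do rewrite -sumEFin.
rewrite integral_sum//; last by move=> i; exact: (sL2_mul_integrable (hf i) (hg i)).
rewrite -[RHS]/(fine (_%:E)) -sumEFin; congr fine; apply: eq_bigr => i _.
rewrite fineK//; apply: integrable_fin_num => //.
exact: (sL2_mul_integrable (hf i) (hg i)).
Qed.

Lemma ip_triangle k (f g h : R -> 'cV[R]_k) : L2 a b f -> L2 a b g -> L2 a b h ->
  ip (fun t => f t - h t) (fun t => f t - h t) <=
  2 * ip (fun t => f t - g t) (fun t => f t - g t) +
  2 * ip (fun t => g t - h t) (fun t => g t - h t).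
Proof.
move=> hf hg hh; have hfg := L2B hf hg; have hgh := L2B hg hh.
have := ip_ge0 (fun t => (f t - g t) + (-1) *: (g t - h t)).
rewrite ip_expand//.
have -> : ip (fun t => f t - h t) (fun t => f t - h t) =
    ip (fun t => (f t - g t) + 1 *: (g t - h t)) (fun t => (f t - g t) + 1 *: (g t - h t)).
  by apply: ip_eq => t _; rewrite scale1r addrA subrK.
by rewrite ip_expand//; lra.
Qed.

(** Coordinatewise Riesz-Fischer. *)
Theorem L2_complete k (f : nat -> R -> 'cV[R]_k) : (forall i, L2 a b (f i)) ->
  (forall e, 0 < e -> exists N, forall i j, (N <= i)%N -> (N <= j)%N ->
     ip (fun t => f i t - f j t) (fun t => f i t - f j t) <= e) ->
  exists2 g, L2 a b g &
    ip (fun t => f i t - g t) (fun t => f i t - g t) @[i --> \oo] --> (0 : R).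
Proof.
move=> hf cau.
have hfs i c : sL2 a b (fun t => f i t c 0) by have /L2P := hf i; apply.
have /choice[g hg] : forall c, exists g, sL2 a b g /\ forall e, 0 < e -> exists N, forall i,
     (N <= i)%N -> intD (fun t => (f i t c 0 - g t) ^+ 2) <= e.
  move=> c; have [|g hg lim] := sL2_complete (fun i => hfs i c).
    move=> e /cau[N hN]; exists N => i j Ni Nj; apply: le_trans (hN i j Ni Nj).
    have hij := L2B (hf i) (hf j).
    rewrite ipE// (bigD1 c)//=.
    apply: (@le_trans _ _ (intD (fun t => (f i t - f j t) c 0 * (f i t - f j t) c 0))).
      by rewrite le_eqVlt; apply/orP; left; apply/eqP/eq_Rintegral => t _; rewrite !mxE expr2.
    by rewrite lerDl sumr_ge0// => l _; apply: Rintegral_ge0 => t _; rewrite -expr2 sqr_ge0.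
  by exists g.
pose G t := \col_c g c t.
have hG : L2 a b G.
  by apply/L2P => c; under eq_fun do rewrite mxE; exact: (hg c).1.
exists G => //.
apply/cvgrPdist_le => e e0.
have e'0 : 0 < e / (k%:R + 1) by rewrite divr_gt0// ltr_wpDl.
have /choice[N hN] c := (hg c).2 _ e'0.
exists (\sum_c N c)%N => // i /= Ni.
rewrite sub0r normrN ger0_norm ?ip_ge0//.
rewrite ipE//; [|exact: (L2B (hf i) hG)..].
apply: (@le_trans _ _ (\sum_(c < k) e / (k%:R + 1))); last first.
  rewrite sumr_const card_ord -(mulr_natr (e / _)) mulrAC ler_pdivrMr ?ltr_wpDl//.
  by rewrite ler_wpM2l ?lerDl// ltW.
apply: ler_sum => c _; apply: le_trans (hN c i _).
  rewrite le_eqVlt; apply/orP; left; apply/eqP/eq_Rintegral => t _.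
  by rewrite !mxE expr2.
by apply: leq_trans Ni; rewrite (bigD1 c)//= leq_addr.
Qed.

(** The sum of the bounds of the entries is a bound of the form, uniform in time. *)
Lemma bmx_form_le k (M : R -> 'M[R]_k) : bmx M -> exists2 K, 0 <= K &
  forall t x, t \in `[a, b] -> dotv (M t *m x) x <= K * dotv x x.
Proof.
move=> bM.
have /choice[K' hK'] : forall ij : 'I_k * 'I_k, exists K, forall t, D t -> `|M t ij.1 ij.2| <= K.
  by move=> ij; have [_] := bM ij.1 ij.2.
pose K i j := K' (i, j).
have hK i j t : D t -> `|M t i j| <= K i j by apply: (hK' (i, j)).
pose S := \sum_i \sum_j `|K i j|.
exists S => [|t x tD]; first by rewrite sumr_ge0// => i _; rewrite sumr_ge0.
have le_xx i j : `|x i 0 * x j 0| <= dotv x x.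
  rewrite normrM.
  have := le_sqr_dotv x i; have := le_sqr_dotv x j.
  rewrite -(real_normK (num_real (x i 0))) -(real_normK (num_real (x j 0))).
  have := sqr_ge0 (`|x i 0| - `|x j 0|); rewrite !expr2; nra.
rewrite {1}/dotv /S mulr_suml; apply: ler_sum => i _.
rewrite mxE mulr_suml mulr_suml; apply: ler_sum => j _.
apply: le_trans (ler_norm _) _; rewrite -mulrA normrM.
apply: (ler_pM _ _ _ (le_xx j i)) => //.
exact: le_trans (hK i j t tD) (ler_norm _).
Qed.

End VectorL2.

Lemma dotv_mulmx_le (R : realType) k l (M : 'M[R]_(k, l)) : exists2 K, 0 <= K &
  forall x, dotv (M *m x) (M *m x) <= K * dotv x x.
Proof.
have [K K0 hK] := bmx_form_le (bmx_cst 0 0 (M^T *m M)); exists K => // x.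
by rewrite dotv_mulmxr mulmxA; apply: (hK 0 x); rewrite in_itv/= lexx.
Qed.

Section VectorL2Estimates.
Context (R : realType) (a b : R).
Local Notation mu := (@lebesgue_measure R).
Local Notation D := (`[a, b]%classic : set (measurableTypeR R)).
Local Notation ip := (ip a b).
Local Notation L2 := (L2 a b).
Hint Resolve mD : core.

Lemma L2_0 k : L2 (fun=> 0 : 'cV[R]_k). Proof. exact: L2_cst. Qed.

Lemma ip0l k (f : R -> 'cV[R]_k) : ip (fun=> 0) f = 0.
Proof.
transitivity (\int[mu]_(t in D) (0 : R)); first by apply: intD_eq => t _; rewrite dotv0l.
by rewrite Rintegral_cst// mul0r.
Qed.

Lemma ip_add_le k (f g : R -> 'cV[R]_k) : L2 f -> L2 g ->
  ip (fun t => f t + g t) (fun t => f t + g t) <= 2 * ip f f + 2 * ip g g.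
Proof.
move=> hf hg; have := ip_ge0 a b (fun t => f t + (-1) *: g t).
have -> : ip (fun t => f t + g t) (fun t => f t + g t) =
    ip (fun t => f t + 1 *: g t) (fun t => f t + 1 *: g t).
  by apply: ip_eq => t _; rewrite scale1r.
by rewrite (ip_expand (-1) hf hg) (ip_expand 1 hf hg); lra.
Qed.

Lemma ip_mulmx_le k l (M : R -> 'M[R]_(k, l)) : bmx a b M -> exists2 K, 0 <= K &
  forall f, L2 f -> ip (fun t => M t *m f t) (fun t => M t *m f t) <= K * ip f f.
Proof.
move=> bM; have [K K0 hK] := bmx_form_le (bmx_mul (bmx_tr bM) bM).
exists K => // f hf; have hMf := L2_mulmx bM hf.
rewrite -(ipZr K hf hf); apply: le_Rintegral => //.
- exact: (dotv_integrable hMf hMf).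
- exact: (dotv_integrable hf (L2Z K hf)).
by move=> t tD /=; rewrite dotv_mulmxr dotvZr mulmxA; apply: hK.
Qed.

Lemma ip_symm k (M : R -> 'M[R]_k) f g :
  (forall t, t \in `[a, b] -> (M t)^T = M t) ->
  ip f (fun t => M t *m g t) = ip g (fun t => M t *m f t).
Proof.
by move=> sM; apply: ip_eq => t tD; rewrite dotv_mulmxr sM// dotvC.
Qed.

Lemma ip_possemidef k (M : R -> 'M[R]_k) f :
  (forall t, t \in `[a, b] -> sym_possemidef (M t)) -> 0 <= ip f (fun t => M t *m f t).
Proof. by move=> pM; apply: Rintegral_ge0 => t tD; rewrite dotvC; apply: (pM t tD).2. Qed.

Lemma ip_square_ge0 k (M : R -> 'M[R]_k) s (u e : R -> 'cV[R]_k) :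
  (forall t, t \in `[a, b] -> sym_posdef (M t)) -> bmx a b M ->
  bmx a b (fun t => invmx (M t)) -> L2 u -> L2 e ->
  0 <= ip (fun t => M t *m e t) e + 2 * s * ip u e +
    s ^+ 2 * ip u (fun t => invmx (M t) *m u t).
Proof.
move=> pM bM bMi hu he; have hMe := L2_mulmx bM he; have hMu := L2_mulmx bMi hu.
have i1 := dotv_integrable hMe he; have i2 := dotv_integrable hu he.
have i3 := dotv_integrable hu hMu.
have j2 := integrable_itv_scale (2 * s) i2; have j3 := integrable_itv_scale (s ^+ 2) i3.
have : 0 <= \int[mu]_(t in D) (dotv (M t *m e t) (e t) + 2 * s * dotv (u t) (e t) +
    s ^+ 2 * dotv (u t) (invmx (M t) *m u t)).
  by apply: Rintegral_ge0 => t tD; apply/posdef_square_ge0/pM.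
rewrite (RintegralD (mD a b) (integrable_itv_add i1 j2) j3) (RintegralD (mD a b) i1 j2).
by rewrite (RintegralZl _ (mD a b) i2) (RintegralZl _ (mD a b) i3).
Qed.

(** Integrating [posdef_inv_coercive]: since the weight is bounded above, its
    inverse is bounded below. *)
Lemma ip_coercive k (M : R -> 'M[R]_k) : bmx a b M ->
  bmx a b (fun t => invmx (M t)) ->
  (forall t, t \in `[a, b] -> sym_posdef (M t)) ->
  exists2 K, 0 <= K & forall f, L2 f -> ip f f <= K * ip f (fun t => invmx (M t) *m f t).
Proof.
move=> bM bMi pM; have [K K0 hK] := bmx_form_le bM; exists K => // f hf.
have hMf : L2 (fun t => invmx (M t) *m f t) by apply: L2_mulmx.
rewrite -ipZr//; apply: le_Rintegral => //.
- exact: dotv_integrable.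
- exact: (dotv_integrable hf (L2Z K hMf)).
move=> t tD /=; rewrite dotvZr (dotvC (f t) (_ *m _)).
by apply: posdef_inv_coercive; [exact: pM|exact: hK].
Qed.

Lemma L2norm_le k (f : R -> 'cV[R]_k) (e : R) : 0 <= e -> ip f f <= e ^+ 2 -> L2norm a b f <= e.
Proof.
move=> e0; rewrite -L2norm_sqr => h.
by rewrite -(@ler_pXn2r _ 2)// nnegrE// sqrtr_ge0.
Qed.

Lemma integral_dotv k (f g : R -> 'cV[R]_k) : L2 f -> L2 g ->
  (\int[mu]_(t in D) (dotv (f t) (g t))%:E = (ip f g)%:E)%E.
Proof.
move=> hf hg; rewrite -[RHS]/((fine _)%:E) fineK//.
exact: (integrable_fin_num (mD a b) (dotv_integrable hf hg)).
Qed.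

End VectorL2Estimates.

(** Cauchy-Schwarz for the dual pair of weights [M] and [M^-1], by completing
    the square. *)
Lemma weighted_cauchy_schwarz (R : realType) (a b : R) k (M : R -> 'M[R]_k)
    (u e : R -> 'cV[R]_k) :
  (forall t, t \in `[a, b] -> sym_posdef (M t)) ->
  bmx a b M -> bmx a b (fun t => invmx (M t)) -> L2 a b u -> L2 a b e ->
  ip a b u e ^+ 2 <=
  ip a b u (fun t => invmx (M t) *m u t) * ip a b (fun t => M t *m e t) e.
Proof.
move=> M_pd M_b Mi_b hu he; rewrite mulrC; apply: discriminant => [s|].
  exact: ip_square_ge0.
by apply: ip_possemidef => t tD; apply/posdef_possemidef/posdef_inv/M_pd.
Qed.

(** * Absolutely continuous representatives *)

Section Sobolev.
Context (R : realType) (a b : R) (ab : a < b).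
Local Notation mu := (@lebesgue_measure R).
Local Notation D := (`[a, b]%classic : set (measurableTypeR R)).
Local Notation intD f := (\int[mu]_(t in D) (f t))%R.
Local Notation ip := (ip a b).
Hint Resolve mD : core.
Implicit Types k l : nat.

(** The triple of a class [v] of [H_1], its derivative [w] and its absolutely
    continuous representative [g]. The integrated form stands for absolute
    continuity together with differentiability almost everywhere, and is
    manifestly stable under linear operations. *)
Definition rep k (v w g : R -> 'cV[R]_k) :=
  [/\ L2 a b w, ae_eq mu D g v &
    forall t, t \in `[a, b] -> forall i, g t i 0 = g a i 0 + prim a b (fun s => w s i 0) t].

Lemma aD : a \in `[a, b]. Proof. by rewrite in_itv/= lexx ltW. Qed.
Lemma bD : b \in `[a, b]. Proof. by rewrite in_itv/= lexx ltW. Qed.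

Lemma L2_coord k (w : R -> 'cV[R]_k) i : L2 a b w -> sL2 a b (fun t => w t i 0).
Proof. by move=> /L2P. Qed.

Lemma le_coord_enorm k (x : 'cV[R]_k) i : `|x i 0| <= enorm x.
Proof.
rewrite -(@ler_pXn2r _ 2) ?nnegrE// ?sqrtr_ge0//.
by rewrite enorm_sqr real_normK ?num_real ?le_sqr_dotv.
Qed.

Lemma enorm_le_sum k (x : 'cV[R]_k) : enorm x <= \sum_i `|x i 0|.
Proof.
rewrite -(@ler_pXn2r _ 2) ?nnegrE// ?sqrtr_ge0 ?sumr_ge0//.
rewrite enorm_sqr [leRHS]expr2 mulr_suml; apply: ler_sum => i _; rewrite -expr2.
rewrite -real_normK ?num_real// expr2 ler_wpM2l//.
by rewrite (bigD1 i)//= lerDl sumr_ge0.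
Qed.

Lemma abs_continuousP k (g : R -> 'cV[R]_k) :
  abs_continuous a b g <-> forall i, ac a b (fun t => g t i 0).
Proof.
split=> [acg i e /acg[del d0 h]|acg].
  exists del => // N s t st tr /(h _ _ _ st tr); apply: le_lt_trans.
  apply: ler_sum => j _; have -> : g (t j) i 0 - g (s j) i 0 = (g (t j) - g (s j)) i 0.
    by rewrite !mxE.
  exact: le_coord_enorm.
move=> e e0; have e'0 : 0 < e / (k%:R + 1) by rewrite divr_gt0// ltr_wpDl.
have /choice[del hdel] : forall i, exists del, 0 < del /\
    forall (N : nat) (s t : 'I_N -> R),
    (forall i, a <= s i /\ s i < t i /\ t i <= b) ->
    trivIset setT (fun i => `]s i, t i[%classic) ->
    \sum_(i < N) (t i - s i) < del ->
    \sum_(j < N) `|g (t j) i 0 - g (s j) i 0| < e / (k%:R + 1).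
  by move=> i; have [d d0 h] := acg i _ e'0; exists d.
exists (\big[Num.min/1]_(i < k) del i).
  by elim/big_ind: _ => // [x y x0 y0|i _]; [rewrite lt_min x0|exact: (hdel i).1].
move=> N s t st tr le_d.
apply: (@le_lt_trans _ _ (\sum_(i < k) \sum_(j < N) `|g (t j) i 0 - g (s j) i 0|)).
  rewrite exchange_big; apply: ler_sum => j _; apply: le_trans (enorm_le_sum _) _.
  by apply: ler_sum => i _; rewrite !mxE.
apply: (@le_lt_trans _ _ (\sum_(i < k) e / (k%:R + 1))).
  apply: ler_sum => i _; apply/ltW/((hdel i).2 _ _ _ st tr).
  by apply: lt_le_trans le_d _; rewrite (bigD1 i)//= ge_min lexx.
rewrite sumr_const card_ord -(mulr_natr (e / _)) mulrAC ltr_pdivrMr ?ltr_wpDl//.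
by rewrite ltr_pM2l// ltrDl.
Qed.

Lemma acrepP k (v : R -> 'cV[R]_k) : in_H1 a b v ->
  H1 a b (acrep a b v) /\ ae_eq mu D (acrep a b v) v.
Proof.
move=> [g Hg gv]; rewrite /acrep.
by case: xgetP => [h _ //|/(_ g)[]].
Qed.

Lemma ae_deriveP k (g w : R -> 'cV[R]_k) : ae_derive a b g w <->
  forall i, {ae mu, forall t : R, t \in `[a, b] -> is_derive t 1 (fun s => g s i 0) (w t i 0)}.
Proof.
split=> [h i|h].
  by apply: filterS h; [exact: (ae_filter_ringOfSetsType mu)|move=> t h1 /h1].
have : {ae mu, forall t i, t \in `[a, b] -> is_derive t 1 (fun s => g s i 0) (w t i 0)}.
  by apply: filter_forall => //; exact: (ae_filter_ringOfSetsType mu).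
apply: filterS; first exact: (ae_filter_ringOfSetsType mu).
by move=> t h1 tD i; apply: h1.
Qed.

Lemma rep_acrep k (v w : R -> 'cV[R]_k) : in_H1 a b v -> L2 a b w ->
  ae_derive a b (acrep a b v) w -> rep v w (acrep a b v).
Proof.
move=> /acrepP[[/abs_continuousP acg _] gv] hw /ae_deriveP dg; split=> // t tD i.
exact: (ac_prim (acg i) (L2_coord i hw) (dg i) tD).
Qed.

(** The representative given by the primitive, which is defined on the whole
    line. *)
Definition mkrep k (c : 'cV[R]_k) (w : R -> 'cV[R]_k) (t : R) : 'cV[R]_k :=
  \col_i (c i 0 + prim a b (fun s => w s i 0) t).

Lemma mkrep_a k c (w : R -> 'cV[R]_k) : mkrep c w a = c.
Proof. by apply/matrixP => i j; rewrite !mxE prim_a addr0 ord1. Qed.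

Lemma rep_mkrep k (v w g : R -> 'cV[R]_k) t : rep v w g -> t \in `[a, b] ->
  g t = mkrep (g a) w t.
Proof.
by move=> [_ _ h] tD; apply/matrixP => i j; rewrite mxE ord1 h.
Qed.

Lemma H1_mkrep k c (w : R -> 'cV[R]_k) : L2 a b w ->
  abs_continuous a b (mkrep c w) /\ ae_derive a b (mkrep c w) w.
Proof.
move=> hw; split.
  apply/abs_continuousP => i.
  rewrite (_ : (fun t => _) = (fun t => c i 0 + prim a b (fun s => w s i 0) t)).
    exact/prim_cst_ac/L2_coord.
  by apply/funext => t; rewrite mxE.
apply/ae_deriveP => i.
rewrite (_ : (fun t => mkrep c w t i 0) = (fun t => c i 0 + prim a b (fun s => w s i 0) t)).
  exact/prim_cst_derive/L2_coord.
by apply/funext => t; rewrite mxE.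
Qed.

(** The choice made by [acrep] does not matter: it agrees almost everywhere with
    the primitive, hence everywhere on the interval. *)
Lemma acrep_rep k (v w g : R -> 'cV[R]_k) : rep v w g ->
  [/\ in_H1 a b v, ae_derive a b (acrep a b v) w &
     forall t, t \in `[a, b] -> acrep a b v t = g t].
Proof.
move=> rg; have [hw gv _] := rg.
pose h := mkrep (g a) w; have [ach dh] := H1_mkrep (g a) hw.
have hv : ae_eq mu D h v.
  apply: filterS gv => t gvt Dt; rewrite -gvt//.
  by rewrite (rep_mkrep rg).
have iv : in_H1 a b v by exists h => //; split=> //; exists w.
have [[acr _] rv] := acrepP iv.
have eq_rh t : t \in `[a, b] -> acrep a b v t = h t.
  move=> tD; apply/matrixP => i j; rewrite ord1.
  have /abs_continuousP/(_ i) acri := acr; have /abs_continuousP/(_ i) achi := ach.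
  apply: (ac_ae_eq ab acri achi) => //.
  by apply: filterS2 rv hv => s h1 h2 sD; rewrite (h1 sD) -(h2 sD).
split=> //; last by move=> t tD; rewrite eq_rh// (rep_mkrep rg).
have neq c : {ae mu, forall t : R, t != c}.
  exists [set c]; split; [exact: measurable_set1|exact: lebesgue_measure_set1|].
  by move=> t /= /negP/negPn/eqP.
apply: filterS3 (neq a) (neq b) dh; first exact: (ae_filter_ringOfSetsType mu).
move=> t ta tb ht tD i; have {}ht := ht tD i.
have tab : t \in `]a, b[.
  by move: tD; rewrite !in_itv/= !lt_neqAle eq_sym ta tb => /andP[-> ->].
apply: near_eq_is_derive ht; near=> s; rewrite eq_rh//.
apply: subset_itv_oo_cc; near: s; exact: near_in_itvoo.
Unshelve. all: by end_near.
Qed.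

Lemma repD k (v w g v' w' g' : R -> 'cV[R]_k) : rep v w g -> rep v' w' g' ->
  rep (fun t => v t + v' t) (fun t => w t + w' t) (fun t => g t + g' t).
Proof.
move=> [hw gv hg] [hw' gv' hg']; split; first exact: L2D.
  by apply: filterS2 gv gv' => t h1 h2 Dt; rewrite h1// h2.
move=> t tD i; rewrite !mxE hg// hg'// addrACA -primD; try exact/sL2_integrable/L2_coord.
by congr (_ + prim _ _ _ _); apply/funext => s; rewrite mxE.
Qed.

Lemma rep_mulmx k l (M : 'M[R]_(l, k)) (v w g : R -> 'cV[R]_k) : rep v w g ->
  rep (fun t => M *m v t) (fun t => M *m w t) (fun t => M *m g t).
Proof.
move=> [hw gv hg]; split; first by apply: (L2_mulmx _ hw); apply: bmx_cst.
  by apply: filterS gv => t h1 Dt; rewrite h1.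
move=> t tD i; rewrite !mxE.
have -> : prim a b (fun s => (M *m w s) i 0) t =
    \sum_j M i j * prim a b (fun s => w s j 0) t.
  transitivity (prim a b (fun s => \sum_j M i j * w s j 0) t).
    by congr prim; apply/funext => s; rewrite mxE.
  have hi j : integrable_itv a b (fun s => M i j * w s j 0).
    exact/integrable_itv_scale/sL2_integrable/L2_coord.
  elim: (index_enum _) => [|j r IH].
    have h0 := primZ 0 t (integrable_itv_cst a b 0); rewrite !mul0r in h0.
    by rewrite big_nil -[RHS]h0; congr prim; apply/funext => s; rewrite big_nil.
  rewrite big_cons -IH -primZ; last exact/sL2_integrable/L2_coord.
  rewrite -primD//; first by congr prim; apply/funext => s; rewrite big_cons.
  apply: sL2_integrable; apply: sL2_sum => j'; exact/sL2Z/L2_coord.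
by rewrite -big_split; apply: eq_bigr => j _; rewrite hg// mulrDr.
Qed.

Lemma repZ k c (v w g : R -> 'cV[R]_k) : rep v w g ->
  rep (fun t => c *: v t) (fun t => c *: w t) (fun t => c *: g t).
Proof.
move=> /(rep_mulmx c%:M); congr rep; apply/funext => t; exact: mul_scalar_mx.
Qed.

Lemma rep_ae k (v w g v' w' : R -> 'cV[R]_k) : rep v w g -> L2 a b w' ->
  ae_eq mu D v v' -> ae_eq mu D w w' -> rep v' w' g.
Proof.
move=> [hw gv hg] hw' vv' ww'; split=> //; first exact: ae_eq_trans gv vv'.
move=> t tD i; rewrite hg//; congr (_ + _); rewrite !prim_eq//.
have tb : `[a, t]%classic `<=` (D : set R).
  move=> s /=; rewrite !in_itv/= => /andP[-> st]; apply: le_trans st _.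
  by move: tD; rewrite in_itv/= => /andP[].
have mt : measurable (`[a, t]%classic : set (measurableTypeR R)) by exact: measurable_itv.
congr fine; apply: ae_eq_integral => //.
- apply/measurable_EFinP; apply: (measurable_funS (mD a b) tb).
  exact: (L2_coord i hw).1.
- apply/measurable_EFinP; apply: (measurable_funS (mD a b) tb).
  exact: (L2_coord i hw').1.
- by apply: filterS ww' => s h Ds /=; rewrite h//; apply: tb.
Qed.

Lemma rep_L2 k (v w g : R -> 'cV[R]_k) : rep v w g -> L2 a b g.
Proof.
move=> rg; have [hw _ _] := rg.
apply/L2P => i; have := sL2_prim (g a i 0) (ltW ab) (L2_coord i hw).
have [_ _ gE] := rg.
have eqg : {in D, (fun t => g a i 0 + prim a b (fun s => w s i 0) t) =1 (fun t => g t i 0)}.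
  by move=> t; rewrite inE => Dt; rewrite (gE t Dt).
move=> [m1 m2]; split; first exact: eq_measurable_fun eqg m1.
rewrite /integrable_itv in m2 *; apply: eq_integrable m2 => // t tD /=.
by rewrite (eqg t tD).
Qed.

Lemma rep_by_parts k (v w g v' w' g' : R -> 'cV[R]_k) : rep v w g -> rep v' w' g' ->
  ip g w' + ip w g' = dotv (g b) (g' b) - dotv (g a) (g' a).
Proof.
move=> rg rg'; have [hw _ hg] := rg; have [hw' _ hg'] := rg'.
have Lg := rep_L2 rg; have Lg' := rep_L2 rg'.
rewrite !ipE// /dotv -sumrB -big_split; apply: eq_bigr => i _.
apply: (@prim_by_parts _ _ _ (fun t => g t i 0) (fun t => g' t i 0)).
- exact: ltW.
- exact: L2_coord.
- exact: L2_coord.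
- by move=> t tD; apply: hg.
- by move=> t tD; apply: hg'.
Qed.

Lemma sqr_int_le (w : R -> R) : sL2 a b w ->
  (intD (fun t => `|w t|)) ^+ 2 <= (b - a) * intD (fun t => w t ^+ 2).
Proof.
move=> hw; have iaw : integrable_itv a b (fun t => `|w t|).
  exact: (integrable_norm (sL2_integrable hw)).
apply: discriminant => [s|]; last by apply: Rintegral_ge0 => t _; apply: sqr_ge0.
have -> : b - a + 2 * s * intD (fun t => `|w t|) + s ^+ 2 * intD (fun t => w t ^+ 2) =
    intD (fun t => (1 + s * `|w t|) ^+ 2).
  have muD : fine (mu D) = b - a by rewrite lebesgue_measure_itv/= lte_fin ab.
  have -> : b - a = intD (fun=> 1) by rewrite Rintegral_cst// mul1r muD.
  rewrite -RintegralZl// -RintegralZl//; last exact: hw.2.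
  rewrite -RintegralD//; [|exact: integrable_itv_cst|exact: integrable_itv_scale].
  rewrite -RintegralD//; first last.
  - exact: integrable_itv_scale hw.2.
  - by apply: integrable_itv_add; [exact: integrable_itv_cst|exact: integrable_itv_scale].
  apply: intD_eq => t _; rewrite -[w t ^+ 2]real_normK ?num_real//; ring.
by apply: Rintegral_ge0 => t _; apply: sqr_ge0.
Qed.

(** The value at [t] is the value at the right end minus an integral, which
    Cauchy-Schwarz on an interval of length at most [b - a] controls. *)
Lemma rep_bound k (v w g : R -> 'cV[R]_k) t : rep v w g -> t \in `[a, b] ->
  dotv (g t) (g t) <= 2 * dotv (g b) (g b) + 2 * (b - a) * ip w w.
Proof.
move=> [hw _ hg] tD; rewrite ipE// /dotv !mulr_sumr -big_split /=.
apply: ler_sum => i _.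
have hwi := L2_coord i hw; have iwi := sL2_integrable hwi.
pose x := prim a b (fun s => w s i 0) b; pose y := prim a b (fun s => w s i 0) t.
pose M := intD (fun s => `|w s i 0|); pose N := intD (fun s => w s i 0 ^+ 2).
have h1 : `|x - y| <= M.
  move: tD; rewrite in_itv/= => /andP[at_ tb].
  apply: le_trans (primB_le iwi at_ tb (lexx _)) _.
  have iaw : integrable_itv a b (fun s => `|w s i 0|) by apply: (integrable_norm iwi).
  have sub : `]t, b[%classic `<=` (D : set R).
    by move=> r /=; rewrite !in_itv/= => /andP[h1 h2]; rewrite !ltW// (le_lt_trans at_).
  apply: fine_le.
  - apply: integrable_fin_num => //; apply: integrableS iaw => //.
  - exact: (integrable_fin_num (mD a b) iaw).
  - by apply: ge0_subset_integral => //; exact: measurable_int iaw.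
have h2 : M ^+ 2 <= (b - a) * N := sqr_int_le hwi.
have -> : intD (fun s => w s i 0 * w s i 0) = N by apply: intD_eq.
have -> : g b i 0 = g a i 0 + x := hg b bD i.
have -> : g t i 0 = g a i 0 + y := hg t tD i.
move: (g a i 0) => c; clearbody x y M N.
have h3 : (x - y) ^+ 2 <= M ^+ 2.
  rewrite -(real_normK (num_real (x - y))) ler_pXn2r ?nnegrE//.
  by apply: (le_trans _ h1).
have h4 := sqr_ge0 (c + x + (x - y)).
move: h2 h3 h4; rewrite !expr2; nra.
Qed.

Lemma rep_ext k (v w g v' w' : R -> 'cV[R]_k) : v =1 v' -> w =1 w' ->
  rep v w g -> rep v' w' g.
Proof. by move=> /funext <- /funext <-. Qed.

Lemma rep_cst0 k : rep (fun=> 0 : 'cV[R]_k) (fun=> 0) (fun=> 0).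
Proof.
split; [exact: L2_cst|exact: ae_eq_refl|] => t tD i; rewrite mxE add0r.
rewrite -[LHS](mul0r (prim a b (fun=> 0) t)) -primZ; last exact: integrable_itv_cst.
by congr prim; apply/funext => s; rewrite mul0r.
Qed.

End Sobolev.

Section RepUnique.
Context (R : realType) (a b : R) (ab : a < b).
Local Notation mu := (@lebesgue_measure R).
Local Notation D := (`[a, b]%classic : set (measurableTypeR R)).
Hint Resolve mD : core.

Lemma prim_inj_ae (w v : R -> R) : integrable_itv a b w -> integrable_itv a b v ->
  (forall t, t \in `[a, b] -> prim a b w t = prim a b v t) ->
  {ae mu, forall t, D t -> w t = v t}.
Proof.
move=> iw iv eq_wv.
have neq c : {ae mu, forall t : R, t != c}.
  exists [set c]; split; [exact: measurable_set1|exact: lebesgue_measure_set1|].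
  by move=> t /= /negP/negPn/eqP.
have neq2 : {ae mu, forall t : R, t != a /\ t != b}.
  apply: filterS2 (neq a) (neq b); first exact: (ae_filter_ringOfSetsType mu).
  by move=> t.
apply: filterS3 neq2 (prim_derive iw) (prim_derive iv).
  exact: (ae_filter_ringOfSetsType mu).
move=> t [ta tb] hw hv tD.
have tab : t \in `]a, b[.
  by move: (tD); rewrite /= !in_itv/= !lt_neqAle eq_sym ta tb => /andP[-> ->].
have dw := @derive_val _ _ _ _ _ _ _ (hw tD).
have hv' : is_derive t 1 (prim a b w) (v t).
  apply: near_eq_is_derive (hv tD); near=> s; rewrite eq_wv//.
  apply: subset_itv_oo_cc; near: s; exact: near_in_itvoo.
by rewrite -dw (@derive_val _ _ _ _ _ _ _ hv').
Unshelve. all: by end_near.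
Qed.

Lemma rep_eq k (v w g w' g' : R -> 'cV[R]_k) : rep a b v w g -> rep a b v w' g' ->
  forall t, t \in `[a, b] -> g t = g' t.
Proof.
move=> rg rg' t tD.
by have [_ _ <-//] := acrep_rep ab rg; have [_ _ ->] := acrep_rep ab rg'.
Qed.

Lemma rep_uniq k (v w g w' g' : R -> 'cV[R]_k) : rep a b v w g -> rep a b v w' g' ->
  ae_eq mu D w w'.
Proof.
move=> rg rg'; have eg := rep_eq rg rg'.
have [hw _ hg] := rg; have [hw' _ hg'] := rg'.
have : {ae mu, forall t i, D t -> w t i 0 = w' t i 0}.
  apply: filter_forall => i.
  apply: prim_inj_ae; [exact/sL2_integrable/L2_coord..|].
  move=> t tD; have := eg t tD => /matrixP/(_ i 0).
  rewrite (hg t tD) (hg' t tD) (eg a (aD ab)).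
  exact: addrI.
apply: filterS => t ht Dt; apply/matrixP => i j; rewrite ord1; exact: ht.
Qed.

(** Uniqueness of the representative and of its derivative lets a matrix that
    fixes [v] pass to both, although they are only determined through [v]. *)
Lemma rep_fix k (M : 'M[R]_k) (v w g : R -> 'cV[R]_k) : rep a b v w g ->
  (forall t, M *m v t = v t) ->
  ae_eq mu D (fun t => M *m w t) w /\ forall t, t \in `[a, b] -> M *m g t = g t.
Proof.
move=> rg Mv; have := rep_mulmx M rg; rewrite (funext Mv) => rM.
by split; [exact: rep_uniq rM rg|exact: rep_eq rM rg].
Qed.

Lemma rep0_eq0 k (v w g : R -> 'cV[R]_k) : rep a b v w g -> ae_eq mu D v (fun=> 0) ->
  forall t, t \in `[a, b] -> g t = 0.
Proof.
move=> rg v0.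
have [hw _ _] := rg.
have r0 : rep a b (fun=> 0 : 'cV[R]_k) (fun=> 0) (fun=> 0).
  split; [exact: L2_cst|exact/aeW|].
  move=> t tD i; rewrite mxE add0r.
  rewrite -[LHS](mul0r (prim a b (fun=> 0) t)) -primZ; last exact: integrable_itv_cst.
  by congr prim; apply/funext => s; rewrite mul0r.
exact: (rep_eq (rep_ae rg hw v0 (ae_eq_refl _ _ _)) r0).
Qed.

End RepUnique.

(** * The Riesz representation theorem for a complete nonnegative form *)

Section Riesz.
Context (R : realType) (V : Type) (comb : V -> R -> V -> V) (P : V -> Prop).
Context (B : V -> V -> R) (L : V -> R) (K : R).

Hypothesis (P_comb : forall c v w, P v -> P w -> P (comb v c w)).
Hypothesis (P_inh : exists v, P v).
Hypothesis (BC : forall v w, B v w = B w v).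
Hypothesis (B_comb : forall c v w x, P v -> P w -> P x ->
  B (comb v c w) x = B v x + c * B w x).
Hypothesis (B_ge0 : forall v, P v -> 0 <= B v v).
Hypothesis (L_comb : forall c v w, P v -> P w -> L (comb v c w) = L v + c * L w).
Hypothesis (K0 : 0 <= K).
Hypothesis (L_le : forall v, P v -> L v ^+ 2 <= K * B v v).
Hypothesis (B_complete : forall v : nat -> V, (forall i, P (v i)) ->
  (forall e, 0 < e -> exists N, forall i j, (N <= i)%N -> (N <= j)%N ->
     B (comb (v i) (-1) (v j)) (comb (v i) (-1) (v j)) <= e) ->
  exists2 w, P w & B (comb (v i) (-1) w) (comb (v i) (-1) w) @[i --> \oo] --> (0 : R)).

Let J v := B v v - 2 * L v.

Let J_comb c v w : P v -> P w ->
  J (comb v c w) = J v + 2 * c * (B v w - L w) + c ^+ 2 * B w w.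
Proof.
move=> Pv Pw; have Pc := P_comb c Pv Pw.
by rewrite /J L_comb// B_comb// !(BC _ (comb _ _ _)) !B_comb// (BC w v); ring.
Qed.

Let J_ge v : P v -> - K <= J v.
Proof.
move=> Pv; have := L_le Pv; have := B_ge0 Pv; rewrite /J => b0 lk.
have h : (2 * L v) ^+ 2 <= (B v v + K) ^+ 2.
  have := sqr_ge0 (B v v - K); rewrite exprMn !expr2 in lk *; lra.
suff : 2 * L v <= B v v + K by lra.
apply: le_trans (ler_norm _) _.
by rewrite -(@ler_pXn2r _ 2) ?nnegrE ?addr_ge0// real_normK ?num_real.
Qed.

Let B_cs v w : P v -> P w -> B v w ^+ 2 <= B v v * B w w.
Proof.
move=> Pv Pw; apply: discriminant; last exact: B_ge0.
move=> s; have Pc := P_comb s Pv Pw; have := B_ge0 Pc.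
by rewrite B_comb// !(BC _ (comb _ _ _)) !B_comb// (BC w v); lra.
Qed.

(** The Riesz representation theorem for a nonnegative form that is complete,
    without passing to the quotient by its kernel: a minimizing sequence of
    [B v v - 2 L v] is Cauchy by the parallelogram law. *)
Theorem riesz : exists2 v, P v & forall x, P x -> B v x = L x.
Proof.
pose A := [set J v | v in P].
have infA : has_inf A.
  split; first by have [v Pv] := P_inh; exists (J v), v.
  by exists (- K) => _ [v Pv <-]; apply: J_ge.
pose I := inf A.
have I_le v : P v -> I <= J v by move=> Pv; apply: ge_inf; [exact: infA.2|exists v].
have /choice[v hv] : forall i : nat, exists v, P v /\ J v <= I + i.+1%:R^-1.
  move=> i; have i0 : 0 < (i.+1%:R^-1 : R) by rewrite invr_gt0.
  by have [_ [v Pv <-] /ltW h] := inf_adherent i0 infA; exists v.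
have Pv i := (hv i).1.
pose e i := J (v i) - I.
have e_le i : e i <= i.+1%:R^-1 by rewrite /e lerBlDl; exact: (hv i).2.
have para i j : B (comb (v i) (-1) (v j)) (comb (v i) (-1) (v j)) <= 2 * e i + 2 * e j.
  have Pd := P_comb (-1) (Pv i) (Pv j).
  have := I_le _ (P_comb (- 2^-1) (Pv i) Pd); rewrite J_comb//.
  rewrite /e /J L_comb// B_comb// !(BC _ (comb _ _ _)) !B_comb// (BC (v j) (v i)).
  by rewrite !expr2; lra.
have e_0 : (i.+1%:R^-1 : R) @[i --> \oo] --> (0 : R) by exact: cvg_harmonic.
have [|w Pw cw] := B_complete Pv.
  move=> r r0; have : \forall i \near \oo, i.+1%:R^-1 <= r / 4.
    by apply: (cvgr_le _ e_0); rewrite divr_gt0.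
  move=> [N _ hN]; exists N => i j Ni Nj; apply: le_trans (para i j) _.
  have h1 : e i <= r / 4 := le_trans (e_le i) (hN i Ni).
  have h2 : e j <= r / 4 := le_trans (e_le j) (hN j Nj).
  by lra.
exists w => // x Px.
have h1 i : (B (v i) x - L x) ^+ 2 <= i.+1%:R^-1 * B x x.
  apply: le_trans (_ : e i * B x x <= _); last by rewrite ler_wpM2r ?B_ge0.
  apply: discriminant; last exact: B_ge0.
  by move=> s; have := I_le _ (P_comb s (Pv i) Px); rewrite J_comb// /e; lra.
have h2 i : (B (v i) x - B w x) ^+ 2 <=
    B (comb (v i) (-1) w) (comb (v i) (-1) w) * B x x.
  have Pd := P_comb (-1) (Pv i) Pw.
  by apply: le_trans (B_cs Pd Px); rewrite B_comb// mulN1r.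
apply/eqP; rewrite -subr_eq0 -sqrf_eq0; apply/eqP/le_anti; rewrite sqr_ge0 andbT.
apply: (@le0_of_cvg _ _ (fun i => 2 * (i.+1%:R^-1 * B x x) +
   2 * (B (comb (v i) (-1) w) (comb (v i) (-1) w) * B x x))) => [i|]; last first.
  rewrite [X in _ --> X](_ : 0 = 2 * (0 * B x x) + 2 * (0 * B x x)); last by rewrite !(mul0r, mulr0) addr0.
  by apply: cvgD; apply: cvgMr; apply: cvgMl.
have := h1 i; have := h2 i; have := sqr_ge0 ((B (v i) x - L x) + (B (v i) x - B w x)).
rewrite !expr2; move: (_ * B x x) (_ * B x x) => y y'; lra.
Qed.

End Riesz.

(** * Random functionals of the observation noise *)

(** Processes are measurable only on the strip over [[a, b]]; they are extended by
    zero outside it, since the theorems of Tonelli and Fubini live on the whole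
    product space. *)
Section FubiniInterval.
Context (R : realType) (a b : R).
Context (dsp : measure_display) (Om : measurableType dsp) (P : probability Om R).
Local Notation mu := (@lebesgue_measure R).
Local Notation D := (`[a, b]%classic : set (measurableTypeR R)).
Hint Resolve mD : core.
Context (X : measurableTypeR R * Om -> R).
Hypothesis (mX : measurable_fun (D `*` [set: Om]) X).

Let f (wt : Om * measurableTypeR R) : \bar R :=
  (((fun wt => X (wt.2, wt.1)) \_ ([set: Om] `*` D)) wt)%:E.

Let mf : measurable_fun setT f.
Proof.
have mT : measurable ([set: Om] `*` D) by exact: measurableX.
pose sw (wt : Om * measurableTypeR R) := (wt.2, wt.1).
have msw : measurable_fun ([set: Om] `*` D) sw.
  by apply: measurable_funTS; exact: measurable_swap.
have sub : sw @` ([set: Om] `*` D) `<=` D `*` [set: Om] by move=> _ [[w t] [/= _ tD] <-].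
have mDT : measurable (D `*` [set: Om]) by exact: measurableX.
apply/measurable_EFinP; apply: ((measurable_restrictT (X \o sw) mT).1 _).
exact: (measurable_comp mDT sub mX msw).
Qed.

Let f_in w t : D t -> f (w, t) = (X (t, w))%:E.
Proof. by move=> Dt; rewrite /f patchE mem_set. Qed.

Let f_out w t : ~ D t -> f (w, t) = 0%E.
Proof. by move=> Dt; rewrite /f patchE memNset// => -[]. Qed.

Let int_t w : (\int[mu]_t f (w, t) = \int[mu]_(t in D) (X (t, w))%:E)%E.
Proof.
rewrite [RHS]integral_mkcond; apply: eq_integral => t _; rewrite patchE.
by case: ifPn => [|/negP]; rewrite inE; [exact: f_in|exact: f_out].
Qed.

Let int_w : (\int[mu]_t \int[P]_w f (w, t) = \int[mu]_(t in D) \int[P]_w (X (t, w))%:E)%E.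
Proof.
rewrite [RHS]integral_mkcond; apply: eq_integral => t _; rewrite patchE.
case: ifPn => [|/negP]; rewrite inE => Dt.
  by apply: eq_integral => w _; exact: f_in.
by rewrite -[RHS](integral0 P setT); apply: eq_integral => w _; exact: f_out.
Qed.

Lemma measurable_slice_t w : measurable_fun D (fun t => X (t, w)).
Proof.
have msw : measurable_fun D (fun t => (t, w)) by apply: measurable_funTS; exact: pair2_measurable.
have sub : (fun t => (t, w)) @` D `<=` D `*` [set: Om] by move=> _ [t tD <-].
have mDT : measurable (D `*` [set: Om]) by exact: measurableX.
exact: (measurable_comp mDT sub mX msw).
Qed.

Lemma measurable_slice_w t : D t -> measurable_fun [set: Om] (fun w => X (t, w)).
Proof.
move=> tD; have msw : measurable_fun [set: Om] (fun w => (t, w)) by exact: pair1_measurable.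
have sub : (fun w => (t, w)) @` [set: Om] `<=` D `*` [set: Om] by move=> _ [w _ <-].
have mDT : measurable (D `*` [set: Om]) by exact: measurableX.
exact: (measurable_comp mDT sub mX msw).
Qed.

Lemma tonelli_itv : (forall t w, D t -> 0 <= X (t, w)) ->
  measurable_fun [set: Om] (fun w => \int[mu]_(t in D) (X (t, w))%:E)%E /\
  (\int[P]_w \int[mu]_(t in D) (X (t, w))%:E =
   \int[mu]_(t in D) \int[P]_w (X (t, w))%:E)%E.
Proof.
move=> X0.
have f0 wt : (0 <= f wt)%E.
  case: wt => w t; have [Dt|Dt] := pselect (D t); first by rewrite f_in// lee_fin X0.
  by rewrite f_out.
split.
  rewrite (_ : (fun w => _) = fubini_F mu f); last by apply/funext => w; rewrite -int_t.
  exact: (measurable_fun_fubini_tonelli_F f mf f0).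
rewrite -int_w -(fubini_tonelli f mf f0).
by apply: eq_integral => w _; rewrite int_t.
Qed.

Lemma fubini_itv : (\int[P]_w \int[mu]_(t in D) `|X (t, w)|%:E < +oo)%E ->
  P.-integrable [set: Om] (fun w => \int[mu]_(t in D) (X (t, w))%:E)%E /\
  (\int[P]_w \int[mu]_(t in D) (X (t, w))%:E =
   \int[mu]_(t in D) \int[P]_w (X (t, w))%:E)%E.
Proof.
move=> Xfin.
have imf : (P \x mu)%E.-integrable setT f.
  apply/(integrable12ltyP _ _ mf).
  apply: le_lt_trans Xfin; rewrite le_eqVlt; apply/orP; left; apply/eqP.
  apply: eq_integral => w _; rewrite [RHS]integral_mkcond; apply: eq_integral => t _.
  rewrite patchE; case: ifPn => [|/negP]; rewrite inE => Dt; first by rewrite f_in.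
  by rewrite f_out// abse0.
split.
  rewrite (_ : (fun w => _) = fubini_F mu f); last by apply/funext => w; rewrite -int_t.
  exact: integrable_fubini_F.
rewrite -int_w -(Fubini imf).
by apply: eq_integral => w _; rewrite int_t.
Qed.

End FubiniInterval.

Section Noise.
Context (R : realType) (q : nat) (a b : R).
Local Notation mu := (@lebesgue_measure R).
Local Notation D := (`[a, b]%classic : set (measurableTypeR R)).
Local Notation ip := (ip a b).
Local Notation L2 := (L2 a b).
Context (Rn : R -> 'M[R]_q).
Hypothesis (Rn_pd : forall t, t \in `[a, b] -> sym_posdef (Rn t)).
Hypothesis (Rn_b : bmx a b Rn) (Ri_b : bmx a b (fun t => invmx (Rn t))).
Hint Resolve mD : core.

Let Ri t := invmx (Rn t).

Lemma half01 : 0 <= (2^-1 : R) <= 1.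
Proof. by rewrite invr_ge0 ler0n invf_le1// ler1n. Qed.

Local Notation coin := (bernoulli_prob (2^-1 : R)).

Lemma expectation_coin (f : bool -> R) :
  ('E_coin[f] = ((f true + f false) / 2)%:E)%E.
Proof.
rewrite unlock integralE !(integral_bernoulli_prob half01)//.
have mx (x : R) : Num.max x 0 = x + Num.max (- x) 0.
  have [x0|x0] := leP x 0; first by rewrite (max_l (_ : 0 <= - x)) ?oppr_ge0// subrr.
  by rewrite (max_r (_ : - x <= 0)) ?addr0// oppr_le0 ltW.
rewrite !funeposE !funenegE /= -!EFin_max -!EFinM -!EFinD /unstable.onem.
by rewrite (mx (f true)) (mx (f false)); congr (_%:E); field.
Qed.

Definition sgnb (w : bool) : R := if w then 1 else -1.

Lemma mxtrace_form (M : 'M[R]_q) (x : 'cV[R]_q) : \tr (M *m (x *m x^T)) = dotv (M *m x) x.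
Proof.
by rewrite mulmxA mxtrace_mulC dotvC dotvE /mxtrace big_ord1.
Qed.

(** The extremal noise is [R^-1 u], normalised to saturate [calW], with a random
    sign to make it centred: the sign kills the cross term of the squared error. *)
Theorem noise_lower (u y0 : R -> 'cV[R]_q) (c : R) : L2 u -> L2 y0 ->
  exists (dsp : measure_display) (Om : measurableType dsp) (P : probability Om R)
    (eta : R -> Om -> 'cV[R]_q),
    [/\ centered_process a b P eta, calW a b Rn (correlation P eta) &
      'E_P[(fun w => (c - obs_functional a b u (fun t => y0 t + eta t w)) ^+ 2)%R]%E =
      ((c - ip u y0) ^+ 2 + ip u (fun t => Ri t *m u t))%:E].
Proof.
move=> hu hy.
have hRu : L2 (fun t => Ri t *m u t) := L2_mulmx Ri_b hu.
pose N := ip u (fun t => Ri t *m u t).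
have N0 : 0 <= N.
  apply: Rintegral_ge0 => t tD; rewrite dotvC.
  exact: (posdef_possemidef (posdef_inv (Rn_pd tD))).2.
pose r := (Num.sqrt N)^-1.
pose g t := r *: (Ri t *m u t).
have hg : L2 g := L2Z r hRu.
have r_N : r * N = Num.sqrt N.
  have [->|N1] := eqVneq N 0; first by rewrite mulr0 sqrtr0.
  rewrite /r -{2}(sqr_sqrtr N0) expr2 mulKf//.
  by rewrite sqrtr_eq0 -ltNge lt_neqAle eq_sym N1.
exists _, bool, coin, (fun t w => sgnb w *: g t); split.
- split.
  + move=> i; rewrite (_ : (fun _ => _) = (fun tw => sgnb tw.2 * g tw.1 i 0)); last first.
      by apply/funext => tw; rewrite mxE.
    apply: measurable_funM.
      by apply: measurableT_comp => //; exact: measurable_funTS.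
    apply: (@measurable_comp _ _ _ _ _ _ D (fun t => g t i 0)) => //.
    * by move=> _ [[t w] [/= tD _] <-].
    * exact: (L2_coord i hg).1.
    * exact: measurable_funTS.
  + by move=> t _; rewrite expectation_coin ltry.
  + move=> t _ i; rewrite expectation_coin /= !mxE /sgnb mul1r mulN1r subrr mul0r.
    by [].
- rewrite /calW /=.
  apply: (@le_trans _ _ (\int[mu]_(t in D) (dotv (Rn t *m g t) (g t))%:E)%E).
    rewrite le_eqVlt; apply/orP; left; apply/eqP/eq_integral => t _.
    congr (_%:E); rewrite -mxtrace_form; congr (\tr (_ *m _)).
    apply/matrixP => i j; rewrite mxE expectation_coin.
    have sq w : (sgnb w *: g t) *m (sgnb w *: g t)^T = g t *m (g t)^T.
      have -> : (sgnb w *: g t)^T = sgnb w *: (g t)^T by apply/matrixP => ? ?; rewrite !mxE.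
      rewrite -scalemxAl -scalemxAr scalerA.
      by case: w; rewrite /sgnb ?mulrNN mulr1 scale1r.
    by rewrite !sq /=; field.
  rewrite (integral_dotv (L2_mulmx Rn_b hg) hg).
  rewrite lee_fin (ipZr r hRu (L2_mulmx Rn_b hg)).
  have -> : ip (fun t => Rn t *m g t) (fun t => Ri t *m u t) = r * N.
    rewrite -(ipZl r hu hRu); apply: ip_eq => t tD.
    by rewrite /g -scalemxAr mulKVmx// (posdef_unitmx (Rn_pd tD)).
  have [->|N1] := eqVneq N 0; first by rewrite !mulr0 ler01.
  rewrite mulrA -expr2 /r exprVn sqr_sqrtr// mulVf//.
rewrite expectation_coin; congr (_%:E).
have obsE w : obs_functional a b u (fun t => y0 t + sgnb w *: g t) = ip u y0 + sgnb w * Num.sqrt N.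
  rewrite -[LHS]/(ip u (fun t => y0 t + sgnb w *: g t)).
  by rewrite (ipDr hy (L2Z _ hg) hu) (ipZr _ hg hu) (ipZr _ hRu hu) r_N.
rewrite !obsE /sgnb -/N -{3}(sqr_sqrtr N0).
by field.
Qed.

End Noise.

Section NoiseUpper.
Context (R : realType) (q : nat) (a b : R).
Local Notation mu := (@lebesgue_measure R).
Local Notation D := (`[a, b]%classic : set (measurableTypeR R)).
Local Notation ip := (ip a b).
Local Notation L2 := (L2 a b).
Context (Rn : R -> 'M[R]_q).
Hypothesis (Rn_pd : forall t, t \in `[a, b] -> sym_posdef (Rn t)).
Hypothesis (Rn_b : bmx a b Rn) (Ri_b : bmx a b (fun t => invmx (Rn t))).
Hint Resolve mD : core.
Context (dsp : measure_display) (Om : measurableType dsp) (P : probability Om R).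
Context (eta : R -> Om -> 'cV[R]_q).
Hypothesis eta_cp : centered_process a b P eta.

Let Ri t := invmx (Rn t).

Lemma fine_integrable (f : Om -> \bar R) : P.-integrable setT f ->
  [/\ P.-integrable setT (EFin \o (fine \o f)),
    (\int[P]_w (fine (f w))%:E = \int[P]_w f w)%E &
    {ae P, forall w, f w = (fine (f w))%:E}].
Proof.
move=> fi; have mf := measurable_int _ fi.
have mg : measurable_fun setT (EFin \o (fine \o f)).
  by apply/measurable_EFinP; apply: measurableT_comp.
have fg : {ae P, forall w, f w = (fine (f w))%:E}.
  by apply: filterS (integrable_ae measurableT fi) => w /(_ Logic.I) fw; rewrite fineK.
have e : ae_eq P setT f (EFin \o (fine \o f)) by apply: filterS fg => w.
split=> //; last by symmetry; apply: ae_eq_integral.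
apply: (le_integrable measurableT mg _ fi) => w _.
by rewrite /=; case: (f w) => [r||] //=; rewrite normr0 leey.
Qed.

Let strip := D `*` [set: Om].
Let mstrip : measurable strip. Proof. exact: measurableX. Qed.

Let measurable_time (g : R -> R) : measurable_fun D g ->
  measurable_fun strip (fun tw : measurableTypeR R * Om => g tw.1).
Proof.
move=> mg; apply: (@measurable_comp _ _ _ _ _ _ D g) => //.
  by move=> _ [[t w] [/= tD _] <-].
exact: measurable_funTS.
Qed.

Let measurable_eta i : measurable_fun strip
  (fun tw : measurableTypeR R * Om => eta tw.1 tw.2 i 0).
Proof. by have [+ _ _] := eta_cp; apply. Qed.

Let q_ (tw : measurableTypeR R * Om) := dotv (Rn tw.1 *m eta tw.1 tw.2) (eta tw.1 tw.2).
Let v_ (u y : R -> 'cV[R]_q) (tw : measurableTypeR R * Om) :=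
  dotv (u tw.1) (y tw.1 + eta tw.1 tw.2).

Let measurable_q : measurable_fun strip q_.
Proof.
apply: measurable_sum => i; apply: measurable_funM => //.
rewrite (_ : (fun _ => _) = fun tw => \sum_j Rn tw.1 i j * eta tw.1 tw.2 j 0); last first.
  by apply/funext => tw; rewrite mxE.
apply: measurable_sum => j; apply: measurable_funM => //.
by apply: (measurable_time (g := fun t => Rn t i j)); exact: (Rn_b i j).1.
Qed.

Let measurable_v u y : L2 u -> L2 y -> measurable_fun strip (v_ u y).
Proof.
move=> hu hy; apply: measurable_sum => i; apply: measurable_funM.
  by apply: (measurable_time (g := fun t => u t i 0)); exact: hu.1.
rewrite (_ : (fun _ => _) = fun tw => y tw.1 i 0 + eta tw.1 tw.2 i 0); last first.
  by apply/funext => tw; rewrite mxE.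
apply: measurable_funD => //.
by apply: (measurable_time (g := fun t => y t i 0)); exact: hy.1.
Qed.

Let q_ge0 t w : D t -> 0 <= q_ (t, w).
Proof. by move=> tD; exact: (posdef_possemidef (Rn_pd tD)).2. Qed.

Let eta_slice t i : D t -> measurable_fun [set: Om] (fun w => eta t w i 0).
Proof. by move=> tD; exact: (measurable_slice_w (measurable_eta i) tD). Qed.

Let eta_prod_integrable t i j : D t ->
  P.-integrable [set: Om] (EFin \o (fun w => eta t w i 0 * eta t w j 0)).
Proof.
move=> tD.
have msq : measurable_fun [set: Om] (fun w => enorm (eta t w) ^+ 2).
  rewrite (funext (fun w => enorm_sqr (eta t w))).
  by apply: measurable_sum => k; apply: measurable_funM; apply: eta_slice.
have isq : P.-integrable [set: Om] (EFin \o (fun w => enorm (eta t w) ^+ 2)).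
  apply/integrableP; split; first exact/measurable_EFinP.
  have [_ + _] := eta_cp; move=> /(_ t tD); rewrite unlock.
  by under eq_integral do rewrite /= -[X in X%:E]ger0_norm ?sqr_ge0//.
apply: le_integrable isq => //.
  by apply/measurable_EFinP; apply: measurable_funM; apply: eta_slice.
move=> w _; rewrite /= lee_fin [leRHS]ger0_norm ?sqr_ge0// enorm_sqr normrM.
have := le_sqr_dotv (eta t w) i; have := le_sqr_dotv (eta t w) j.
rewrite -(real_normK (num_real (eta t w i 0))) -(real_normK (num_real (eta t w j 0))).
have := sqr_ge0 (`|eta t w i 0| - `|eta t w j 0|); rewrite !expr2; nra.
Qed.

Let expectation_q t : D t ->
  (\int[P]_w (q_ (t, w))%:E = (\tr (Rn t *m correlation P eta t t))%:E)%E.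
Proof.
move=> tD.
have E w : (q_ (t, w))%:E = (\sum_i \sum_j (Rn t i j)%:E * (eta t w j 0 * eta t w i 0)%:E)%E.
  rewrite /q_ /= /dotv -sumEFin; apply: eq_bigr => i _; rewrite mxE mulr_suml -sumEFin.
  by apply: eq_bigr => j _; rewrite -mulrA EFinM.
under eq_integral do rewrite E.
rewrite integral_sum//; last first.
  move=> i; apply: integrable_sum => // j _; apply: integrableZl => //.
  exact: eta_prod_integrable.
rewrite /mxtrace -sumEFin; apply: eq_bigr => i _.
rewrite integral_sum//; last first.
  by move=> j; apply: integrableZl => //; exact: eta_prod_integrable.
rewrite mxE -sumEFin; apply: eq_bigr => j _.
rewrite integralZl//; last exact: eta_prod_integrable.
rewrite mxE EFinM; congr (_ * _)%E.
rewrite unlock; under [in RHS]eq_integral do rewrite mxE big_ord1 mxE.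
by rewrite fineK//; apply: (integrable_fin_num _ (eta_prod_integrable _ _ tD)).
Qed.

Let K w := (\int[mu]_(t in D) (q_ (t, w))%:E)%E.

Let K_ge0 w : (0 <= K w)%E.
Proof. by apply: integral_ge0 => t tD; rewrite lee_fin q_ge0. Qed.

Hypothesis etaW : calW a b Rn (correlation P eta).

Let K_le1 : (\int[P]_w K w <= 1)%E.
Proof.
rewrite (tonelli_itv P measurable_q (@q_ge0)).2.
by under eq_integral => t /[!inE] tD do rewrite expectation_q//.
Qed.

Let K_integrable : P.-integrable setT K.
Proof.
apply/integrableP; split; first exact: (tonelli_itv P measurable_q (@q_ge0)).1.
under eq_integral do rewrite gee0_abs//.
exact: le_lt_trans K_le1 (ltry _).
Qed.

Let coercive : exists2 c, 0 <= c &
  forall t w, D t -> dotv (eta t w) (eta t w) <= c * q_ (t, w).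
Proof.
have [c c0 hc] := bmx_form_le Ri_b; exists c => // t w tD.
have := posdef_inv_coercive (posdef_inv (Rn_pd tD)) (hc t (eta t w) tD).
by rewrite invmxK.
Qed.

(** Only almost every path is square-integrable; the others are not excluded, so
    the weighted Cauchy-Schwarz inequality is available on paths of finite [K]. *)
Let path_L2 w : (K w < +oo)%E -> L2 (eta ^~ w) /\
  (forall u, L2 u -> ip u (eta ^~ w) ^+ 2 <= ip u (fun t => Ri t *m u t) * fine (K w)).
Proof.
move=> Kw.
have [c c0 coer] := coercive.
have me i : measurable_fun D (fun t => eta t w i 0).
  exact: (measurable_slice_t (measurable_eta i) w).
have iq : integrable_itv a b (fun t => q_ (t, w)).
  apply/integrableP; split; first by apply/measurable_EFinP; exact: measurable_slice_t.
  by under eq_integral => t /[!inE] tD do rewrite /= ger0_norm ?q_ge0//.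
have he : L2 (eta ^~ w).
  split=> //.
  have : integrable_itv a b (fun t => c * q_ (t, w)) by exact: integrable_itv_scale.
  have msq : measurable_fun D (fun t => enorm (eta t w) ^+ 2).
    rewrite (funext (fun t => enorm_sqr (eta t w))).
    by apply: measurable_sum => k; apply: measurable_funM.
  have le t : D t -> `|enorm (eta t w) ^+ 2| <= c * q_ (t, w).
    by move=> tD; rewrite ger0_norm ?sqr_ge0// enorm_sqr; exact: coer.
  by move/(integrable_itv_le msq le)/(integrable_lty (mD a b)).
split=> // u hu.
have -> : fine (K w) = ip (fun t => Rn t *m eta t w) (eta ^~ w) by [].
exact: weighted_cauchy_schwarz.
Qed.

Let v_dominated u y : L2 u -> L2 y ->
  (\int[P]_w \int[mu]_(t in D) `|v_ u y (t, w)|%:E < +oo)%E.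
Proof.
move=> hu hy; have [c c0 coer] := coercive.
have m1 : measurable_fun strip (fun tw => `|v_ u y tw|).
  by apply: measurableT_comp => //; exact: measurable_v.
have [mI _] := tonelli_itv P m1 (fun _ _ _ => normr_ge0 _).
pose s t := dotv (u t) (u t) + 2 * dotv (y t) (y t).
have iS : integrable_itv a b s.
  apply: integrable_itv_add; first exact: dotv_integrable.
  by apply: integrable_itv_scale; exact: dotv_integrable.
have s0 t : 0 <= s t by rewrite addr_ge0 ?mulr_ge0 ?dotv_ge0.
pose J := (\int[mu]_(t in D) (s t)%:E)%E.
have J0 : (0 <= J)%E by apply: integral_ge0 => t _; rewrite lee_fin.
have Jfin : J \is a fin_num by exact: integrable_fin_num.
have dom w : (\int[mu]_(t in D) `|v_ u y (t, w)|%:E <= J + (2 * c)%:E * K w)%E.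
  have mq : measurable_fun D (EFin \o (fun t => q_ (t, w))).
    by apply/measurable_EFinP; exact: measurable_slice_t.
  have c2 : 0 <= 2 * c by rewrite mulr_ge0.
  rewrite -ge0_integralZl_EFin//; last by move=> t tD; rewrite lee_fin q_ge0.
  rewrite -ge0_integralD//; first last.
  - by apply: measurable_funeM.
  - by move=> t tD; rewrite -EFinM lee_fin mulr_ge0// q_ge0.
  - exact: (measurable_int _ iS).
  - by move=> t _; rewrite lee_fin.
  apply: ge0_le_integral => //.
  - by apply/measurable_EFinP; exact: (measurable_slice_t m1 w).
  - by apply: emeasurable_funD; [exact: (measurable_int _ iS)|apply: measurable_funeM].
  move=> t tD; rewrite -EFinM -EFinD lee_fin /v_ /=.
  have h1 := dotv_am (u t) (y t + eta t w).
  have h2 := dotv_am (- u t) (y t + eta t w).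
  have h3 := dotv_add_le (y t) (eta t w).
  have h4 := coer t w tD.
  rewrite dotvNl dotvNl dotvNr opprK in h2.
  by rewrite ler_norml /s; apply/andP; split; lra.
apply: (integrable_lty measurableT).
have iJ : P.-integrable setT (fun w => J + (2 * c)%:E * K w)%E.
  apply: integrableD => //; last exact: integrableZl.
  by rewrite -(fineK Jfin); exact: finite_measure_integrable_cst.
apply: (le_integrable measurableT mI _ iJ) => w _.
rewrite gee0_abs; last by apply: integral_ge0 => t _; rewrite lee_fin.
by rewrite gee0_abs// adde_ge0// mule_ge0// lee_fin mulr_ge0.
Qed.

Let eta_integrable t i : D t -> P.-integrable [set: Om] (EFin \o (fun w => eta t w i 0)).
Proof.
move=> tD; have h1 : P.-integrable [set: Om] (EFin \o cst (1 : R)).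
  exact: finite_measure_integrable_cst.
apply: le_integrable (integrableD measurableT h1 (eta_prod_integrable i i tD)) => //.
  by apply/measurable_EFinP; exact: eta_slice.
move=> w _; rewrite /= lee_fin -expr2 [leRHS]ger0_norm ?addr_ge0 ?sqr_ge0//.
rewrite -(real_normK (num_real (eta t w i 0))).
by have := sqr_ge0 (`|eta t w i 0| - 1); have := normr_ge0 (eta t w i 0); nra.
Qed.

Let expectation_v u y t : D t ->
  (\int[P]_w (v_ u y (t, w))%:E = (dotv (u t) (y t))%:E)%E.
Proof.
move=> tD.
have iye i : P.-integrable [set: Om] (EFin \o (fun w => y t i 0 + eta t w i 0)).
  have ic : P.-integrable [set: Om] (EFin \o cst (y t i 0)).
    exact: finite_measure_integrable_cst.
  exact: (integrableD measurableT ic (eta_integrable i tD)).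
have E w : (v_ u y (t, w))%:E = (\sum_i (u t i 0)%:E * (y t i 0 + eta t w i 0)%:E)%E.
  by rewrite /v_ /= /dotv -sumEFin; apply: eq_bigr => i _; rewrite mxE EFinM.
under eq_integral do rewrite E.
rewrite integral_sum//; last by move=> i; exact: (integrableZl measurableT _ (iye i)).
rewrite /dotv -sumEFin; apply: eq_bigr => i _.
rewrite (integralZl measurableT (iye i)) EFinM; congr (_ * _)%E.
under eq_integral do rewrite /= EFinD.
have ic : P.-integrable [set: Om] (EFin \o cst (y t i 0)).
  exact: finite_measure_integrable_cst.
rewrite (integralD measurableT ic (eta_integrable i tD)).
have [_ _ /(_ t tD i)] := eta_cp; rewrite unlock => ->.
rewrite adde0 -[LHS]/(\int[P]_w cst (y t i 0)%:E w)%E.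
by rewrite integral_cst// [X in (_ * X)%E]probability_setT mule1.
Qed.

(** The observed functional [fine (Z w)] has mean [ip u y] by Fubini, because the
    noise is centred, and its deviation is almost surely at most
    [ip u (R^-1 u) * K w] in square, whose mean is bounded since [K] has mean at
    most 1. Integrability of the squared error is not known beforehand, so it is
    dominated by the integrable [g]. *)
Theorem noise_upper u y c : L2 u -> L2 y ->
  ('E_P[(fun w => (c - obs_functional a b u (fun t => y t + eta t w)) ^+ 2)%R] <=
   ((c - ip u y) ^+ 2 + ip u (fun t => Ri t *m u t))%:E)%E.
Proof.
move=> hu hy.
pose Z w := (\int[mu]_(t in D) (v_ u y (t, w))%:E)%E.
have [iZ EZ] := fubini_itv (measurable_v hu hy) (v_dominated hu hy).
have {}iZ : P.-integrable setT Z := iZ.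
have {}EZ : (\int[P]_w Z w = (ip u y)%:E)%E.
  rewrite EZ -(integral_dotv hu hy).
  by apply: eq_integral => t /[!inE] tD; exact: expectation_v.
have [iZ' EZ' _] := fine_integrable iZ.
have [iK' EK' aeK] := fine_integrable K_integrable.
pose N := ip u (fun t => Ri t *m u t); pose i0 := ip u y.
have N0 : 0 <= N.
  apply: Rintegral_ge0 => t tD; rewrite dotvC.
  exact: (posdef_possemidef (posdef_inv (Rn_pd tD))).2.
pose g w := ((c - i0) ^+ 2 + 2 * (c - i0) * i0) + (- (2 * (c - i0))) * fine (Z w) + N * fine (K w).
have ig1 : P.-integrable setT (EFin \o cst ((c - i0) ^+ 2 + 2 * (c - i0) * i0)).
  exact: finite_measure_integrable_cst.
have ig2 : P.-integrable setT (EFin \o (fun w => (- (2 * (c - i0))) * fine (Z w))).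
  exact: (integrableZl measurableT _ iZ').
have ig3 : P.-integrable setT (EFin \o (fun w => N * fine (K w))).
  exact: (integrableZl measurableT _ iK').
have ig12 := integrableD measurableT ig1 ig2.
have ig : P.-integrable setT (EFin \o g) := integrableD measurableT ig12 ig3.
have Eg : (\int[P]_w (g w)%:E <= ((c - i0) ^+ 2 + N)%:E)%E.
  rewrite [leLHS](integralD measurableT ig12 ig3) (integralD measurableT ig1 ig2).
  have -> : (\int[P]_w (EFin \o (fun w => - (2 * (c - i0)) * fine (Z w))%R) w =
      (- (2 * (c - i0)) * i0)%:E)%E.
    transitivity ((- (2 * (c - i0)))%:E * \int[P]_w (fine (Z w))%:E)%E.
      exact: (integralZl measurableT iZ' _).
    by rewrite EZ' EZ.
  have -> : (\int[P]_w (EFin \o (fun w => N * fine (K w))%R) w = N%:E * \int[P]_w K w)%E.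
    transitivity (N%:E * \int[P]_w (fine (K w))%:E)%E; last by rewrite EK'.
    exact: (integralZl measurableT iK' _).
  rewrite -[X in (X + _ + _)%E]/(\int[P]_w cst ((c - i0) ^+ 2 + 2 * (c - i0) * i0)%R%:E w)%E.
  rewrite integral_cst// [X in (_ * X)%E]probability_setT mule1.
  apply: (@le_trans _ _ (((c - i0) ^+ 2 + 2 * (c - i0) * i0)%:E +
     (- (2 * (c - i0)) * i0)%:E + N%:E * 1)%E).
    by rewrite leeD2l// lee_wpmul2l// lee_fin.
  by rewrite mule1 -!EFinD lee_fin; lra.
rewrite unlock; apply: le_trans Eg.
pose f w := (c - fine (Z w)) ^+ 2.
have fg : {ae P, forall w, f w <= g w}.
  apply: filterS aeK => w hK.
  have Kfin : (K w < +oo)%E by rewrite hK ltry.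
  have [he hcs] := path_L2 Kfin.
  have ZE : fine (Z w) = i0 + ip u (eta ^~ w) by exact: (ipDr hy he hu).
  have := hcs u hu; rewrite /f /g ZE -/N; lra.
have mf : measurable_fun setT f.
  apply: measurable_funX; apply: measurable_funB => //.
  by apply/measurable_EFinP; exact: (measurable_int _ iZ').
have gabs : ae_eq P setT (fun w => `|g w|%:E) (EFin \o g).
  apply: filterS fg => w fgw _; rewrite /= ger0_norm//.
  by apply: le_trans fgw; exact: sqr_ge0.
have mg : measurable_fun setT g by apply/measurable_EFinP; exact: (measurable_int _ ig).
have mga : measurable_fun setT (fun w => `|g w|) by exact: measurableT_comp.
rewrite -(ae_eq_integral _ _ _ _ _ gabs)//; try exact/measurable_EFinP.
apply: ae_ge0_le_integral => //; try exact/measurable_EFinP.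
- by move=> w _; rewrite lee_fin sqr_ge0.
- apply: filterS fg => w fgw _; rewrite lee_fin.
  by apply: le_trans (ler_norm _).
Qed.

End NoiseUpper.

(** * Green's formula and the energy form *)

Section Core.
Context (R : realType) (m n q : nat) (a b : R) (ab : a < b).
Context (F : 'M[R]_(m, n)) (C : R -> 'M[R]_(m, n)) (H : R -> 'M[R]_(q, n)).
Context (Q0 : 'M[R]_m) (Q : R -> 'M[R]_m) (Rn : R -> 'M[R]_q).
Local Notation mu := (@lebesgue_measure R).
Local Notation D := (`[a, b]%classic : set (measurableTypeR R)).
Local Notation ip := (ip a b).
Local Notation L2 := (L2 a b).
Local Notation rep := (rep a b).
Hypothesis (C_b : bmx a b C) (H_b : bmx a b H).
Hypothesis (Q0_pd : sym_posdef Q0).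
Hypothesis (Q_pd : forall t, t \in `[a, b] -> sym_posdef (Q t)).
Hypothesis (Rn_pd : forall t, t \in `[a, b] -> sym_posdef (Rn t)).
Hypothesis (Q_b : bmx a b Q) (Rn_b : bmx a b Rn).
Hypothesis (Qi_b : bmx a b (fun t => invmx (Q t))).
Hypothesis (Ri_b : bmx a b (fun t => invmx (Rn t))).
Hint Resolve mD : core.

Let Qi t := invmx (Q t).
Let Ri t := invmx (Rn t).
Let Q0i := invmx Q0.
Local Notation G := (Defs.pinv F^T).

Lemma pinv_GT : Defs.pinv F = G^T. Proof. by rewrite pinv_tr trmxK. Qed.

(** [G F'] and [F' G] are the orthogonal projectors onto the ranges of [F] and
    [F']. *)
Lemma projF : G *m F^T *m F = F.
Proof.
have [x1 x2 x3 x4] := pinvP F^T.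
by rewrite -[LHS]trmxK trmx_mul x4 mulmxA x1 trmxK.
Qed.

Lemma projFT : F^T *m G *m F^T = F^T. Proof. by have [] := pinvP F^T. Qed.
Lemma projFT_tr : (F^T *m G)^T = F^T *m G. Proof. by have [] := pinvP F^T. Qed.
Lemma projF_tr : (G *m F^T)^T = G *m F^T. Proof. by have [] := pinvP F^T. Qed.

Lemma FGT : F *m G^T = G *m F^T.
Proof. by rewrite -{1}(trmxK F) -trmx_mul projF_tr. Qed.

(** The equation is carried by the representative [g], so that boundary values
    are plain values of [g]. *)
Definition adj (u : R -> 'cV[R]_q) (z : R -> 'cV[R]_m) (p g : R -> 'cV[R]_n) :=
  [/\ L2 u, L2 z, L2 p &
    rep (fun t => F^T *m z t)
        (fun t => - ((C t)^T *m z t) + (H t)^T *m u t + p t) g].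

Definition state (x : R -> 'cV[R]_n) (f h : R -> 'cV[R]_m) :=
  [/\ L2 x, L2 f & rep (fun t => F *m x t) (fun t => C t *m x t + f t) h].

Lemma L2_C x : L2 x -> L2 (fun t => C t *m x t).
Proof. exact: L2_mulmx. Qed.
Lemma L2_H x : L2 x -> L2 (fun t => H t *m x t).
Proof. exact: L2_mulmx. Qed.
Lemma L2_CT z : L2 z -> L2 (fun t => (C t)^T *m z t).
Proof. by apply: L2_mulmx; apply: bmx_tr. Qed.
Lemma L2_HT u : L2 u -> L2 (fun t => (H t)^T *m u t).
Proof. by apply: L2_mulmx; apply: bmx_tr. Qed.
Lemma L2_Qi z : L2 z -> L2 (fun t => Qi t *m z t).
Proof. exact: L2_mulmx. Qed.
Lemma L2_Ri u : L2 u -> L2 (fun t => Ri t *m u t).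
Proof. exact: L2_mulmx. Qed.
Lemma L2_mx k l (M : 'M[R]_(k, l)) f : L2 f -> L2 (fun t => M *m f t).
Proof. by apply: L2_mulmx; apply: bmx_cst. Qed.

Lemma state_range x f h : state x f h ->
  forall t, t \in `[a, b] -> G *m F^T *m h t = h t.
Proof.
by move=> [_ _ rh]; apply: (rep_fix ab rh _).2 => t; rewrite mulmxA projF.
Qed.

Lemma adj_range u z p g : adj u z p g ->
  forall t, t \in `[a, b] -> F^T *m G *m g t = g t.
Proof.
by move=> [_ _ _ rg]; apply: (rep_fix ab rg _).2 => t; rewrite mulmxA projFT.
Qed.

(** The Green formula. The derivatives stay in the ranges of [F] and [F^T], so
    that the projectors introduced by the pseudoinverse can be dropped. *)
Theorem green u z p g x f h : adj u z p g -> state x f h ->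
  dotv (G *m g b) (h b) - dotv (G *m g a) (h a) =
  ip z f + ip u (fun t => H t *m x t) + ip p x.
Proof.
move=> [hu hz hp rg] [hx hf rh].
have hCx := L2_C hx; have hHx := L2_H hx; have hCz := L2_CT hz; have hHu := L2_HT hu.
have hw : L2 (fun t => - ((C t)^T *m z t) + (H t)^T *m u t + p t).
  exact: (L2D (L2D (L2N hCz) hHu) hp).
have hCxf := L2D hCx hf.
have rGg := rep_mulmx G rg.
have LGg := rep_L2 ab rGg; have Lh := rep_L2 ab rh.
have [_ eGg _] := rGg; have [_ eh _] := rh.
rewrite -(rep_by_parts ab rGg rh).
have -> : ip (fun t => G *m g t) (fun t => C t *m x t + f t) =
    ip z (fun t => C t *m x t + f t).
  have [fixh _] := rep_fix ab rh (M := G *m F^T)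
    (fun t => etrans (mulmxA _ _ _) (congr1 (mulmx^~ (x t)) projF)).
  have hS : L2 (fun t => G *m (F^T *m z t)) by exact: (L2_mx G (L2_mx F^T hz)).
  have hS' := L2_mx (G *m F^T) hCxf.
  rewrite (ip_ae LGg hCxf hS hCxf eGg (ae_eq_refl _ _ _)).
  transitivity (ip z (fun t => G *m F^T *m (C t *m x t + f t))).
    by apply: ip_eq => t _; rewrite mulmxA dotv_mulmxl projF_tr.
  exact: (ip_ae hz hS' hz hCxf (ae_eq_refl _ _ _) fixh).
set w := (fun t => - _ + _ + _) in hw rg *.
have -> : ip (fun t => G *m w t) h = ip w x.
  have [fixg _] := rep_fix ab rg (M := F^T *m G)
    (fun t => etrans (mulmxA _ _ _) (congr1 (mulmx^~ (z t)) projFT)).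
  have hGw := L2_mx G hw; have hFx := L2_mx F hx.
  have hPw := L2_mx (F^T *m G) hw.
  rewrite (ip_ae hGw Lh hGw hFx (ae_eq_refl _ _ _) eh).
  transitivity (ip (fun t => F^T *m G *m w t) x).
    by apply: ip_eq => t _; rewrite dotv_mulmxr mulmxA.
  exact: (ip_ae hPw hx hw hx fixg (ae_eq_refl _ _ _)).
rewrite (ipDr hCx hf hz) (ipDl (L2D (L2N hCz) hHu) hp hx) (ipDl (L2N hCz) hHu hx).
rewrite (ipNl hCz hx).
have -> : ip z (fun t => C t *m x t) = ip (fun t => (C t)^T *m z t) x.
  by apply: ip_eq => t _; rewrite dotv_mulmxr.
have -> : ip (fun t => (H t)^T *m u t) x = ip u (fun t => H t *m x t).
  by apply: ip_eq => t _; rewrite dotv_mulmxr.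
by ring.
Qed.

Lemma adj_comb c u z p g u' z' p' g' : adj u z p g -> adj u' z' p' g' ->
  adj (fun t => u t + c *: u' t) (fun t => z t + c *: z' t)
    (fun t => p t + c *: p' t) (fun t => g t + c *: g' t).
Proof.
move=> [hu hz hp rg] [hu' hz' hp' rg']; split.
- exact: (L2D hu (L2Z c hu')).
- exact: (L2D hz (L2Z c hz')).
- exact: (L2D hp (L2Z c hp')).
apply: rep_ext (repD rg (repZ c rg')) => t.
  by rewrite mulmxDr -scalemxAr.
rewrite !mulmxDr -!scalemxAr !scalerDr scalerN opprD.
by rewrite (addrACA (_ + _)) (addrACA (- _)).
Qed.

Lemma state_comb c x f h x' f' h' : state x f h -> state x' f' h' ->
  state (fun t => x t + c *: x' t) (fun t => f t + c *: f' t) (fun t => h t + c *: h' t).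
Proof.
move=> [hx hf rh] [hx' hf' rh']; split.
- exact: (L2D hx (L2Z c hx')).
- exact: (L2D hf (L2Z c hf')).
apply: rep_ext (repD rh (repZ c rh')) => t.
  by rewrite mulmxDr -scalemxAr.
by rewrite mulmxDr -scalemxAr scalerDr addrACA.
Qed.

(** The relations between the components are left to [adm], so that tuples can be
    formed freely. *)
Record unknowns := Unknowns {
  vu : R -> 'cV[R]_q;
  vz : R -> 'cV[R]_m;
  vp : R -> 'cV[R]_n;
  vg : R -> 'cV[R]_n;
  vd : 'cV[R]_m }.

(** Tuples are combined by an explicit operation because [unknowns] carries no
    module structure. *)
Definition comb (v : unknowns) (c : R) (w : unknowns) := Unknowns
  (fun t => vu v t + c *: vu w t) (fun t => vz v t + c *: vz w t)
  (fun t => vp v t + c *: vp w t) (fun t => vg v t + c *: vg w t)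
  (vd v + c *: vd w).

Definition va (v : unknowns) : 'cV[R]_m := G *m vg v a - vd v.

Definition adm (v : unknowns) := adj (vu v) (vz v) (vp v) (vg v) /\ F^T *m vd v = 0.

Lemma adm_comb c v w : adm v -> adm w -> adm (comb v c w).
Proof.
move=> [hv dv] [hw dw]; split; first exact: (adj_comb c hv hw).
by rewrite /= mulmxDr -scalemxAr dv dw scaler0 addr0.
Qed.

Lemma va_comb c v w : va (comb v c w) = va v + c *: va w.
Proof. by rewrite /va /= mulmxDr -scalemxAr scalerBr opprD addrACA. Qed.

(** The energy form, whose value on the diagonal is [Omega]. *)
Definition energy (v w : unknowns) : R :=
  ip (vu v) (fun t => Ri t *m vu w t) + ip (vz v) (fun t => Qi t *m vz w t)
  + dotv (va v) (Q0i *m va w).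

Lemma Ri_pd t : t \in `[a, b] -> sym_posdef (Ri t).
Proof. by move=> tD; apply/posdef_inv/Rn_pd. Qed.
Lemma Qi_pd t : t \in `[a, b] -> sym_posdef (Qi t).
Proof. by move=> tD; apply/posdef_inv/Q_pd. Qed.
Lemma Q0i_pd : sym_posdef Q0i.
Proof. exact: posdef_inv. Qed.

Lemma energyC v w : energy v w = energy w v.
Proof.
rewrite /energy (ip_symm _ _ (fun t tD => (Ri_pd tD).1)).
rewrite (ip_symm _ _ (fun t tD => (Qi_pd tD).1)).
by rewrite (dotv_mulmxr Q0i) Q0i_pd.1 (dotvC (_ *m _)).
Qed.

Lemma energy_combl c v w x : adm v -> adm w -> adm x ->
  energy (comb v c w) x = energy v x + c * energy w x.
Proof.
move=> [[hu hz _ _] _] [[hu' hz' _ _] _] [[hu'' hz'' _ _] _].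
rewrite /energy va_comb.
have -> : ip (vu (comb v c w)) (fun t => Ri t *m vu x t) =
    ip (vu v) (fun t => Ri t *m vu x t) + c * ip (vu w) (fun t => Ri t *m vu x t).
  have hR := L2_Ri hu''.
  by rewrite -(ipZl c hu' hR) -(ipDl hu (L2Z c hu') hR).
have -> : ip (vz (comb v c w)) (fun t => Qi t *m vz x t) =
    ip (vz v) (fun t => Qi t *m vz x t) + c * ip (vz w) (fun t => Qi t *m vz x t).
  have hR := L2_Qi hz''.
  by rewrite -(ipZl c hz' hR) -(ipDl hz (L2Z c hz') hR).
by rewrite dotvDl dotvZl; ring.
Qed.

Lemma energy_combr c v w x : adm v -> adm w -> adm x ->
  energy x (comb v c w) = energy x v + c * energy x w.
Proof. by move=> hv hw hx; rewrite energyC energy_combl// !(energyC _ x). Qed.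

Lemma energy_ge0 v : 0 <= energy v v.
Proof.
apply: addr_ge0; first apply: addr_ge0.
- by apply: ip_possemidef => t tD; apply/posdef_possemidef/Ri_pd.
- by apply: ip_possemidef => t tD; apply/posdef_possemidef/Qi_pd.
- by rewrite dotvC; apply: (posdef_possemidef Q0i_pd).2.
Qed.

(** The weights [R], [Q] and [Q0] being bounded, the energy controls [u], [z] and
    the initial value. *)
Lemma energy_coercive : exists2 K, 0 <= K & forall v, adm v ->
  [/\ ip (vu v) (vu v) <= K * energy v v, ip (vz v) (vz v) <= K * energy v v
    & dotv (va v) (va v) <= K * energy v v].
Proof.
have [K1 K10 h1] := ip_coercive Rn_b Ri_b Rn_pd.
have [K2 K20 h2] := ip_coercive Q_b Qi_b Q_pd.
have [K3 K30 h3] := bmx_form_le (bmx_cst a b Q0).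
exists (K1 + K2 + K3) => [|v [[hu hz hp _] _]]; first by rewrite !addr_ge0.
have := h1 _ hu; have := h2 _ hz.
have := posdef_inv_coercive Q0_pd (h3 a (va v) (aD ab)).
rewrite (dotvC (_ *m _)) /energy.
have p1 : 0 <= ip (vu v) (fun t => Ri t *m vu v t).
  by apply: ip_possemidef => t tD; apply/posdef_possemidef/Ri_pd.
have p2 : 0 <= ip (vz v) (fun t => Qi t *m vz v t).
  by apply: ip_possemidef => t tD; apply/posdef_possemidef/Qi_pd.
have p3 : 0 <= dotv (va v) (Q0i *m va v).
  by rewrite dotvC; apply: (posdef_possemidef Q0i_pd).2.
have le3 (K x y w s : R) : 0 <= x -> 0 <= y -> 0 <= w -> s <= K * x -> 0 <= K ->
    s <= K * (x + y + w).
  by move=> x0 y0 w0 sK K0; apply: le_trans sK _; rewrite ler_wpM2l// -addrA lerDl addr_ge0.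
have leK (K K' s e : R) : 0 <= e -> K <= K' -> s <= K * e -> s <= K' * e.
  by move=> e0 KK' sK; apply: le_trans sK _; rewrite ler_wpM2r.
have e0 := energy_ge0 v; rewrite /energy in e0.
move=> i3 i2 i1; split.
- by apply: (leK K1) => //; [lra|apply: le3].
- by apply: (leK K2) => //; [lra|rewrite (addrC (ip (vu v) _)); apply: le3].
- by apply: (leK K3) => //; [lra|rewrite addrC addrA; apply: le3].
Qed.

(** * The regularised boundary value problem *)

(** Stated through the representatives [vg v] of [F^T z] and [h] of [F p], in
    which every equation is linear. *)
Definition bvp (l : 'cV[R]_m) (eps : R) (v : unknowns) (h : R -> 'cV[R]_m) :=
  [/\ adm v,
      rep (fun t => F *m vp v t) (fun t => C t *m vp v t + eps *: (Qi t *m vz v t)) h,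
      ae_eq mu D (fun t => eps *: vu v t) (fun t => Rn t *m H t *m vp v t),
      vg v b + G^T *m h b = F^T *m l
    & eps^-1 *: h a = Q0i *m va v].

(** The residual of the adjoint equation and, through
    [F^T l - vg v b = F^+ h b], that of its final condition. *)
Definition pform (v : unknowns) (h : R -> 'cV[R]_m) (v' : unknowns) (h' : R -> 'cV[R]_m) :=
  ip (vp v) (vp v') + dotv (G^T *m h b) (G^T *m h' b).

(** Division by [eps] turns the term [eps Q^-1 z] of the equation for [p] into an
    input that no longer depends on the scale of the residual. *)
Lemma bvp_state l eps v h : 0 < eps -> bvp l eps v h ->
  state (fun t => eps^-1 *: vp v t) (fun t => Qi t *m vz v t) (fun t => eps^-1 *: h t).
Proof.
move=> e0 [[[hu hz hp _] _] rh _ _ _]; split; [exact: L2Z|exact: L2_Qi|].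
apply: rep_ext (repZ eps^-1 rh) => t; first by rewrite scalemxAr.
by rewrite scalerDr scalemxAr scalerA mulVf ?gt_eqF// scale1r.
Qed.

Lemma bvp_Ri l eps v h : 0 < eps -> bvp l eps v h ->
  ae_eq mu D (fun t => eps^-1 *: (H t *m vp v t)) (fun t => Ri t *m vu v t).
Proof.
move=> e0 [_ _ + _ _]; apply: filterS => t ht Dt.
have -> : vu v t = eps^-1 *: (eps *: vu v t) by rewrite scalerA mulVf ?gt_eqF// scale1r.
by rewrite (ht Dt) -scalemxAr -mulmxA mulKmx// (posdef_unitmx (Rn_pd Dt)).
Qed.

Lemma adm_d_ortho x f h v t : state x f h -> adm v -> t \in `[a, b] -> dotv (vd v) (h t) = 0.
Proof.
move=> sx [_ dv] tD.
by rewrite -(state_range sx tD) dotv_mulmxr projF_tr -mulmxA dv mulmx0 dotv0l.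
Qed.

Lemma bvp_range l eps v h : bvp l eps v h ->
  forall t, t \in `[a, b] -> G *m F^T *m h t = h t.
Proof.
by move=> [_ rh _ _ _]; apply: (rep_fix ab rh _).2 => t; rewrite mulmxA projF.
Qed.

(** Green's formula against the state of [bvp_state]: the equation for [u] turns
    its observation, and the initial condition its initial value, into the
    missing terms of the energy form. *)
Lemma bvp_green l eps v h v' : 0 < eps -> bvp l eps v h -> adm v' ->
  eps^-1 * dotv (vg v' b) (G^T *m h b) =
  energy v' v + eps^-1 * ip (vp v') (vp v).
Proof.
move=> e0 sv av'; have sx := bvp_state e0 sv.
have [[hu' hz' hp' _] _] := av'.
have [[[hu hz hp _] _] _ _ _ ha] := sv.
have := green av'.1 sx.
have -> : dotv (G *m vg v' a) (eps^-1 *: h a) = dotv (va v') (Q0i *m va v).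
  by rewrite -ha /va dotvBl (adm_d_ortho sx av' (aD ab)) subr0.
have -> : ip (vu v') (fun t => H t *m (eps^-1 *: vp v t)) = ip (vu v') (fun t => Ri t *m vu v t).
  have Hp_eq : ae_eq mu D (fun t => H t *m (eps^-1 *: vp v t)) (fun t => Ri t *m vu v t).
    apply: filterS (bvp_Ri e0 sv) => t ht Dt; rewrite -(ht Dt).
    by rewrite scalemxAr.
  exact: (ip_ae hu' (L2_H (L2Z _ hp)) hu' (L2_Ri hu) (ae_eq_refl _ _ _) Hp_eq).
rewrite dotvZr ipZr// dotv_mulmxl /energy.
by move=> /eqP; rewrite subr_eq => /eqP ->; ring.
Qed.

(** The final conditions of both solutions turn the left-hand side of
    [bvp_green] into a value of the state, minus the residual forms. *)
Lemma bvp_green2 l eps v h l' eps' v' h' : 0 < eps -> bvp l eps v h -> bvp l' eps' v' h' ->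
  eps^-1 * dotv l' (h b) = energy v' v + eps^-1 * pform v' h' v h.
Proof.
move=> e0 sv sv'; have [av' _ _ gb' _] := sv'.
have := bvp_green e0 sv av'.
have -> : vg v' b = F^T *m l' - G^T *m h' b by rewrite -gb' addrK.
rewrite dotvBl dotv_mulmxl trmxK mulmxA FGT.
rewrite (bvp_range sv (bD ab)).
rewrite /pform; lra.
Qed.

Lemma pform_ge0 v h : 0 <= pform v h v h.
Proof. by rewrite addr_ge0 ?ip_ge0 ?dotv_ge0. Qed.

Lemma bvp_comb c l eps v h l' v' h' : bvp l eps v h -> bvp l' eps v' h' ->
  bvp (l + c *: l') eps (comb v c v') (fun t => h t + c *: h' t).
Proof.
move=> [av rh eu eb ea] [av' rh' eu' eb' ea']; split.
- exact: adm_comb.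
- apply: rep_ext (repD rh (repZ c rh')) => t /=.
    by rewrite mulmxDr -scalemxAr.
  rewrite !mulmxDr -!scalemxAr !scalerDr !scalerA (mulrC c eps).
  by rewrite addrACA.
- apply: filterS2 eu eu' => t h1 h2 Dt /=.
  by rewrite scalerDr h1// scalerA (mulrC eps) -scalerA h2// mulmxDr -scalemxAr.
- by rewrite /= !mulmxDr -!scalemxAr -eb -eb' scalerDr addrACA.
- by rewrite va_comb mulmxDr -scalemxAr -ea -ea' scalerDr !scalerA (mulrC c).
Qed.

Lemma energy_eq0 v : adm v -> energy v v = 0 ->
  [/\ ae_eq mu D (vu v) (fun=> 0), ae_eq mu D (vz v) (fun=> 0) & va v = 0].
Proof.
move=> av e0; have [K _ hK] := energy_coercive.
have [] := hK v av; rewrite e0 mulr0.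
have [[hu hz _ _] _] := av.
move=> h1 h2 h3; split.
- by apply: ip_eq0 => //; apply/le_anti; rewrite h1 ip_ge0.
- by apply: ip_eq0 => //; apply/le_anti; rewrite h2 ip_ge0.
- by apply: dotv_eq0; apply/le_anti; rewrite h3 dotv_ge0.
Qed.

(** The difference of two solutions solves the problem for [l = 0], where
    [bvp_green2] says that energy plus weighted residual vanishes. *)
Lemma bvp_unique l eps v h v' h' : 0 < eps -> bvp l eps v h -> bvp l eps v' h' ->
  [/\ ae_eq mu D (vu v) (vu v'), ae_eq mu D (vp v) (vp v'),
      ae_eq mu D (vz v) (vz v') & vd v = vd v'].
Proof.
move=> e0 sv sv'; have := bvp_comb (-1) sv sv'.
set w := comb v (-1) v'; set hw := (fun t => _ + _ *: _) => sw.
have := bvp_green2 e0 sw sw; rewrite scaleN1r subrr dotv0l mulr0 => e_p.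
have aw : adm w by case: sw.
have w1 := energy_ge0 w; have w2 := pform_ge0 w hw.
have ie0 : 0 < eps^-1 by rewrite invr_gt0.
have w3 : 0 <= eps^-1 * pform w hw w hw by rewrite mulr_ge0// ltW.
have ew0 : energy w w = 0 by lra.
have pw0 : pform w hw w hw = 0.
  have /eqP : eps^-1 * pform w hw w hw = 0 by lra.
  by rewrite mulf_eq0 gt_eqF//= => /eqP.
have [u0 z0 a0] := energy_eq0 aw ew0.
have [[_ _ Lpw rg] _] := aw.
have pp0 : ip (vp w) (vp w) = 0.
  by move: pw0; rewrite /pform; have := ip_ge0 a b (vp w); have := dotv_ge0 (G^T *m hw b); lra.
have p0 := ip_eq0 Lpw pp0.
have ga : vg w a = 0.
  apply: (rep0_eq0 ab rg _ (aD ab)).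
  by apply: filterS z0 => t ht Dt; rewrite ht// mulmx0.
have eq_of k (f g : R -> 'cV[R]_k) :
    ae_eq mu D (fun t => f t + (-1) *: g t) (fun=> 0) -> ae_eq mu D f g.
  by apply: filterS => t ht Dt; have := ht Dt; rewrite scaleN1r => /subr0_eq.
split; [exact: eq_of u0|exact: eq_of p0|exact: eq_of z0|].
move: a0; rewrite /va ga mulmx0 sub0r => /eqP; rewrite oppr_eq0 => /eqP.
by rewrite /= scaleN1r => /subr0_eq.
Qed.

Lemma pform_cauchy_schwarz v h v' h' : L2 (vp v) -> L2 (vp v') ->
  pform v h v' h' ^+ 2 <= pform v h v h * pform v' h' v' h'.
Proof.
move=> hv hv'; apply: discriminant (pform_ge0 _ _) => s.
have -> : pform v h v h + 2 * s * pform v h v' h' + s ^+ 2 * pform v' h' v' h' =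
    ip (fun t => vp v t + s *: vp v' t) (fun t => vp v t + s *: vp v' t) +
    dotv (G^T *m h b + s *: (G^T *m h' b)) (G^T *m h b + s *: (G^T *m h' b)).
  rewrite ip_expand// /pform !(dotvDl, dotvDr, dotvZl, dotvZr).
  by rewrite (dotvC (G^T *m h' b) (G^T *m h b)); ring.
by rewrite addr_ge0 ?ip_ge0 ?dotv_ge0.
Qed.

Lemma energy_diff v w : adm v -> adm w ->
  energy (comb v (-1) w) (comb v (-1) w) = energy v v + energy w w - 2 * energy v w.
Proof.
move=> av aw; rewrite energy_combl ?energy_combr ?(energyC w v)//; first by ring.
exact: adm_comb.
Qed.

(** The energy decreases in [eps] at least by the squared distance. The identity
    [bvp_green2] for the four pairs of solutions reduces the claim to
    [discriminant_le]. *)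
Theorem bvp_cauchy l eps del v h v' h' : 0 < del -> del <= eps ->
  bvp l eps v h -> bvp l del v' h' ->
  energy (comb v' (-1) v) (comb v' (-1) v) <= energy v' v' - energy v v.
Proof.
move=> d0 de sv sv'; have e0 : 0 < eps by apply: lt_le_trans de.
have [av _ _ _ _] := sv; have [av' _ _ _ _] := sv'.
have [[_ _ hp _] _] := av; have [[_ _ hp' _] _] := av'.
rewrite energy_diff//.
suff : energy v v <= energy v' v by lra.
have h1 := bvp_green2 e0 sv sv; have h2 := bvp_green2 e0 sv sv'.
have h3 := bvp_green2 d0 sv' sv'; have h4 := bvp_green2 d0 sv' sv.
have pC : pform v h v' h' = pform v' h' v h.
  by rewrite /pform ipC (dotvC (G^T *m h b)).
rewrite pC (energyC v v') in h4.
apply: (@discriminant_le R (energy v v) (energy v' v') (energy v' v) (pform v h v h)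
  (pform v' h' v' h') (pform v' h' v h) eps^-1 del^-1).
- by rewrite invr_gt0.
- by rewrite lef_pV2.
- exact: pform_ge0.
- exact: pform_ge0.
- by rewrite mulrC; apply: pform_cauchy_schwarz.
- by rewrite (addrC (energy v v)) -energy_diff// energy_ge0.
- by rewrite -h1 -h2.
- by rewrite -h3 -h4.
Qed.

Definition adj_rhs u z p t := - ((C t)^T *m z t) + (H t)^T *m u t + p t : 'cV[R]_n.

Lemma L2_adj_rhs u z p : L2 u -> L2 z -> L2 p -> L2 (adj_rhs u z p).
Proof. by move=> hu hz hp; exact: (L2D (L2D (L2N (L2_CT hz)) (L2_HT hu)) hp). Qed.

Lemma adj_rhs_le : exists2 K, 0 <= K & forall u z p, L2 u -> L2 z -> L2 p ->
  ip (adj_rhs u z p) (adj_rhs u z p) <= K * (ip u u + ip z z + ip p p).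
Proof.
have [K1 K10 h1] := ip_mulmx_le (bmx_tr C_b).
have [K2 K20 h2] := ip_mulmx_le (bmx_tr H_b).
exists (4 * K1 + 4 * K2 + 2) => [|u z p hu hz hp]; first by lra.
have hCz := L2_CT hz; have hHu := L2_HT hu.
have le1 := ip_add_le (L2D (L2N hCz) hHu) hp.
have le2 := ip_add_le (L2N hCz) hHu.
have le3 := h1 _ hz; have le4 := h2 _ hu.
have eN : ip (fun t => - ((C t)^T *m z t)) (fun t => - ((C t)^T *m z t)) =
    ip (fun t => (C t)^T *m z t) (fun t => (C t)^T *m z t).
  by apply: ip_eq => s _; rewrite dotvNl dotvNr opprK.
rewrite eN in le2; rewrite /adj_rhs.
have p1 := ip_ge0 a b u; have p2 := ip_ge0 a b z; have p3 := ip_ge0 a b p.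
have := mulr_ge0 K10 p1; have := mulr_ge0 K10 p3.
have := mulr_ge0 K20 p2; have := mulr_ge0 K20 p3.
by rewrite !mulrDl !mulrDr; lra.
Qed.

Lemma adj_rhs_comb c u z p u' z' p' t : adj_rhs u z p t + c *: adj_rhs u' z' p' t =
  adj_rhs (fun t => u t + c *: u' t) (fun t => z t + c *: z' t) (fun t => p t + c *: p' t) t.
Proof.
rewrite /adj_rhs !mulmxDr -!scalemxAr !scalerDr scalerN opprD.
by rewrite (addrACA (_ + _)) (addrACA (- _)).
Qed.

(** [rep_bound], with the derivative estimated by the right-hand side of the
    adjoint equation. *)
Lemma adj_bound : exists2 K, 0 <= K & forall u z p g, adj u z p g ->
  forall t, t \in `[a, b] ->
  dotv (g t) (g t) <= K * (dotv (g b) (g b) + ip u u + ip z z + ip p p).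
Proof.
have [K K0 hK] := adj_rhs_le.
have ba : 0 <= b - a by rewrite subr_ge0 ltW.
exists (2 + 2 * (b - a) * K).
  by apply: addr_ge0 => //; apply: mulr_ge0; [exact: mulr_ge0|].
move=> u z p g [hu hz hp rg] t tD.
apply: le_trans (rep_bound ab rg tD) _.
have le1 := ler_wpM2l ba (hK _ _ _ hu hz hp).
have p1 := ip_ge0 a b u; have p2 := ip_ge0 a b z; have p3 := ip_ge0 a b p.
have le2 := mulr_ge0 ba (mulr_ge0 K0 (dotv_ge0 (g b))).
have -> : (2 + 2 * (b - a) * K) * (dotv (g b) (g b) + ip u u + ip z z + ip p p) =
  2 * dotv (g b) (g b) + 2 * (ip u u + ip z z + ip p p)
  + 2 * ((b - a) * (K * dotv (g b) (g b)))
  + 2 * ((b - a) * (K * (ip u u + ip z z + ip p p))) by ring.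
move: le1 le2; rewrite -mulrA.
move: (_ * ip (adj_rhs _ _ _) _) (_ * (_ * dotv _ _)) (_ * (_ * (_ + _))) => x y y'.
by lra.
Qed.

(** The squared graph norm of the adjoint operator. The values of [g]
    before the final time and [d] are controlled by it through [adj_bound]. *)
Definition gnorm (v : unknowns) : R :=
  ip (vu v) (vu v) + ip (vz v) (vz v) + ip (vp v) (vp v)
  + dotv (va v) (va v) + dotv (vg v b) (vg v b).

Lemma gnorm_ge v : [/\ ip (vu v) (vu v) <= gnorm v, ip (vz v) (vz v) <= gnorm v,
  ip (vp v) (vp v) <= gnorm v, dotv (va v) (va v) <= gnorm v
  & dotv (vg v b) (vg v b) <= gnorm v].
Proof.
rewrite /gnorm; have := ip_ge0 a b (vu v); have := ip_ge0 a b (vz v).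
have := ip_ge0 a b (vp v); have := dotv_ge0 (va v); have := dotv_ge0 (vg v b).
by move=> *; split; lra.
Qed.

(** The adjoint operator is closed: the components converge by completeness of
    [L_2], the representatives converge uniformly by [rep_bound], so the limit
    representative is the primitive of the limit of the right-hand sides. *)
Theorem adm_complete (v : nat -> unknowns) : (forall i, adm (v i)) ->
  (forall e, 0 < e -> exists N, forall i j, (N <= i)%N -> (N <= j)%N ->
     gnorm (comb (v i) (-1) (v j)) <= e) ->
  exists2 w, adm w & gnorm (comb (v i) (-1) w) @[i --> \oo] --> (0 : R).
Proof.
move=> av cau.
have ipN k (f g : R -> 'cV[R]_k) : ip (fun t => f t - g t) (fun t => f t - g t) =
    ip (fun t => f t + (-1) *: g t) (fun t => f t + (-1) *: g t).
  by apply: ip_eq => t _; rewrite scaleN1r.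
have [u hu cu] : exists2 u, L2 u & ip (fun t => vu (v i) t - u t) (fun t => vu (v i) t - u t)
    @[i --> \oo] --> (0 : R).
  apply: L2_complete => [i|e /cau[N hN]]; first by have [[]] := av i.
  exists N => i j Ni Nj; rewrite ipN; apply: le_trans (hN i j Ni Nj).
  by have [] := gnorm_ge (comb (v i) (-1) (v j)).
have [z hz cz] : exists2 z, L2 z & ip (fun t => vz (v i) t - z t) (fun t => vz (v i) t - z t)
    @[i --> \oo] --> (0 : R).
  apply: L2_complete => [i|e /cau[N hN]]; first by have [[]] := av i.
  exists N => i j Ni Nj; rewrite ipN; apply: le_trans (hN i j Ni Nj).
  by have [] := gnorm_ge (comb (v i) (-1) (v j)).
have [p hp cp] : exists2 p, L2 p & ip (fun t => vp (v i) t - p t) (fun t => vp (v i) t - p t)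
    @[i --> \oo] --> (0 : R).
  apply: L2_complete => [i|e /cau[N hN]]; first by have [[]] := av i.
  exists N => i j Ni Nj; rewrite ipN; apply: le_trans (hN i j Ni Nj).
  by have [] := gnorm_ge (comb (v i) (-1) (v j)).
have [al cal] : exists y, dotv (va (v i) - y) (va (v i) - y) @[i --> \oo] --> (0 : R).
  apply: cauchy_cvg_cV => e /cau[N hN]; exists N => i j Ni Nj.
  apply: le_trans (hN i j Ni Nj).
  by have [_ _ _ + _] := gnorm_ge (comb (v i) (-1) (v j)); rewrite va_comb scaleN1r.
have [be cbe] : exists y, dotv (vg (v i) b - y) (vg (v i) b - y) @[i --> \oo] --> (0 : R).
  apply: cauchy_cvg_cV => e /cau[N hN]; exists N => i j Ni Nj.
  apply: le_trans (hN i j Ni Nj).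
  by have [_ _ _ _] := gnorm_ge (comb (v i) (-1) (v j)); rewrite /= scaleN1r.
(* The constant of integration is fixed by the value at the final time. *)
pose w := adj_rhs u z p.
have hw : L2 w := L2_adj_rhs hu hz hp.
pose g := mkrep a b (be - (\col_i prim a b (fun s => w s i 0) b)) w.
have gb : g b = be.
  by apply/matrixP => i j; rewrite !mxE ord1 subrK.
have rg : rep g w g.
  split=> //; first exact: ae_eq_refl.
  by move=> t tD i; rewrite /g mkrep_a mxE.
have [K K0 hK] := adj_rhs_le; have [K' K'0 hK'] := ip_mulmx_le (bmx_cst a b F^T).
have ba : 0 <= b - a by rewrite subr_ge0 ltW.
pose S i := ip (fun t => vu (v i) t - u t) (fun t => vu (v i) t - u t)
  + ip (fun t => vz (v i) t - z t) (fun t => vz (v i) t - z t)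
  + ip (fun t => vp (v i) t - p t) (fun t => vp (v i) t - p t).
have S_0 : S i @[i --> \oo] --> (0 : R).
  by rewrite -[X in _ --> X](addr0 0) -[X in _ --> X + _](addr0 0); apply: cvgD => //; apply: cvgD.
pose B i := 2 * dotv (vg (v i) b - be) (vg (v i) b - be) + 2 * (b - a) * (K * S i).
have B_0 : B i @[i --> \oo] --> (0 : R).
  rewrite [X in _ --> X](_ : 0 = 2 * 0 + 2 * (b - a) * (K * 0)); last by rewrite !mulr0 addr0.
  by apply: cvgD; apply: cvgMr => //; apply: cvgMr.
have rdiff i : rep (fun t => F^T *m vz (v i) t + (-1) *: g t)
    (adj_rhs (fun t => vu (v i) t + (-1) *: u t) (fun t => vz (v i) t + (-1) *: z t)
       (fun t => vp (v i) t + (-1) *: p t))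
    (fun t => vg (v i) t + (-1) *: g t).
  have [[_ _ _ ri] _] := av i.
  by apply: rep_ext (repD ri (repZ (-1) rg)) => // t; exact: adj_rhs_comb.
have le_B i t : t \in `[a, b] -> dotv (vg (v i) t - g t) (vg (v i) t - g t) <= B i.
  move=> tD; have := rep_bound ab (rdiff i) tD; rewrite !scaleN1r gb.
  move=> /le_trans; apply; rewrite lerD2l; apply: ler_wpM2l; first exact: mulr_ge0.
  rewrite /S !ipN; have [[hui hzi hpi _] _] := av i.
  exact: (hK _ _ _ (L2D hui (L2Z _ hu)) (L2D hzi (L2Z _ hz)) (L2D hpi (L2Z _ hp))).
have Lg := rep_L2 ab rg; have LFz := L2_mx F^T hz.
have Fz_g : ae_eq mu D (fun t => F^T *m z t) g.
  have hd := L2B LFz Lg.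
  have d0 : ip (fun t => F^T *m z t - g t) (fun t => F^T *m z t - g t) = 0.
    apply/le_anti; rewrite ip_ge0 andbT.
    apply: (@le0_of_cvg _ _ (fun i => 2 * (K' * ip (fun t => vz (v i) t - z t) (fun t => vz (v i) t - z t))
      + 2 * ((b - a) * B i))); last first.
      rewrite [X in _ --> X](_ : 0 = 2 * (K' * 0) + 2 * ((b - a) * 0)); last by rewrite !mulr0 addr0.
      by apply: cvgD; apply: cvgMr; apply: cvgMr.
    move=> i; have [[hui hzi hpi ri] _] := av i.
    have LFzi := L2_mx F^T hzi.
    apply: le_trans (ip_triangle LFz LFzi Lg) _; apply: lerD.
      rewrite ler_pM2l//.
      have -> : ip (fun t => F^T *m z t - F^T *m vz (v i) t) (fun t => F^T *m z t - F^T *m vz (v i) t)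
        = ip (fun t => F^T *m (vz (v i) t - z t)) (fun t => F^T *m (vz (v i) t - z t)).
        by apply: ip_eq => t _; rewrite mulmxBr -opprB dotvNl dotvNr opprK.
      exact: (hK' _ (L2B hzi hz)).
    rewrite ler_pM2l//.
    have Lgi := rep_L2 ab ri; have hgi := L2B Lgi Lg; have [_ egi _] := ri.
    have -> : ip (fun t => F^T *m vz (v i) t - g t) (fun t => F^T *m vz (v i) t - g t) =
        ip (fun t => vg (v i) t - g t) (fun t => vg (v i) t - g t).
      have e1 : ae_eq mu D (fun t => F^T *m vz (v i) t - g t) (fun t => vg (v i) t - g t).
        by apply: filterS egi => t ht Dt; rewrite (ht Dt).
      have h1 := L2B LFzi Lg.
      exact: (ip_ae h1 h1 hgi hgi e1 e1).
    have -> : (b - a) * B i = \int[mu]_(t in D) (B i).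
      have muD : fine (mu D) = b - a by rewrite lebesgue_measure_itv/= lte_fin ab.
      by rewrite Rintegral_cst// mulrC muD.
    apply: le_Rintegral => //.
    - exact: (dotv_integrable hgi hgi).
    - exact: integrable_itv_cst.
    - by move=> t tD; apply: le_B.
  apply: filterS (ip_eq0 hd d0) => t ht Dt; exact/subr0_eq/ht.
pose d := G *m g a - al.
have dE i : d - vd (v i) = G *m (g a - vg (v i) a) + (va (v i) - al).
  by rewrite /d /va mulmxBr -!addrA addKr (addrC (- al)).
exists (Unknowns u z p g d).
  split=> /=.
    split; [exact: hu|exact: hz|exact: hp|].
    exact: (rep_ae rg hw (ae_eq_sym Fz_g) (ae_eq_refl _ _ _)).
  have [K1 K10 h1] := dotv_mulmx_le F^T; have [K2 K20 h2] := dotv_mulmx_le G.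
  apply: dotv_eq0; apply/le_anti; rewrite dotv_ge0 andbT.
  apply: (@le0_of_cvg _ _ (fun i => K1 * (2 * (K2 * B i) + 2 * dotv (va (v i) - al) (va (v i) - al)))).
    move=> i; have [_ di] := av i.
    have -> : F^T *m d = F^T *m (d - vd (v i)) by rewrite [RHS]mulmxBr di subr0.
    apply: le_trans (h1 _) _; apply: ler_wpM2l => //; rewrite dE.
    apply: le_trans (dotv_add_le _ _) _; rewrite lerD2r ler_pM2l//.
    apply: le_trans (h2 _) _; apply: ler_wpM2l => //.
    by have := le_B i a (aD ab); rewrite -opprB dotvNl dotvNr opprK.
  rewrite [X in _ --> X](_ : 0 = K1 * (2 * (K2 * 0) + 2 * 0)); last by rewrite !(mulr0, addr0).
  by apply: cvgMr; apply: cvgD; apply: cvgMr => //; apply: cvgMr.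
rewrite (_ : (fun i => _) = (fun i => S i + dotv (va (v i) - al) (va (v i) - al)
    + dotv (vg (v i) b - be) (vg (v i) b - be))).
  rewrite -[X in _ --> X](addr0 0) -[X in _ --> X + _](addr0 0).
  by apply: cvgD => //; apply: cvgD.
apply/funext => i; rewrite /gnorm va_comb /= /S !ipN !scaleN1r gb.
by have -> : va (Unknowns u z p g d) = al by rewrite /va /= /d opprB addrC subrK.
Qed.

(** The test tuples of the Euler-Lagrange equations whose [F^T z] vanishes. *)
Lemma adm_test u z p d : L2 u -> L2 z -> L2 p -> (forall t, F^T *m z t = 0) ->
  (forall t, adj_rhs u z p t = 0) -> F^T *m d = 0 -> adm (Unknowns u z p (fun=> 0) d).
Proof.
move=> hu hz hp z0 r0 d0; split; last exact: d0.
split; [exact: hu|exact: hz|exact: hp|].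
by apply: rep_ext (rep_cst0 a b n) => t; [exact/esym/z0|exact/esym/r0].
Qed.

(** The polar form of the functional whose minimiser, under the linear term of
    [tikh_riesz], solves the boundary value problem: the energy plus the
    penalised residual. *)
Definition tikh (eps : R) (v w : unknowns) : R :=
  energy v w + eps^-1 * (ip (vp v) (vp w) + dotv (vg v b) (vg w b)).

Lemma tikh_gnorm eps : 0 < eps -> exists K1 K2, [/\ 0 <= K1, 0 <= K2 &
  forall v, adm v -> gnorm v <= K1 * tikh eps v v /\ tikh eps v v <= K2 * gnorm v].
Proof.
move=> e0; have ie0 : 0 <= eps^-1 by rewrite invr_ge0 ltW.
have [K K0 hK] := energy_coercive.
have [M1 M10 hM1] := ip_mulmx_le Ri_b; have [M2 M20 hM2] := ip_mulmx_le Qi_b.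
have [M3 M30 hM3] := dotv_mulmx_le Q0i.
exists (3 * K + eps), (3 + M1 + M2 + M3 + eps^-1); split; [lra|lra|].
move=> v av; have [h1 h2 h3] := hK v av; have [[hu hz hp _] _] := av.
have p1 := ip_ge0 a b (vu v); have p2 := ip_ge0 a b (vz v).
have p3 := ip_ge0 a b (vp v); have p4 := dotv_ge0 (va v); have p5 := dotv_ge0 (vg v b).
have p6 := energy_ge0 v.
rewrite /tikh /gnorm; split.
  set X := ip (vp v) (vp v) + dotv (vg v b) (vg v b).
  have q1 : eps * (eps^-1 * X) = X by rewrite mulrA mulfV ?gt_eqF// mul1r.
  have q2 : 0 <= K * (eps^-1 * X) by rewrite !mulr_ge0// addr_ge0.
  have q3 : 0 <= eps * energy v v by rewrite mulr_ge0// ltW.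
  have -> : (3 * K + eps) * (energy v v + eps^-1 * X) = 3 * (K * energy v v)
    + 3 * (K * (eps^-1 * X)) + eps * energy v v + eps * (eps^-1 * X) by ring.
  have hX : X = ip (vp v) (vp v) + dotv (vg v b) (vg v b) by [].
  by rewrite q1; clearbody X; lra.
have le_am k (f g : R -> 'cV[R]_k) : L2 f -> L2 g ->
    ip f g <= ip f f + ip g g.
  move=> hf hg; have := ip_expand (-1) hf hg.
  have := ip_ge0 a b (fun t => f t + (-1) *: g t) => /[swap] ->.
  have := ip_ge0 a b f; have := ip_ge0 a b g; lra.
have e1 := le_am _ _ _ hu (L2_Ri hu); have e2 := le_am _ _ _ hz (L2_Qi hz).
have e3 := dotv_am (va v) (Q0i *m va v).
have f1 := hM1 _ hu; have f2 := hM2 _ hz; have f3 := hM3 (va v).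
rewrite /energy; set K2 := 3 + M1 + M2 + M3 + eps^-1.
have c1 : (1 + M1) * ip (vu v) (vu v) <= K2 * ip (vu v) (vu v).
  by rewrite ler_wpM2r// /K2; lra.
have c2 : (1 + M2) * ip (vz v) (vz v) <= K2 * ip (vz v) (vz v).
  by rewrite ler_wpM2r// /K2; lra.
have c3 : (1 + M3) * dotv (va v) (va v) <= K2 * dotv (va v) (va v).
  by rewrite ler_wpM2r// /K2; lra.
have c4 : eps^-1 * (ip (vp v) (vp v) + dotv (vg v b) (vg v b)) <=
    K2 * (ip (vp v) (vp v) + dotv (vg v b) (vg v b)).
  by apply: ler_wpM2r; [exact: addr_ge0|rewrite /K2; lra].
rewrite mulrDl mul1r in c1; rewrite mulrDl mul1r in c2; rewrite mulrDl mul1r in c3.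
rewrite [leRHS](_ : _ = K2 * ip (vu v) (vu v) + K2 * ip (vz v) (vz v) +
  K2 * dotv (va v) (va v) + K2 * (ip (vp v) (vp v) + dotv (vg v b) (vg v b))); last by ring.
apply: lerD c4; apply: lerD; first apply: lerD.
- by apply: le_trans c1; apply: le_trans e1 _; rewrite lerD2l.
- by apply: le_trans c2; apply: le_trans e2 _; rewrite lerD2l.
- by apply: le_trans c3; apply: le_trans e3 _; rewrite lerD2l.
Qed.

Lemma adm_L2 v : adm v -> [/\ L2 (vu v), L2 (vz v), L2 (vp v) & L2 (vg v)].
Proof. by move=> [[hu hz hp rg] _]; split; [exact: hu|exact: hz|exact: hp|exact: (rep_L2 ab rg)]. Qed.

(** The weak form of the boundary value problem. *)
Lemma tikh_riesz eps l : 0 < eps -> exists2 v, adm v &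
  forall w, adm w -> tikh eps v w = eps^-1 * dotv (F^T *m l) (vg w b).
Proof.
move=> e0; have ie0 : 0 < eps^-1 by rewrite invr_gt0.
have [K1 [K2 [K10 K20 hK]]] := tikh_gnorm e0.
apply: (riesz (comb := comb) (K := dotv (F^T *m l) (F^T *m l) * eps^-1)).
- by move=> c v w; apply: adm_comb.
- exists (Unknowns (fun=> 0) (fun=> 0) (fun=> 0) (fun=> 0) 0).
  apply: adm_test; [exact: L2_0|exact: L2_0|exact: L2_0|..].
  + by move=> t; rewrite mulmx0.
  + by move=> t; rewrite /adj_rhs !mulmx0 oppr0 !addr0.
  + by rewrite mulmx0.
- move=> v w; rewrite /tikh energyC (ipC _ _ (vp v)) (dotvC (vg v b)) //.
- move=> c v w x av aw ax; rewrite /tikh energy_combl//.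
  have [_ _ hpv _] := adm_L2 av; have [_ _ hpw _] := adm_L2 aw.
  have [_ _ hpx _] := adm_L2 ax.
  by rewrite /= (ipDl hpv (L2Z c hpw) hpx) (ipZl c hpw hpx) dotvDl dotvZl; ring.
- move=> v av; rewrite /tikh addr_ge0 ?energy_ge0// mulr_ge0 ?(ltW ie0)//.
  by rewrite addr_ge0 ?ip_ge0 ?dotv_ge0.
- by move=> c v w _ _; rewrite /= dotvDr dotvZr; ring.
- by rewrite mulr_ge0 ?dotv_ge0// ltW.
- move=> v av; rewrite exprMn.
  have cs : dotv (F^T *m l) (vg v b) ^+ 2 <= dotv (F^T *m l) (F^T *m l) * dotv (vg v b) (vg v b).
    apply: discriminant; last exact: dotv_ge0.
    move=> s; have := dotv_ge0 (F^T *m l + s *: vg v b).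
    by rewrite !(dotvDl, dotvDr, dotvZl, dotvZr) (dotvC (vg v b) (F^T *m l)); lra.
  apply: (@le_trans _ _ (dotv (F^T *m l) (F^T *m l) * eps^-1 * (eps^-1 * dotv (vg v b) (vg v b)))).
    rewrite [leRHS](_ : _ = eps^-1 ^+ 2 * (dotv (F^T *m l) (F^T *m l) * dotv (vg v b) (vg v b))).
      by rewrite ler_wpM2l// sqr_ge0.
    by ring.
  apply: ler_wpM2l; first by rewrite mulr_ge0 ?dotv_ge0// ltW.
  rewrite /tikh mulrDr addrA lerDr addr_ge0 ?energy_ge0//.
  by rewrite mulr_ge0 ?ip_ge0 ?(ltW ie0).
- move=> v av cau.
  have [||w aw cw] := @adm_complete v.
  + exact: av.
  + move=> e ee0; have K11 : 0 < K1 + 1 by rewrite ltr_wpDl.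
    have [N hN] := cau (e / (K1 + 1)) (divr_gt0 ee0 K11).
    exists N => i j Ni Nj; have ad := adm_comb (-1) (av i) (av j).
    apply: le_trans (hK _ ad).1 _.
    apply: le_trans (ler_wpM2l K10 (hN i j Ni Nj)) _.
    rewrite mulrA ler_pdivrMr// mulrC; apply: ler_wpM2l; first exact: ltW.
    by rewrite lerDl.
  exists w => //.
  apply: (cvg0_ge0_le (t := fun i => K2 * gnorm (comb (v i) (-1) w))).
  + move=> i; rewrite /tikh addr_ge0 ?energy_ge0// mulr_ge0 ?(ltW ie0)//.
    by rewrite addr_ge0 ?ip_ge0 ?dotv_ge0.
  + by move=> i; apply: (hK _ (adm_comb (-1) (av i) aw)).2.
  + by rewrite -[X in _ --> X](mulr0 K2); apply: cvgMr.
Qed.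

(** The Euler-Lagrange equations of the weak problem. That [F p] has a
    representative at all is a regularity statement: the weak identity determines
    the projection of [p] on the range of [F^T] as [F^+] of a primitive of
    [C p + eps Q^-1 z]. *)
Theorem bvp_exists l eps : 0 < eps -> exists v h, bvp l eps v h.
Proof.
move=> e0; have [v av weak] := tikh_riesz l e0.
have en0 : eps != 0 by rewrite gt_eqF.
have [hu hz hp hg] := adm_L2 av.
have {}weak w : adm w -> eps * energy v w + (ip (vp v) (vp w) + dotv (vg v b) (vg w b)) =
    dotv (F^T *m l) (vg w b).
  move=> /weak; rewrite /tikh => /(congr1 ( *%R eps)).
  by rewrite mulrDr !mulrA mulfV// !mul1r.
have G_P : G *m (F^T *m G) = G by have [_ + _ _] := pinvP F^T; rewrite mulmxA.
pose k t := C t *m vp v t + eps *: (Qi t *m vz v t).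
have hk : L2 k by exact: (L2D (L2_C hp) (L2Z eps (L2_Qi hz))).
(* Testing against an arbitrary [u], whose effect [H' u] on the equation is
   cancelled by the residual. *)
have Ru : ae_eq mu D (fun t => eps *: (Ri t *m vu v t)) (fun t => H t *m vp v t).
  pose r t := eps *: (Ri t *m vu v t) - H t *m vp v t.
  have hr : L2 r by exact: (L2B (L2Z eps (L2_Ri hu)) (L2_H hp)).
  have hHr := L2_HT hr.
  have aw : adm (Unknowns r (fun=> 0) (fun t => - ((H t)^T *m r t)) (fun=> 0) 0).
    apply: adm_test; [exact: hr|exact: L2_0|exact: (L2N hHr)|..].
    - by move=> t; rewrite mulmx0.
    - by move=> t; rewrite /adj_rhs mulmx0 oppr0 add0r subrr.
    - by rewrite mulmx0.
  have := weak _ aw; rewrite /energy /va /= mulmx0 subr0 mulmx0 !dotv0r !addr0.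
  have -> : ip (vz v) (fun t => Qi t *m 0) = 0.
    by rewrite ipC -[RHS](ip0l a b (vz v)); apply: ip_eq => t _; rewrite mulmx0.
  rewrite addr0 (ip_symm _ _ (fun t tD => (Ri_pd tD).1)).
  rewrite -(ipZr eps (L2_Ri hu) hr) ipC.
  have -> : ip (vp v) (fun t => - ((H t)^T *m r t)) = - ip (fun t => H t *m vp v t) r.
    rewrite -(ipNl (L2_H hp) hr); apply: ip_eq => t _.
    by rewrite dotvNr dotvNl dotv_mulmxl.
  rewrite -(ipBl (L2Z eps (L2_Ri hu)) (L2_H hp) hr) => r0.
  by apply: filterS (ip_eq0 hr r0) => t ht Dt; apply/subr0_eq/ht.
(* Testing against [z] in the kernel of [F^T]: the candidate [k] for the
   derivative of the representative of [F p] lies in the range of [F]. *)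
pose S := G *m F^T.
have ST : S^T = S := projF_tr.
have SS : S *m S = S by rewrite /S !mulmxA -(mulmxA G) G_P.
have FS0 (x : 'cV[R]_m) : F^T *m (x - S *m x) = 0.
  by rewrite mulmxBr /S !mulmxA projFT subrr.
have Sk : ae_eq mu D (fun t => S *m k t) k.
  pose z t := k t - S *m k t.
  have hz' : L2 z by exact: (L2B hk (L2_mx S hk)).
  have hCz := L2_CT hz'.
  have aw : adm (Unknowns (fun=> 0) z (fun t => (C t)^T *m z t) (fun=> 0) 0).
    apply: adm_test; [exact: L2_0|exact: hz'|exact: hCz|..].
    - by move=> t; exact: FS0.
    - by move=> t; rewrite /adj_rhs mulmx0 addr0 addNr.
    - by rewrite mulmx0.
  have := weak _ aw; rewrite /energy /va /= mulmx0 subr0 mulmx0 !dotv0r !addr0.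
  have -> : ip (vu v) (fun t => Ri t *m 0) = 0.
    by rewrite ipC -[RHS](ip0l a b (vu v)); apply: ip_eq => t _; rewrite mulmx0.
  rewrite add0r (ip_symm _ _ (fun t tD => (Qi_pd tD).1)).
  rewrite -(ipZr eps (L2_Qi hz) hz') [X in X + _]ipC.
  have -> : ip (vp v) (fun t => (C t)^T *m z t) = ip (fun t => C t *m vp v t) z.
    by apply: ip_eq => t _; rewrite dotv_mulmxl.
  rewrite addrC -(ipDl (L2_C hp) (L2Z eps (L2_Qi hz)) hz') => kz.
  have zz : ip z z = 0.
    rewrite -kz; apply: ip_eq => t _.
    rewrite {1}/z dotvBl dotv_mulmxl ST /z mulmxBr mulmxA SS subrr dotv0r subr0.
    by [].
  by apply: filterS (ip_eq0 hz' zz) => t ht Dt; apply/esym/subr0_eq/ht.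
(* Testing against [d] in the kernel of [F^T]: the candidate for the initial
   value lies in the range of [F] as well. *)
pose c0 := Q0i *m va v.
have Sc0 : S *m c0 = c0.
  pose d := c0 - S *m c0.
  have aw : adm (Unknowns (fun=> 0) (fun=> 0) (fun=> 0) (fun=> 0) d).
    apply: adm_test; [exact: L2_0|exact: L2_0|exact: L2_0|..].
    - by move=> t; rewrite mulmx0.
    - by move=> t; rewrite /adj_rhs !mulmx0 oppr0 !addr0.
    - exact: FS0.
  have := weak _ aw; rewrite energyC /energy /va /= mulmx0 sub0r !dotv0r !ip0l.
  rewrite ipC ip0l !add0r !addr0 dotvNl -/c0 => /eqP.
  rewrite mulf_eq0 (negPf en0) oppr_eq0 /= => /eqP dc.
  have dd : dotv d d = 0.
    rewrite -dc {2}/d dotvBr (dotv_mulmxr S) ST.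
    have -> : S *m d = 0 by rewrite /d mulmxBr (mulmxA S S) SS subrr.
    by rewrite dotv0l subr0.
  by have := dotv_eq0 dd => /subr0_eq.
pose h := mkrep a b (eps *: c0) k.
have rh : rep h k h.
  split; [exact: hk|exact: ae_eq_refl|].
  by move=> t tD i; rewrite /h mkrep_a mxE.
have ha : h a = eps *: c0 by rewrite /h mkrep_a.
have Sh t : t \in `[a, b] -> S *m h t = h t.
  move=> tD.
  have := rep_ae (rep_mulmx S rh) hk (ae_eq_refl _ _ _) Sk.
  move=> [_ _ hS]; apply/matrixP => i j; rewrite ord1 (hS t tD i).
  have [_ _ hh] := rh.
  by rewrite (hh t tD i) ha -scalemxAr Sc0.
(* Testing against [z = G g] for a primitive [g] with arbitrary derivative and
   final value: integration by parts isolates the projection [P p] of [p]. *)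
pose P := F^T *m G.
have PT : P^T = P := projFT_tr.
have test r c : L2 r ->
    dotv (G^T *m h b) c - ip (fun t => G^T *m h t) r + ip (fun t => P *m vp v t) r
    + dotv (P *m (vg v b - F^T *m l)) c = 0.
  move=> hr.
  pose ga := mkrep a b (c - \col_i prim a b (fun s => r s i 0) b) r.
  have gb : ga b = c by apply/matrixP => i j; rewrite !mxE ord1 subrK.
  have rga : rep ga r ga.
    split; [exact: hr|exact: ae_eq_refl|].
    by move=> t tD i; rewrite /ga mkrep_a mxE.
  have hga := rep_L2 ab rga.
  pose z t := G *m ga t.
  have hz' : L2 z := L2_mx G hga.
  have hCz := L2_CT hz'; have hPr := L2_mx P hr.
  have aw : adm (Unknowns (fun=> 0) z (fun t => P *m r t + (C t)^T *m z t)
      (fun t => P *m ga t) 0).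
    split; last by rewrite /= mulmx0.
    split; [exact: L2_0|exact: hz'|exact: (L2D hPr hCz)|].
    apply: rep_ext (rep_mulmx P rga) => t; first by rewrite /= mulmxA.
    by rewrite /= mulmx0 addr0 [P *m _ + _]addrC addKr.
  have := weak _ aw; rewrite /energy /va /= gb subr0.
  have -> : ip (vu v) (fun t => Ri t *m 0) = 0.
    by rewrite ipC -[RHS](ip0l a b (vu v)); apply: ip_eq => t _; rewrite mulmx0.
  rewrite add0r (ip_symm _ _ (fun t tD => (Qi_pd tD).1)) mulrDr.
  rewrite -(ipZr eps (L2_Qi hz) hz') (ipDr hPr hCz hp).
  have -> : ip (vp v) (fun t => (C t)^T *m z t) = ip z (fun t => C t *m vp v t).
    by rewrite [RHS]ipC; apply: ip_eq => t _; rewrite dotv_mulmxl.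
  have -> : ip (vp v) (fun t => P *m r t) = ip (fun t => P *m vp v t) r.
    by apply: ip_eq => t _; rewrite dotv_mulmxl PT.
  have -> : G *m (P *m ga a) = G *m ga a by rewrite mulmxA G_P.
  have -> : dotv (va v) (Q0i *m (G *m ga a)) = dotv c0 (G *m ga a).
    by rewrite /c0 dotv_mulmxl Q0i_pd.1.
  have -> : dotv (vg v b) (P *m c) = dotv (P *m vg v b) c by rewrite dotv_mulmxl PT.
  have -> : dotv (F^T *m l) (P *m c) = dotv (P *m (F^T *m l)) c by rewrite [RHS]dotv_mulmxl PT.
  have eq_k : ip z k = ip z (fun t => C t *m vp v t) + ip z (fun t => eps *: (Qi t *m vz v t)).
    exact: (ipDr (L2_C hp) (L2Z eps (L2_Qi hz)) hz').
  have parts := rep_by_parts ab (rep_mulmx G^T rh) rga.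
  have eq_k' : ip (fun t => G^T *m k t) ga = ip z k.
    by rewrite ipC; apply: ip_eq => t _; rewrite dotv_mulmxr trmxK.
  rewrite eq_k' eq_k gb ha in parts.
  have eq_a : dotv (G^T *m (eps *: c0)) (ga a) = eps * dotv c0 (G *m ga a).
    by rewrite dotv_mulmxl trmxK dotvZl.
  rewrite eq_a in parts.
  by rewrite mulmxBr dotvBl => eqn; move: parts eqn; lra.
have hPp := L2_mx P hp.
have hGh := rep_L2 ab (rep_mulmx G^T rh).
have Pp : ae_eq mu D (fun t => P *m vp v t) (fun t => G^T *m h t).
  have hr := L2B hPp hGh.
  have := test _ 0 hr; rewrite !dotv0r addr0 add0r addrC => r0.
  have r0' := ipBl hPp hGh hr; rewrite r0 in r0'.
  by apply: filterS (ip_eq0 hr r0') => t ht Dt; apply/subr0_eq/ht.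
have end_b : G^T *m h b + P *m (vg v b - F^T *m l) = 0.
  have := test _ (G^T *m h b + P *m (vg v b - F^T *m l)) (L2_0 a b n).
  rewrite ![ip _ (fun=> 0)]ipC !ip0l subr0 addr0 -dotvDl.
  exact: dotv_eq0.
exists v, h; split.
- exact: av.
- apply: (rep_ae rh hk _ (ae_eq_refl _ _ _)).
  apply: filterS Pp => t ht Dt.
  have -> : F *m vp v t = F *m (P *m vp v t).
    have FP : F *m P = F by rewrite -{1}PT /P trmx_mul trmxK mulmxA FGT projF.
    by rewrite mulmxA FP.
  by rewrite (ht Dt) mulmxA FGT Sh.
- apply: filterS Ru => t ht Dt.
  by rewrite -mulmxA -(ht Dt) -scalemxAr mulKVmx// (posdef_unitmx (Rn_pd Dt)).
- move: end_b; rewrite mulmxBr /P (adj_range av.1 (bD ab)) mulmxA projFT.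
  by move=> /eqP; rewrite addrCA addrA subr_eq0 => /eqP.
- by rewrite ha scalerA mulVf// scale1r.
Qed.

Local Notation sig := (sigma a b F C H Q0 Q Rn).
Local Notation FX x := (acrep a b (fun t => F *m x t)).

(** * Bounds of the worst-case error *)

Lemma calGE x0 f : calG a b Q0 Q (x0, f) <->
  L2 f /\ dotv (Q0 *m x0) x0 + ip (fun t => Q t *m f t) f <= 1.
Proof.
rewrite /calG /=; split=> -[hf]; rewrite (integral_dotv (L2_mulmx Q_b hf) hf) -EFinD lee_fin.
  by split.
by move=> ?; split=> //; rewrite (integral_dotv (L2_mulmx Q_b hf) hf) -EFinD lee_fin.
Qed.

Lemma state_of_solution x0 f x : L2 f -> state_solution a b F C x0 f x ->
  state x f (FX x) /\ FX x a = x0.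
Proof.
move=> hf [hx hFx dx xa]; split=> //; split=> //.
exact: (rep_acrep hFx (L2D (L2_C hx) hf) dx).
Qed.

(** Cauchy-Schwarz for the weights of [calG] and their inverses; the two squares
    are completed with the same [s], so that the pair [(x0, f)] is treated as one
    vector of norm at most 1. *)
Lemma error_le v x0 f : adm v -> calG a b Q0 Q (x0, f) ->
  (dotv (va v) x0 + ip (vz v) f) ^+ 2 <=
  dotv (va v) (Q0i *m va v) + ip (vz v) (fun t => Qi t *m vz v t).
Proof.
move=> [[_ hz _ _] _] /calGE[hf g1].
set A := _ + ip _ (fun t => Qi t *m _); set B := _ + ip _ f.
have A0 : 0 <= A.
  apply: addr_ge0; first by rewrite dotvC; exact: (posdef_possemidef Q0i_pd).2.
  by apply: ip_possemidef => t tD; apply/posdef_possemidef/Qi_pd.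
apply: (@le_trans _ _ ((dotv (Q0 *m x0) x0 + ip (fun t => Q t *m f t) f) * A)); last first.
  by rewrite -[leRHS]mul1r ler_wpM2r.
apply: discriminant => // s.
have := posdef_square_ge0 s (va v) x0 Q0_pd.
have := ip_square_ge0 s Q_pd Q_b Qi_b hz hf.
by rewrite /A /B /Qi /Q0i; lra.
Qed.

(** Green's formula eliminates the state from the error: what is left is the
    pairing of [error_le] and the noise. *)
Theorem sigma_le l v : adm v -> ae_eq mu D (vp v) (fun=> 0) -> vg v b = F^T *m l ->
  (sig l (vu v) <= (energy v v)%:E)%E.
Proof.
move=> av p0 gb; apply: ub_ereal_sup => _ [x0 [f [x [dsp [Om [P [eta [hG sx cp cW ->]]]]]]]].
have [hf _] := calGE x0 f; have [{}hf _] := hf hG.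
have [st hxa] := state_of_solution hf sx.
have [hx _ _] := st.
have [[hu hz hp _] _] := av.
apply: le_trans (noise_upper Rn_pd Rn_b Ri_b cp cW _ hu (L2_H hx)) _.
rewrite lee_fin.
have gr := green av.1 st.
have e1 : ip (vp v) x = 0.
  by rewrite (ip_ae hp hx (L2_0 a b n) hx p0 (ae_eq_refl _ _ _)) ip0l.
have e2 : dotv (G *m vg v b) (FX x b) = dotv l (FX x b).
  by rewrite gb mulmxA dotv_mulmxl projF_tr (state_range st (bD ab)).
have e3 : dotv (G *m vg v a) (FX x a) = dotv (va v) x0.
  rewrite -hxa /va dotvBl (adm_d_ortho st av (aD ab)) subr0.
  by [].
have -> : dotv l (FX x b) - ip (vu v) (fun t => H t *m x t) = dotv (va v) x0 + ip (vz v) f.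
  by rewrite -e2 -e3; move: gr; rewrite e1; lra.
have := error_le av hG.
rewrite /energy /Ri; lra.
Qed.

Theorem sigma_ge l u x0 f x h : L2 u -> calG a b Q0 Q (x0, f) -> state x f h -> h a = x0 ->
  (((dotv l (h b) - ip u (fun t => H t *m x t)) ^+ 2 + ip u (fun t => Ri t *m u t))%:E
   <= sig l u)%E.
Proof.
move=> hu hG st ha; have [hx hf rh] := st.
have [hH1 dFx eFx] := acrep_rep ab rh.
have [dsp [Om [P [eta [cp cW e]]]]] :=
  noise_lower Rn_pd Rn_b Ri_b (dotv l (h b)) hu (L2_H hx).
rewrite -e; apply: ereal_sup_ubound.
exists x0, f, x, dsp, Om, P, eta; split=> //; last by rewrite (eFx b (bD ab)).
by split=> //; rewrite (eFx a (aD ab)).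
Qed.

(** The rescaled residual is a state of squared size [A], the state part of the
    energy; its deterministic error under [u] is energy plus weighted residual
    minus the weighted product of [u] and [vu v]. Normalising it into the
    ellipsoid and adding the worst noise bounds the square of that error by [A]
    times the room [M - N] left by the noise; the geometric-arithmetic mean
    inequality, used twice, then eliminates [u]. *)
Theorem bvp_le_sigma l eps v h u M : 0 < eps -> bvp l eps v h -> L2 u ->
  (sig l u <= M%:E)%E -> energy v v + 2 * (eps^-1 * pform v h v h) <= M.
Proof.
move=> e0 sv hu sM; have st := bvp_state e0 sv.
have [[[hue hz hp _] _] _ _ _ ha] := sv.
pose N := ip u (fun t => Ri t *m u t).
pose B := ip (vu v) (fun t => Ri t *m vu v t).
pose A := ip (vz v) (fun t => Qi t *m vz v t) + dotv (va v) (Q0i *m va v).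
pose Pf := eps^-1 * pform v h v h.
pose X := energy v v + Pf - ip u (fun t => Ri t *m vu v t).
have EAB : energy v v = A + B by rewrite /energy /A /B; ring.
have N0 : 0 <= N by apply: ip_possemidef => t tD; apply/posdef_possemidef/Ri_pd.
have A0 : 0 <= A.
  apply: addr_ge0; last by rewrite dotvC; exact: (posdef_possemidef Q0i_pd).2.
  by apply: ip_possemidef => t tD; apply/posdef_possemidef/Qi_pd.
(* The rescaled residual times [s], written as a combination of itself. *)
have key s : s ^+ 2 * A <= 1 -> s ^+ 2 * X ^+ 2 + N <= M.
  move=> sA; rewrite -lee_fin; apply: le_trans sM.
  have st' := state_comb (s - 1) st st.
  pose x' t := eps^-1 *: vp v t + (s - 1) *: (eps^-1 *: vp v t).
  pose f' t := Qi t *m vz v t + (s - 1) *: (Qi t *m vz v t).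
  have sE k (y : 'cV[R]_k) : y + (s - 1) *: y = s *: y.
    by rewrite scalerBl scale1r addrC subrK.
  have hG : calG a b Q0 Q (s *: (Q0i *m va v), f').
    apply/calGE; have [_ hf' _] := st'; split=> //.
    apply: le_trans sA; rewrite le_eqVlt; apply/orP; left; apply/eqP.
    rewrite /A mulrDr addrC; congr (_ + _).
      have hQz := L2_Qi hz.
      rewrite expr2 -mulrA -(ipZr s hQz hz) -(ipZl s hz (L2Z s hQz)).
      apply: ip_eq => t tD; rewrite /f' sE -scalemxAr /Qi.
      by rewrite (mulKVmx (posdef_unitmx (Q_pd tD))).
    rewrite -scalemxAr dotvZl dotvZr mulrA -expr2 /Q0i.
    by rewrite (mulKVmx (posdef_unitmx Q0_pd)).
  have := sigma_ge l hu hG st' _; rewrite sE ha => /(_ erefl).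
  rewrite sE; congr (_ <= _)%E; congr (_%:E); congr (_ + _).
  rewrite -exprMn; congr (_ ^+ 2).
  rewrite dotvZr dotvZr (bvp_green2 e0 sv sv) -/Pf /X mulrBr; congr (_ - _).
  have Hp_eq : ae_eq mu D (fun t => H t *m x' t) (fun t => s *: (Ri t *m vu v t)).
    apply: filterS (bvp_Ri e0 sv) => t ht Dt; rewrite -(ht Dt) /x' sE.
    by rewrite -!scalemxAr.
  have [hx' _ _] := st'.
  rewrite (ip_ae hu (L2_H hx') hu (L2Z s (L2_Ri hue)) (ae_eq_refl _ _ _) Hp_eq).
  exact: (ipZr s (L2_Ri hue) hu).
have MN : 0 <= M - N by have := key 0; rewrite expr0n /= !mul0r; lra.
have XA : X ^+ 2 <= A * (M - N).
  have [A00|A00] := eqVneq A 0.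
    have [->|X0] := eqVneq X 0; first by rewrite expr0n /= mulr_ge0.
    have := key ((M - N + 1) / X); rewrite A00 mulr0 => /(_ ler01).
    by rewrite -exprMn divfK//; nra.
  have Ap : 0 < A by rewrite lt_neqAle eq_sym A00.
  have := key (Num.sqrt A^-1); rewrite sqr_sqrtr ?invr_ge0// mulVf// => /(_ (lexx _)).
  by rewrite mulrC -lerBrDr ler_pdivrMr// mulrC.
have AM : ip u (fun t => Ri t *m vu v t) <= (N + B) / 2.
  have := ip_square_ge0 (-1) (fun t tD => Ri_pd tD) Ri_b _ (L2_Ri hue) hu.
  have -> : (fun t => invmx (Ri t)) = Rn by apply/funext => t; rewrite /Ri invmxK.
  move=> /(_ Rn_b).
  have -> : ip (fun t => Ri t *m vu v t) (fun t => invmx (Ri t) *m (Ri t *m vu v t)) = B.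
    rewrite /B ipC; apply: ip_eq => t tD; rewrite (mulKmx (posdef_unitmx (Ri_pd tD))).
    by [].
  rewrite (ipC a b (fun t => Ri t *m u t)) (ipC a b (fun t => Ri t *m vu v t)) -/N; lra.
have XM : 2 * X <= A + (M - N).
  exact: am_gm.
move: XM AM; rewrite /X EAB -/Pf; lra.
Qed.

Local Notation solution := (bvp_solution a b F C H Q0 Q Rn).

Lemma bvp_of_solution l eps u p z d : solution l eps u p z d ->
  bvp l eps (Unknowns u z p (acrep a b (fun t => F^T *m z t)) d) (FX p).
Proof.
move=> [[hu hp hz] [Hp Hz] [dz dp eu] [eb dd ea]].
have rz := rep_acrep Hz (L2_adj_rhs hu hz hp) dz.
have rp := rep_acrep Hp (L2D (L2_C hp) (L2Z eps (L2_Qi hz))) dp.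
split; [|exact: rp|exact: eu| |exact: ea].
  by split; [split; [exact: hu|exact: hz|exact: hp|exact: rz]|exact: dd].
by rewrite -eb pinv_GT.
Qed.

Lemma solution_of_bvp l eps v h : bvp l eps v h -> solution l eps (vu v) (vp v) (vz v) (vd v).
Proof.
move=> [[[hu hz hp rz] dd] rp eu eb ea].
have [Hz dz gz] := acrep_rep ab rz; have [Hp dp gp] := acrep_rep ab rp.
split.
- by split; [exact: hu|exact: hp|exact: hz].
- by split; [exact: Hp|exact: Hz].
- by split; [exact: dz|exact: dp|exact: eu].
- by split=> //; rewrite ?(gz b (bD ab)) ?(gp b (bD ab)) ?(gz a (aD ab)) ?(gp a (aD ab)) ?pinv_GT.
Qed.

(** The parallelogram inequality, by positivity at [v + w - 2 x]. *)
Lemma energy_triangle v w x : adm v -> adm w -> adm x ->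
  energy (comb v (-1) w) (comb v (-1) w) <=
  2 * energy (comb v (-1) x) (comb v (-1) x) + 2 * energy (comb x (-1) w) (comb x (-1) w).
Proof.
move=> av aw ax; have avw := adm_comb 1 av aw.
have := energy_ge0 (comb (comb v 1 w) (-2) x).
rewrite !energy_diff//.
rewrite (energy_combl (-2) avw ax (adm_comb (-2) avw ax)).
rewrite (energy_combr (-2) avw ax avw) (energy_combr (-2) avw ax ax).
rewrite (energy_combl 1 av aw avw) (energy_combl 1 av aw ax).
rewrite (energy_combr 1 av aw av) (energy_combr 1 av aw aw) (energy_combr 1 av aw ax).
rewrite (energyC w v) (energyC x v) (energyC x w).
by lra.
Qed.

Lemma energy_le_gnorm : exists2 K, 0 <= K & forall v, adm v -> energy v v <= K * gnorm v.
Proof.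
have [K1 [K [_ K0 hK]]] := tikh_gnorm ltr01; exists K => // v av.
apply: le_trans (hK v av).2.
by rewrite lerDl invr1 mul1r addr_ge0 ?ip_ge0 ?dotv_ge0.
Qed.

Lemma vd_le_gnorm : exists2 K, 0 <= K & forall v, adm v -> dotv (vd v) (vd v) <= K * gnorm v.
Proof.
have [K1 K10 h1] := dotv_mulmx_le G; have [K2 K20 h2] := adj_bound.
exists (2 * K1 * K2 + 2) => [|v [av _]]; first by rewrite addr_ge0 ?mulr_ge0.
have -> : vd v = G *m vg v a + (- 1) *: va v by rewrite scaleN1r /va opprB addrC subrK.
apply: le_trans (dotv_add_le _ _) _; rewrite dotvZl dotvZr !mulN1r opprK.
have := h2 _ _ _ _ av a (aD ab); have := h1 (vg v a).
have : dotv (vg v b) (vg v b) + ip (vu v) (vu v) + ip (vz v) (vz v) + ip (vp v) (vp v) <= gnorm v.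
  by rewrite /gnorm; have := dotv_ge0 (va v); lra.
have [_ _ _ g4 _] := gnorm_ge v.
set s := _ + ip (vp v) _; set g := gnorm v in g4 *; move=> sg.
set da := dotv (va v) (va v) in g4 *.
move=> /= hG ha; apply: (@le_trans _ _ (2 * (K1 * (K2 * g)) + 2 * g)); last by rewrite le_eqVlt; apply/orP; left; apply/eqP; ring.
rewrite lerD ?ler_pM2l//; apply: le_trans hG _; rewrite ler_wpM2l//.
by apply: le_trans ha _; rewrite ler_wpM2l.
Qed.

Lemma gnorm_split : exists2 K, 0 <= K & forall v, adm v ->
  gnorm v <= K * energy v v + ip (vp v) (vp v) + dotv (vg v b) (vg v b).
Proof.
have [K K0 hK] := energy_coercive; exists (3 * K) => [|v av]; first by rewrite mulr_ge0.
by have [] := hK v av; rewrite /gnorm; lra.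
Qed.

Lemma gnorm_combC v w : gnorm (comb v (-1) w) = gnorm (comb w (-1) v).
Proof.
have sw k (x y : 'cV[R]_k) : dotv (x + (-1) *: y) (x + (-1) *: y) =
    dotv (y + (-1) *: x) (y + (-1) *: x).
  by rewrite !(dotvDl, dotvDr, dotvZl, dotvZr) (dotvC x y); ring.
rewrite /gnorm !va_comb (sw _ (va v)) (sw _ (vg v b)).
have e1 : ip (vu (comb v (-1) w)) (vu (comb v (-1) w)) =
    ip (vu (comb w (-1) v)) (vu (comb w (-1) v)) by apply: ip_eq => t _; exact: sw.
have e2 : ip (vz (comb v (-1) w)) (vz (comb v (-1) w)) =
    ip (vz (comb w (-1) v)) (vz (comb w (-1) v)) by apply: ip_eq => t _; exact: sw.
have e3 : ip (vp (comb v (-1) w)) (vp (comb v (-1) w)) =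
    ip (vp (comb w (-1) v)) (vp (comb w (-1) v)) by apply: ip_eq => t _; exact: sw.
by rewrite e1 e2 e3.
Qed.

(** * The limit of the regularised problems *)

Section Limit.
Context (l : 'cV[R]_m) (u0 : R -> 'cV[R]_q) (M0 : R).
Hypothesis (hu0 : L2 u0) (hM0 : (sig l u0 <= M0%:E)%E).

Let pform_le eps v h : 0 < eps -> bvp l eps v h -> pform v h v h <= eps * M0.
Proof.
move=> e0 sv; have := bvp_le_sigma e0 sv hu0 hM0; have := energy_ge0 v.
have := pform_ge0 v h; set p := pform v h v h => p0 h1 h2.
rewrite mulrC -ler_pdivrMr// mulrC.
have : 0 <= eps^-1 * p by rewrite mulr_ge0// invr_ge0 ltW.
by lra.
Qed.

Let gnorm_cauchy : exists2 K, 0 <= K & forall eps v h del v' h',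
  0 < del -> del <= eps -> bvp l eps v h -> bvp l del v' h' ->
  gnorm (comb v' (-1) v) <= K * (energy v' v' - energy v v) + 4 * M0 * eps.
Proof.
have [K K0 hK] := gnorm_split; exists K => // eps v h del v' h' d0 de sv sv'.
have e0 := lt_le_trans d0 de.
have [av _ _ gb _] := sv; have [av' _ _ gb' _] := sv'.
have acv := adm_comb (-1) av' av; apply: le_trans (hK _ acv) _.
have := ler_wpM2l K0 (bvp_cauchy d0 de sv sv').
have p1 := pform_le e0 sv; have p2 := pform_le d0 sv'.
have [_ _ hp _] := adm_L2 av; have {hp}hp' := hp; have [_ _ hp _] := adm_L2 av'.
have i1 : ip (vp (comb v' (-1) v)) (vp (comb v' (-1) v)) <=
    2 * ip (vp v') (vp v') + 2 * ip (vp v) (vp v).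
  have := ip_add_le hp (L2Z (-1) hp').
  by rewrite (ipZl (-1) hp' (L2Z (-1) hp')) (ipZr (-1) hp' hp'); lra.
have i2 : dotv (vg (comb v' (-1) v) b) (vg (comb v' (-1) v) b) <=
    2 * dotv (G^T *m h b) (G^T *m h b) + 2 * dotv (G^T *m h' b) (G^T *m h' b).
  have -> : vg (comb v' (-1) v) b = G^T *m h b + (-1) *: (G^T *m h' b).
    have e : vg v b = F^T *m l - G^T *m h b by rewrite -gb addrK.
    have e' : vg v' b = F^T *m l - G^T *m h' b by rewrite -gb' addrK.
    by rewrite /= e e' !scaleN1r opprB addrC addrA subrK.
  by have := dotv_add_le (G^T *m h b) ((-1) *: (G^T *m h' b)); rewrite !dotvZl !dotvZr; lra.
rewrite /pform in p1 p2.
have M00 : 0 <= M0.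
  by have := bvp_le_sigma e0 sv hu0 hM0; have := energy_ge0 v;
     have : 0 <= eps^-1 * pform v h v h by [rewrite mulr_ge0 ?pform_ge0// invr_ge0 ltW]; lra.
have dM : del * M0 <= eps * M0 by rewrite ler_wpM2r.
by lra.
Qed.

(** The regularised solutions form a Cauchy family because their energies are
    monotone and bounded; the limit has no residual. *)
Theorem limit_exists : exists w, [/\ adm w, ip (vp w) (vp w) = 0, vg w b = F^T *m l,
  forall u M, L2 u -> (sig l u <= M%:E)%E -> energy w w <= M &
  forall e, 0 < e -> exists2 del, 0 < del & forall eps v h, 0 < eps -> eps <= del ->
    bvp l eps v h -> gnorm (comb v (-1) w) <= e].
Proof.
have /choice[vh hvh] : forall k : nat, exists vh : unknowns * (R -> 'cV[R]_m),
    bvp l k.+1%:R^-1 vh.1 vh.2.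
  move=> k; have [|v [h hv]] := @bvp_exists l k.+1%:R^-1; first by rewrite invr_gt0.
  by exists (v, h).
pose v k := (vh k).1; pose h k := (vh k).2; pose ep k : R := k.+1%:R^-1.
have ep0 k : 0 < ep k by rewrite /ep invr_gt0.
have epS j k : (j <= k)%N -> ep k <= ep j by move=> jk; rewrite /ep lef_pV2// ?posrE// ler_nat.
have sv k : bvp l (ep k) (v k) (h k) := hvh k.
have av k : adm (v k) by case: (sv k).
pose E k := energy (v k) (v k).
have ndE : nondecreasing_seq E.
  move=> j k jk; rewrite -subr_ge0; apply: le_trans (energy_ge0 _) _.
  exact: (bvp_cauchy (ep0 k) (epS j k jk) (sv j) (sv k)).
have E_le eps v' h' u M : 0 < eps -> bvp l eps v' h' -> L2 u -> (sig l u <= M%:E)%E ->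
    energy v' v' <= M.
  move=> e0 sv' hu hM; have := bvp_le_sigma e0 sv' hu hM.
  have : 0 <= eps^-1 * pform v' h' v' h' by rewrite mulr_ge0 ?pform_ge0// invr_ge0 ltW.
  by lra.
have cE : cvgn E.
  apply: nondecreasing_is_cvgn => //; exists M0 => _ [k _ <-].
  exact: (E_le _ _ _ _ _ (ep0 k) (sv k) hu0 hM0).
pose S := limn E.
have ES k : E k <= S by exact: nondecreasing_cvgn_le.
have ep_cvg : ep k @[k --> \oo] --> (0 : R) by exact: cvg_harmonic.
have [K K0 hK] := gnorm_cauchy.
have small e : 0 < e -> exists N, forall k, (N <= k)%N -> K * (S - E k) + 4 * M0 * ep k <= e.
  move=> e0.
  have : K * (S - E k) + 4 * M0 * ep k @[k --> \oo] --> K * (S - S) + 4 * M0 * 0.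
    apply: cvgD; first apply: cvgM; [exact: cvg_cst|apply: cvgB; [exact: cvg_cst|exact: cE]|].
    by apply: cvgM; [exact: cvg_cst|exact: ep_cvg].
  rewrite subrr !mulr0 addr0 => /cvgrPdist_le/(_ e e0)[N _ hN].
  by exists N => k Nk; apply: le_trans (hN k Nk); rewrite sub0r normrN ler_norm.
have [|w aw cw] := adm_complete av.
  move=> e e0; have [N hN] := small e e0; exists N.
  have le_ij i j : (N <= i)%N -> (i <= j)%N -> gnorm (comb (v j) (-1) (v i)) <= e.
    move=> Ni ij; apply: le_trans (hK _ _ _ _ _ _ (ep0 j) (epS _ _ ij) (sv i) (sv j)) _.
    apply: le_trans (hN i Ni); rewrite lerD2r ler_wpM2l// lerB//; exact: ES.
  move=> i j Ni Nj; have [ij|/ltnW ji] := leqP i j; last exact: le_ij.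
  by rewrite gnorm_combC; exact: le_ij.
(* Both the residual and the error in the final condition of [w] are bounded by
   those of [v k] plus the distance, that is, by the null sequence [cr]. *)
pose d k := comb (v k) (-1) w.
have ad k : adm (d k) := adm_comb (-1) (av k) aw.
have M00 : 0 <= M0 by apply: le_trans (energy_ge0 (v 0%N)) (E_le _ _ _ _ _ (ep0 _) (sv _) hu0 hM0).
have [_ _ hpw _] := adm_L2 aw.
have cr : 2 * (ep k * M0) + 2 * gnorm (d k) @[k --> \oo] --> (0 : R).
  have -> : (0 : R) = 2 * (0 * M0) + 2 * 0 by rewrite mul0r mulr0 addr0.
  apply: cvgD; apply: cvgM; [exact: cvg_cst| |exact: cvg_cst|exact: cw].
  by apply: cvgM; [exact: ep_cvg|exact: cvg_cst].
have pw0 : ip (vp w) (vp w) = 0.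
  apply/le_anti; rewrite ip_ge0 andbT; apply: (le0_of_cvg _ cr) => k.
  have [_ _ hpv _] := adm_L2 (av k); have [_ _ hpd _] := adm_L2 (ad k).
  have -> : ip (vp w) (vp w) = ip (fun t => vp (v k) t + (-1) *: vp (d k) t)
      (fun t => vp (v k) t + (-1) *: vp (d k) t).
    by apply: ip_eq => t _; rewrite /= !scaleN1r opprB addrC subrK.
  apply: le_trans (ip_add_le hpv (L2Z (-1) hpd)) _.
  rewrite (ipZl (-1) hpd (L2Z (-1) hpd)) (ipZr (-1) hpd hpd).
  have := pform_le (ep0 k) (sv k); rewrite /pform; have := dotv_ge0 (G^T *m h k b).
  by have [_ _ + _ _] := gnorm_ge (d k); lra.
have gw : vg w b = F^T *m l.
  apply/subr0_eq/dotv_eq0/le_anti; rewrite dotv_ge0 andbT; apply: (le0_of_cvg _ cr) => k.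
  have [_ _ _ gb _] := sv k.
  have -> : vg w b - F^T *m l = (-1) *: (G^T *m h k b) + (-1) *: vg (d k) b.
    have e : vg (v k) b = F^T *m l - G^T *m h k b by rewrite -gb addrK.
    by rewrite /= e !scaleN1r !opprB addrCA addKr.
  apply: le_trans (dotv_add_le _ _) _; rewrite !dotvZl !dotvZr.
  have := pform_le (ep0 k) (sv k); rewrite /pform; have := ip_ge0 a b (vp (v k)).
  by have [_ _ _ _ +] := gnorm_ge (d k); lra.
have ae0 := ip_eq0 hpw pw0.
have [Ke Ke0 hKe] := energy_le_gnorm.
exists w; split=> //.
  (* Since [w] has no residual, [bvp_green] and [bvp_green2] give
     [energy w w = energy (d k) (d k) + (energy (v k) (v k) + 2 * residual)]. *)
  move=> u M hu hM; rewrite -subr_le0.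
  have ckg : Ke * gnorm (d k) @[k --> \oo] --> (0 : R).
    by rewrite -(mulr0 Ke); apply: cvgM; [exact: cvg_cst|exact: cw].
  apply: (le0_of_cvg _ ckg) => k.
  have := hKe _ (ad k); rewrite /d (energy_diff (av k) aw).
  have := bvp_green (ep0 k) (sv k) aw.
  have [_ _ hpv _] := adm_L2 (av k).
  have -> : ip (vp w) (vp (v k)) = 0.
    by rewrite (ip_ae hpw hpv (L2_0 a b n) hpv ae0 (ae_eq_refl _ _ _)) ip0l.
  rewrite gw dotv_mulmxl trmxK mulmxA FGT (bvp_range (sv k) (bD ab)).
  rewrite (bvp_green2 (ep0 k) (sv k) (sv k)) (energyC w).
  by have := bvp_le_sigma (ep0 k) (sv k) hu hM; lra.
move=> e e0.
have [Ks Ks0 hKs] := gnorm_split.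
have ct : Ks * (2 * (S - E k) + 2 * (Ke * gnorm (d k))) + 2 * (ep k * M0) @[k --> \oo] --> (0 : R).
  have -> : (0 : R) = Ks * (2 * (S - S) + 2 * (Ke * 0)) + 2 * (0 * M0).
    by ring.
  apply: cvgD; apply: cvgM; [exact: cvg_cst| |exact: cvg_cst|].
    apply: cvgD; apply: cvgM; [exact: cvg_cst| |exact: cvg_cst|].
      by apply: cvgB; [exact: cvg_cst|exact: cE].
    by apply: cvgM; [exact: cvg_cst|exact: cw].
  by apply: cvgM; [exact: ep_cvg|exact: cvg_cst].
have [k hk] : exists k, Ks * (2 * (S - E k) + 2 * (Ke * gnorm (d k))) + 2 * (ep k * M0) <= e.
  have /cvgrPdist_le/(_ e e0)[N _ hN] := ct; exists N.
  by apply: le_trans (hN N (leqnn N)); rewrite sub0r normrN ler_norm.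
exists (ep k) => // eps v' h' eps0 epsk sv'; apply: le_trans hk.
have [av' _ _ gb' _] := sv'; have [_ _ hpv _] := adm_L2 av'.
apply: le_trans (hKs _ (adm_comb (-1) av' aw)) _.
rewrite -addrA; apply: lerD.
  have t1 : energy (comb v' (-1) (v k)) (comb v' (-1) (v k)) <= S - E k.
    apply: le_trans (bvp_cauchy eps0 epsk (sv k) sv') _; rewrite lerD2r.
    have [j hj] : exists j, ep j <= eps.
      have /cvgrPdist_le/(_ eps eps0)[N _ hN] := ep_cvg; exists N.
      by apply: le_trans (hN N (leqnn N)); rewrite sub0r normrN ler_norm.
    apply: le_trans (ES j); rewrite -subr_ge0; apply: le_trans (energy_ge0 _) _.
    exact: (bvp_cauchy (ep0 j) hj sv' (sv j)).
  have t2 := hKe _ (ad k).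
  apply: (ler_wpM2l Ks0); apply: le_trans (energy_triangle av' aw (av k)) _.
  have two0 : 0 <= 2 :> R by [].
  exact: (lerD (ler_wpM2l two0 t1) (ler_wpM2l two0 t2)).
have -> : vg (comb v' (-1) w) b = (-1) *: (G^T *m h' b).
  have e' : vg v' b = F^T *m l - G^T *m h' b by rewrite -gb' addrK.
  by rewrite /= e' gw !scaleN1r addrAC subrr add0r.
have := ip_add_le hpv (L2Z (-1) hpw).
rewrite (ipZl (-1) hpw (L2Z (-1) hpw)) (ipZr (-1) hpw hpw) pw0 dotvZl dotvZr.
have := pform_le eps0 sv'; rewrite /pform.
have : eps * M0 <= ep k * M0 by rewrite ler_wpM2r.
have := dotv_ge0 (G^T *m h' b); rewrite /=; lra.
Qed.

End Limit.

(** The square roots in [Omega] only enter through their squares. *)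
Lemma Omega_energy w : adm w -> Omega a b F Q0 Q Rn (vu w) (vz w) (vd w) = energy w w.
Proof.
move=> [[hu hz hp rz] dd]; have [_ _ gz] := acrep_rep ab rz.
have weight k (M : R -> 'M[R]_k) f : (forall t, t \in `[a, b] -> sym_posdef (M t)) ->
    L2norm a b (fun t => sqrtmx (M t) *m f t) ^+ 2 = ip f (fun t => M t *m f t).
  move=> pM; rewrite L2norm_sqr; apply: ip_eq => t tD.
  by rewrite -enorm_sqr (enorm_sqrtmx _ (posdef_possemidef (pM t tD))) dotvC.
rewrite /Omega (weight _ _ _ (fun t tD => Ri_pd tD)) (weight _ _ _ (fun t tD => Qi_pd tD)).
rewrite (enorm_sqrtmx _ (posdef_possemidef Q0i_pd)) (gz a (aD ab)) dotvC.
by rewrite /energy -/(va w) addrAC.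
Qed.

Lemma bvp_wellposed eps l : 0 < eps ->
  (exists u p z d, solution l eps u p z d) /\
  (forall u p z d u' p' z' d', solution l eps u p z d -> solution l eps u' p' z' d' ->
    [/\ ae_eq mu D u u', ae_eq mu D p p', ae_eq mu D z z' & d = d']).
Proof.
move=> e0; split.
  have [v [h sv]] := bvp_exists l e0.
  by exists (vu v), (vp v), (vz v), (vd v); exact: (solution_of_bvp sv).
move=> u p z d u' p' z' d' /bvp_of_solution s1 /bvp_of_solution s2.
exact: (bvp_unique e0 s1 s2).
Qed.

(** * The minimax estimate *)

(** The limit of [limit_exists] is sandwiched: [sigma_le] bounds its worst-case
    error above by its energy, which no other functional can go below. *)
Theorem minimax_limit l : minimax_observable a b F C H Q0 Q Rn l ->
  exists (dh : 'cV[R]_m) (uh : R -> 'cV[R]_q) (zh : R -> 'cV[R]_m),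
    [/\ L2 uh /\ L2 zh,
      forall (u_ : R -> R -> 'cV[R]_q) (p_ : R -> R -> 'cV[R]_n)
             (z_ : R -> R -> 'cV[R]_m) (d_ : R -> 'cV[R]_m),
        (forall eps, 0 < eps -> solution l eps (u_ eps) (p_ eps) (z_ eps) (d_ eps)) ->
        [/\ d_ eps @[eps --> 0^'+] --> dh,
            L2norm a b (fun t => u_ eps t - uh t) @[eps --> 0^'+] --> (0 : R)
          & L2norm a b (fun t => z_ eps t - zh t) @[eps --> 0^'+] --> (0 : R)],
      [/\ in_H1 a b (fun t => F^T *m zh t),
          ae_derive a b (acrep a b (fun t => F^T *m zh t))
            (fun t => - ((C t)^T *m zh t) + (H t)^T *m uh t)
        & acrep a b (fun t => F^T *m zh t) b = F^T *m l]
    & l_estimate a b F C H Q0 Q Rn l uh /\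
      sigma_hat a b F C H Q0 Q Rn l = (Omega a b F Q0 Q Rn uh zh dh)%:E].
Proof.
rewrite /minimax_observable /= => /ereal_inf_lt[_ [u0 hu0 <-] s0].
have [M0 hM0] : exists M0, (sig l u0 <= M0%:E)%E.
  by move: s0; case: (sig l u0) => [r||]// _; [exists r|exists 0; rewrite leNye].
have [w [aw p0 gb low lim]] := limit_exists hu0 hM0.
have [[hu hz hp rz] dd] := aw.
exists (vd w), (vu w), (vz w); split.
- by split; [exact: hu|exact: hz].
- move=> u_ p_ z_ d_ sol.
  pose v eps := Unknowns (u_ eps) (z_ eps) (p_ eps) (acrep a b (fun t => F^T *m z_ eps t)) (d_ eps).
  have sv eps : 0 < eps -> bvp l eps (v eps) (FX (p_ eps)).
    by move=> /sol /bvp_of_solution.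
  have near_le e : 0 < e -> \forall eps \near 0^'+, gnorm (comb (v eps) (-1) w) <= e /\ adm (v eps).
    move=> e0; have [del del0 hdel] := lim e e0.
    near=> eps; have eps0 : 0 < eps by near: eps; exact: nbhs_right_gt.
    have := sv eps eps0; split; last by case: (sv eps eps0).
    apply: (hdel eps _ _ eps0 _ (sv eps eps0)).
    by near: eps; exact: nbhs_right_le.
  have [K K0 hK] := vd_le_gnorm.
  split.
  + apply/cvg_ballP => e e0.
    have e1 : 0 < e ^+ 2 / (2 * (K + 1)) by rewrite divr_gt0 ?exprn_gt0 ?mulr_gt0 ?ltr_wpDl.
    near=> eps; have [g1 av] : gnorm (comb (v eps) (-1) w) <= e ^+ 2 / (2 * (K + 1)) /\ adm (v eps).
      by near: eps; exact: near_le.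
    split=> // i j; rewrite (ord1 j) /ball /= distrC.
    have h1 := hK _ (adm_comb (-1) av aw).
    have h2 := le_sqr_dotv (vd (comb (v eps) (-1) w)) i.
    have h3 := le_trans h2 (le_trans h1 (ler_wpM2l K0 g1)).
    rewrite -(@ltr_pXn2r _ 2)// ?nnegrE ?(ltW e0)// real_normK ?num_real//.
    have -> : d_ eps i 0 - vd w i 0 = vd (comb (v eps) (-1) w) i 0 by rewrite /= !mxE mulN1r.
    apply: le_lt_trans h3 _; rewrite mulrCA gtr_pMr ?exprn_gt0//.
    by rewrite ltr_pdivrMr ?mul1r ?mulr_gt0 ?ltr_wpDl//; lra.
  + apply/cvgrPdist_le => e e0.
    near=> eps; have [g1 av] : gnorm (comb (v eps) (-1) w) <= e ^+ 2 /\ adm (v eps).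
      by near: eps; apply: near_le; rewrite exprn_gt0.
    rewrite sub0r normrN ger0_norm ?sqrtr_ge0//; apply: L2norm_le; first exact: ltW.
    apply: le_trans g1; have [+ _ _ _ _] := gnorm_ge (comb (v eps) (-1) w).
    apply: le_trans; rewrite le_eqVlt; apply/orP; left; apply/eqP; apply: ip_eq => t _.
    by rewrite /= scaleN1r.
  + apply/cvgrPdist_le => e e0.
    near=> eps; have [g1 av] : gnorm (comb (v eps) (-1) w) <= e ^+ 2 /\ adm (v eps).
      by near: eps; apply: near_le; rewrite exprn_gt0.
    rewrite sub0r normrN ger0_norm ?sqrtr_ge0//; apply: L2norm_le; first exact: ltW.
    apply: le_trans g1; have [_ + _ _ _] := gnorm_ge (comb (v eps) (-1) w).
    apply: le_trans; rewrite le_eqVlt; apply/orP; left; apply/eqP; apply: ip_eq => t _.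
    by rewrite /= scaleN1r.
- have ae0 := ip_eq0 hp p0.
  have hw : L2 (fun t => - ((C t)^T *m vz w t) + (H t)^T *m vu w t).
    exact: (L2D (L2N (L2_CT hz)) (L2_HT hu)).
  have rz' : rep (fun t => F^T *m vz w t) (fun t => - ((C t)^T *m vz w t) + (H t)^T *m vu w t) (vg w).
    apply: (rep_ae rz hw); first exact: ae_eq_refl.
    by apply: filterS ae0 => t ht Dt; rewrite ht// addr0.
  have [Hz dz gz] := acrep_rep ab rz'.
  by split; [exact: Hz|exact: dz|rewrite (gz b (bD ab)) gb].
rewrite (Omega_energy aw).
have up : (sig l (vu w) <= (energy w w)%:E)%E := sigma_le aw (ip_eq0 hp p0) gb.
have dn u : L2 u -> ((energy w w)%:E <= sig l u)%E.
  move=> hu'; have h M : (sig l u <= M%:E)%E -> energy w w <= M := low u M hu'.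
  case: (sig l u) h => [r||] h; first by rewrite lee_fin; apply: h.
    by rewrite leey.
  have {}h : energy w w <= -1 by apply: h; exact: leNye.
  by have := le_trans (energy_ge0 w) h; rewrite oppr_ge0 ler10.
have hat : sigma_hat a b F C H Q0 Q Rn l = (energy w w)%:E.
  apply/eqP; rewrite eq_le; apply/andP; split.
    by apply: le_trans up; apply: ereal_inf_lbound; exists (vu w).
  by apply: le_ereal_inf_tmp => _ [u hu' <-]; exact: dn.
split=> //; split; first exact: hu.
by rewrite hat; apply/eqP; rewrite eq_le up dn.
Unshelve. all: by end_near.
Qed.

End Core.

Theorem proposition4 (R : realType) (m n q : nat) (t0 T : R)
  (F : 'M[R]_(m, n)) (C : R -> 'M[R]_(m, n)) (H : R -> 'M[R]_(q, n))
  (Q0 : 'M[R]_m) (Q : R -> 'M[R]_m) (Rn : R -> 'M[R]_q)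
  (t0_lt_T : t0 < T)
  (C_cont : {within `[t0, T], continuous C})
  (H_cont : {within `[t0, T], continuous H})
  (Q0_pd : sym_posdef Q0)
  (Q_pd : forall t, t \in `[t0, T] -> sym_posdef (Q t))
  (Rn_pd : forall t, t \in `[t0, T] -> sym_posdef (Rn t))
  (Q_cont : {within `[t0, T], continuous Q})
  (Qinv_cont : {within `[t0, T], continuous (fun t => invmx (Q t))})
  (Rn_cont : {within `[t0, T], continuous Rn})
  (Rninv_cont : {within `[t0, T], continuous (fun t => invmx (Rn t))}) :
  (forall (eps : R) (l : 'cV[R]_m), 0 < eps ->
    (exists u p z d, bvp_solution t0 T F C H Q0 Q Rn l eps u p z d) /\
    (forall u p z d u' p' z' d',
      bvp_solution t0 T F C H Q0 Q Rn l eps u p z d ->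
      bvp_solution t0 T F C H Q0 Q Rn l eps u' p' z' d' ->
      [/\ ae_eq lebesgue_measure `[t0, T]%classic u u',
          ae_eq lebesgue_measure `[t0, T]%classic p p',
          ae_eq lebesgue_measure `[t0, T]%classic z z'
        & d = d'])) /\
  (forall l : 'cV[R]_m, minimax_observable t0 T F C H Q0 Q Rn l ->
    exists (dh : 'cV[R]_m) (uh : R -> 'cV[R]_q) (zh : R -> 'cV[R]_m),
      [/\ L2 t0 T uh /\ L2 t0 T zh,
          forall (u_ : R -> R -> 'cV[R]_q) (p_ : R -> R -> 'cV[R]_n)
                 (z_ : R -> R -> 'cV[R]_m) (d_ : R -> 'cV[R]_m),
            (forall eps, 0 < eps ->
              bvp_solution t0 T F C H Q0 Q Rn l eps
                (u_ eps) (p_ eps) (z_ eps) (d_ eps)) ->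
            [/\ d_ eps @[eps --> 0^'+] --> dh,
                L2norm t0 T (fun t => u_ eps t - uh t)
                  @[eps --> 0^'+] --> (0 : R)
              & L2norm t0 T (fun t => z_ eps t - zh t)
                  @[eps --> 0^'+] --> (0 : R)],
          [/\ in_H1 t0 T (fun t => F^T *m zh t),
              ae_derive t0 T (acrep t0 T (fun t => F^T *m zh t))
                (fun t => - ((C t)^T *m zh t) + (H t)^T *m uh t)
            & acrep t0 T (fun t => F^T *m zh t) T = F^T *m l]
        & l_estimate t0 T F C H Q0 Q Rn l uh /\
          sigma_hat t0 T F C H Q0 Q Rn l =
            (Omega t0 T F Q0 Q Rn uh zh dh)%:E]).
Proof.
have C_b := bmx_continuous C_cont; have H_b := bmx_continuous H_cont.
have Q_b := bmx_continuous Q_cont; have Rn_b := bmx_continuous Rn_cont.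
have Qi_b := bmx_continuous Qinv_cont; have Ri_b := bmx_continuous Rninv_cont.
split=> [eps l e0|l hl].
  exact: (bvp_wellposed t0_lt_T F C_b H_b Q0_pd Q_pd Rn_pd Q_b Rn_b Qi_b Ri_b l e0).
exact: (minimax_limit t0_lt_T C_b H_b Q0_pd Q_pd Rn_pd Q_b Rn_b Qi_b Ri_b hl).
Qed.
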